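(* For each $p$ in an increasing sequence of positive integers tending to infinity, let $m=m(p)$ be a positive integer and let $X = X^{(p)}$ be a $p \times m$ random matrix whose columns are independent, and each column follows the block-independent model with blocks of sizes $d_j = d_j(p)$ (the same block partition for all columns of $X^{(p)}$), where $p=\sum_j d_j$. Assume that, as $p \to \infty$: (i) $p/m \to \lambda \in (0,\infty)$; (ii) $\max_j d_j = o(p)$; (iii) all entries of the random matrices $X^{(p)}$ have uniformly bounded fourth moments, i.e. $\sup_p \max_{i,k} \mathbb{E}(X^{(p)}_{ik})^4 < \infty$. Then, with probability $1$, the empirical spectral distribution of the sample covariance matrix $W = \frac{1}{m} X X^\mathsf{T}$ converges weakly to the Marchenko-Pastur distribution with parameter $\lambda$.
   Context: Block-independent model: a random vector $x \in \mathbb{R}^p$ follows the block-independent model with blocks of sizes $d_j$ if $\mathbb{E}x = 0$, $\mathbb{E} x x^\mathsf{T} = I_p$ (isotropy), and the coordinate index set $[p]$ is partitioned into disjoint blocks $I_1, I_2,\dots$ with $|I_j| = d_j$ such that the sub-vectors $(x_i)_{i \in I_j}$, $j=1,2,\dots$, are mutually independent (entries within the same block may be dependent). Empirical spectral distribution of a symmetric $p\times p$ matrix $W$ with eigenvalues $\lambda_1(W),\dots,\lambda_p(W)$: $F^W(x) = \frac{1}{p}\#\{1\le i\le p : \lambda_i(W) \le x\}$. Marchenko-Pastur distribution with parameter $\lambda\in(0,\infty)$: let $\lambda_\pm = (1\pm\sqrt{\lambda})^2$ and $f_\lambda(x) = \frac{1}{2\pi \lambda x}\sqrt{[(\lambda_+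 - x)(x-\lambda_-)]_+}$ for $x>0$. For $\lambda \le 1$ it is the probability distribution with density $f_\lambda$; for $\lambda > 1$ it is the probability distribution consisting of a point mass $1 - 1/\lambda$ at $0$ plus the absolutely continuous part with density $f_\lambda$. *)

(* Defs.v *)
From HB Require Import structures.
From mathcomp Require Import all_boot all_order all_algebra.
From mathcomp Require Import all_classical all_reals all_analysis.
Set Implicit Arguments. Unset Strict Implicit. Unset Printing Implicit Defensive.
Import Order.TTheory GRing.Theory Num.Theory.
Import numFieldNormedType.Exports.
Local Open Scope classical_set_scope.
Local Open Scope ring_scope.

Section Defs.
Context {R : realType}.

(** Mutual independence of groups of real random variables.
    X : I -> T -> R is a finite family of random variables and g : I -> J
    assigns each variable to a group; the random vectors
    (X i)_{g i = j}, j ranging over the groups, are mutually independent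
    iff the joint law factorizes on measurable rectangles (a pi-system
    generating the product sigma-algebra); taking B i = setT gives the
    product rule for every subfamily of groups. *)
Definition indep_groups {d} {T : measurableType d} (P : probability T R)
  (I : finType) (J : eqType) (X : I -> T -> R) (g : I -> J) : Prop :=
  forall B : I -> set R, (forall i, measurable (B i)) ->
    P (\bigcap_(i in [set: I]) (X i @^-1` B i)) =
    (\prod_(j <- undup [seq g i | i <- enum I])
        P (\bigcap_(i in [set i | g i = j]) (X i @^-1` B i)))%E.

(** Eigenvalues (with multiplicity) of a square real matrix whose
    characteristic polynomial splits over R (e.g. any symmetric matrix):
    a sequence s with char_poly A = prod_(r <- s) ('X - r).  The multiset
    is unique, so the spectral distribution below is well defined. *)
Definition eigenvalues n (A : 'M[R]_n) : seq R :=
  xget [::] [set s : seq R | char_poly A = \prod_(r <- s) ('X - r%:P)].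

Definition esd n (W : 'M[R]_n) (x : R) : R :=
  (count (fun r => r <= x) (eigenvalues W))%:R / n%:R.

Definition mp_density (lam x : R) : R :=
  let lp := (1 + Num.sqrt lam) ^+ 2 in
  let lm := (1 - Num.sqrt lam) ^+ 2 in
  if 0 < x then
    Num.sqrt (Num.max 0 ((lp - x) * (x - lm))) / (2 * pi * lam * x)
  else 0.

Definition mp_cdf (lam x : R) : R :=
  (if 1 < lam then (1 - lam^-1) * (0 <= x)%R%:R else 0) +
  fine (\int[@lebesgue_measure R]_(t in `]-oo, x]%classic) (mp_density lam t)%:E)%E.

Definition sample_cov p m (X : 'I_p -> 'I_m -> R) : 'M[R]_p :=
  (m%:R)^-1 *: ((\matrix_(i, k) X i k) *m (\matrix_(i, k) X i k)^T).

Definition max_block p (blk : 'I_p -> nat) : nat :=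
  \max_(i < p) #|[set i' : 'I_p | blk i' == blk i]|.

End Defs.

(* Main.v *)
Require Import Defs.
From HB Require Import structures.
From mathcomp Require Import all_boot all_order all_algebra.
From mathcomp Require Import all_classical all_reals all_analysis.
From mathcomp Require Import measurable_realfun ring lra.
From mathcomp Require spectral complex.
Import Order.TTheory GRing.Theory Num.Theory.
Import numFieldNormedType.Exports.
Local Open Scope classical_set_scope.
Local Open Scope ring_scope.

(** Everything is read off the resolvent traces s_n(t) = tr (W + t)^-1 / p at real t > 0,
    so no complex spectral parameter is needed.  Writing W as the sum of the rank-one terms
    x_k x_k^T / m, the Sherman-Morrison identity gives
    p - t tr (W + t)^-1 = sum_k q_k / (1 + q_k), where q_k is the quadratic form
    x_k^T (W_k + t)^-1 x_k / m and W_k omits the k-th column.  As x_k is independent of W_k,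
    the block structure bounds the variance of q_k by O((max block) p / m^2) = o(1), so q_k
    is close to (p / m) s_n(t), and s_n(t) is an approximate root of an equation whose unique
    nonnegative solution is the Stieltjes transform of the Marchenko-Pastur law at -t.  This
    gives convergence of the means without a rate; removing one column moves the trace by at
    most 1 / t, so a bounded-differences argument bounds the fourth central moment of s_n(t)
    by O(p^-2), which is summable and gives almost sure convergence for countably many t.
    Finally the values of the transform at t = 1 - 1 / (j + 2) determine the limits of the
    moments of y = 1 / (x + 1), and polynomials (1 - y^N)^M approximating indicators turn
    these into convergence of distribution functions. *)

Set Implicit Arguments.
Unset Strict Implicit.
Unset Printing Implicit Defensive.

(** * Decoupling of independent groups *)

Section vectors.
Context {R : realType} {I : finType}.

(** The hypothesis on the blocks is that their largest size is o(p), at no prescribed speed, so the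
    estimate that identifies the limit of the mean of s_n(t) is not summable. Concentration around
    the mean is therefore a separate argument, resting on the independence of the columns and on the
    bound 1/t for the effect of one column. There the variance would only be O(1/p), not summable
    when p_n grows like n; the fourth moment is the first even one to give a summable bound. The
    shifts 1 - s with s = 1 / (j + 2) are chosen because 1 / (x + 1 - s) is a power series in s
    whose coefficients are the powers of y; as these s accumulate at 0, the moments can be recovered
    one after the other. Independence is given on rectangles only. It is first transferred to laws
    on a product space, where a sample may be replaced by a mixture of two independent samples;
    conditional expectations then become integrals over one of the copies. *)

Definition rectangles : set (set (I -> R)) :=
  [set A | exists2 B : I -> set R,
    (forall i, measurable (B i)) & A = [set x | forall i, B i (x i)]].

(** The space of samples with its product sigma-algebra, presented by the very rectangles on which
    [indep_groups] states the product rule. *)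
Definition vec := g_sigma_algebraType rectangles.

Lemma rectangles_setI : setI_closed rectangles.
Proof.
move=> A1 A2 [B1 mB1 ->] [B2 mB2 ->].
exists (fun i => B1 i `&` B2 i); first by move=> i; exact: measurableI.
apply/seteqP; split=> [x [h1 h2] i|x h]; first by split.
by split=> i; case: (h i).
Qed.

Lemma measurable_coord (i : I) : measurable_fun [set: vec] (fun x : vec => x i).
Proof.
move=> _ B mB; rewrite setTI; apply: sub_sigma_algebra.
exists (fun j => if j == i then B else setT); first by move=> j; case: ifP.
apply/seteqP; split=> [x /= Bx j|x /= /(_ i)]; last by rewrite eqxx.
by case: eqP => [->|].
Qed.

Lemma measurable_vec d (T : measurableType d) (f : T -> vec) :
  (forall i, measurable_fun [set: T] (fun w => f w i)) ->
  measurable_fun [set: T] f.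
Proof.
move=> mf; refine (@measurability _ _ T vec setT f rectangles _ _); first by [].
move=> _ [_ [B mB ->] <-]; rewrite setTI.
have -> : f @^-1` [set x | forall i, B i (x i)] =
    \bigcap_(i in [set: I]) ((fun w => f w i) @^-1` B i).
  by apply/seteqP; split=> [x h i _|x h i]; [exact: h | exact: (h i Logic.I)].
apply: fin_bigcap_measurable => // i _.
by rewrite -[X in measurable X]setTI; exact: mf.
Qed.

End vectors.
Arguments vec R I : clear implicits.

Section decoupling.
Context {R : realType} {d : measure_display} {T : measurableType d}.
Variable P : probability T R.
Variables (I : finType) (J : eqType) (X : I -> T -> R) (g : I -> J) (S : pred J).
Hypothesis mX : forall i, measurable_fun setT (X i).
Hypothesis indX : indep_groups P X g.

Let sample (w : T) : vec R I := fun i => X i w.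

(** Groups selected by [S] are read from the first copy of the probability space, all others from an
    independent second copy. *)
Definition mix (z : T * T) : vec R I :=
  fun i => if S (g i) then X i z.1 else X i z.2.

Let msample : measurable_fun setT sample.
Proof. exact: measurable_vec. Qed.

Lemma measurable_mix : measurable_fun setT mix.
Proof.
apply: measurable_vec => i; rewrite /mix; case: (S (g i)).
  exact: (measurableT_comp (mX i) measurable_fst).
exact: (measurableT_comp (mX i) measurable_snd).
Qed.

Let half (b : bool) (B : I -> set R) : set T :=
  \bigcap_(i in [set i | S (g i) = b]) (X i @^-1` B i).

Let mhalf b B : (forall i, measurable (B i)) -> measurable (half b B).
Proof.
move=> mB; apply: fin_bigcap_measurable => // i _.
by rewrite -[X in measurable X]setTI; exact: mX.
Qed.

Let prob_half b B : (forall i, measurable (B i)) ->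
  (P (half b B) = \prod_(j <- undup [seq g i | i <- enum I] | S j == b)
    P (\bigcap_(i in [set i | g i = j]) (X i @^-1` B i)))%E.
Proof.
move=> mB.
(* Enlarging the sets of the other half to [setT] makes their factors equal to 1, which leaves the
   product rule for one half. *)
have := @indX (fun i => if S (g i) == b then B i else setT).
have -> : \bigcap_(i in [set: I]) (X i @^-1` (if S (g i) == b then B i else setT))
    = half b B.
  apply/seteqP; split=> [w h i /= /eqP Sib|w h i _ /=].
    by have := h i Logic.I; rewrite /= Sib.
  by case: eqP => // Sib; exact: h.
move=> /= ->; last by move=> i; case: ifP.
rewrite [RHS]big_mkcond /=; apply: eq_bigr => j _.
case: ifP => Sj.
  congr (P _); apply/seteqP; split=> [w h i /= gi|w h i /= gi].
    by have := h i gi; rewrite gi Sj.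
  by rewrite gi Sj; exact: h.
rewrite (_ : \bigcap_(i in _) _ = setT) ?probability_setT//.
by apply/seteqP; split=> // w _ i /= gi; rewrite gi Sj.
Qed.

Let prob_rect (B : I -> set R) : (forall i, measurable (B i)) ->
  P (\bigcap_(i in [set: I]) (X i @^-1` B i)) = (P (half true B) * P (half false B))%E.
Proof.
move=> mB; rewrite indX// !prob_half// (bigID (fun j => S j == true)) /=.
by congr (_ * _)%E; apply: eq_bigl => j; case: (S j).
Qed.

(** On a rectangle both laws give the product of the probabilities of the two halves. Rectangles are
    stable under intersection and generate the sigma-algebra, so the two finite measures
    coincide. *)
Lemma mix_law (A : set (vec R I)) : measurable A ->
  P (sample @^-1` A) = (P \x P)%E (mix @^-1` A).
Proof.
move=> mA.
pose law1 : {measure set (vec R I) -> \bar R} := pushforward P sample.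
pose law2 : {measure set (vec R I) -> \bar R} := pushforward (P \x P)%E mix.
pose mu1 := law1 msample; pose mu2 := law2 measurable_mix.
suff : mu1 A = mu2 A by [].
apply: (@measure_unique _ R (vec R I) rectangles (fun=> setT) _ _ _ _ mu1 mu2) => //.
- exact: rectangles_setI.
- by move=> _; exists (fun=> setT) => //; apply/seteqP; split.
- by apply/seteqP; split=> // x _; exists 0%N.
- move=> _ [B mB ->]; change (P (sample @^-1` [set x | forall i, B i (x i)]) =
    (P \x P)%E (mix @^-1` [set x | forall i, B i (x i)])).
  have -> : sample @^-1` [set x | forall i, B i (x i)] =
      \bigcap_(i in [set: I]) (X i @^-1` B i).
    by apply/seteqP; split=> [w h i _|w h i]; [exact: h|exact: (h i Logic.I)].
  have -> : mix @^-1` [set x | forall i, B i (x i)] = half true B `*` half false B.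
    apply/seteqP; split=> [[w w'] h|[w w'] [h1 h2] i].
      by split=> i /= Si; have := h i; rewrite /= /mix Si.
    by rewrite /= /mix; case: ifP => Si; [exact: h1|exact: h2].
  by rewrite prob_rect// product_measure1E//; exact: mhalf.
- by move=> _; change (P (sample @^-1` setT) < +oo)%E; rewrite preimage_setT probability_setT ltry.
Qed.

(** Change of variables on both sides of [mix_law], then Tonelli. In the iterated integral the
    groups outside [S] are frozen at [w'] while those in [S] are integrated over [w]: this is how
    one conditions here. *)
Lemma decouple_ge0 (F : vec R I -> R) : measurable_fun setT F -> (forall x, 0 <= F x) ->
  (\int[P]_w (F (fun i => X i w))%:E =
   \int[P]_w' \int[P]_w (F (mix (w, w')))%:E)%E.
Proof.
move=> mF F0.
pose law1 : {measure set (vec R I) -> \bar R} := pushforward P sample.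
pose law2 : {measure set (vec R I) -> \bar R} := pushforward (P \x P)%E mix.
pose mu1 := law1 msample; pose mu2 := law2 measurable_mix.
have mFE : measurable_fun [set: vec R I] (fun x : vec R I => (F x)%:E) by exact/measurable_EFinP.
transitivity (\int[mu1]_x (F x)%:E)%E.
  rewrite (ge0_integral_pushforward msample _ measurableT mFE) ?preimage_setT//.
  by move=> x _; rewrite lee_fin.
transitivity (\int[mu2]_x (F x)%:E)%E.
  by apply: eq_measure_integral => A mA _; exact: mix_law.
rewrite (ge0_integral_pushforward measurable_mix _ measurableT mFE) ?preimage_setT//; last first.
  by move=> x _; rewrite lee_fin.
by rewrite fubini_tonelli2// => [|x]; [exact: measurableT_comp measurable_mix|rewrite lee_fin].
Qed.

(** The nonnegative case applied to the absolute value of [F] gives integrability on the product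
    space; Fubini then replaces Tonelli. *)
Lemma decouple (F : vec R I -> R) : measurable_fun setT F ->
  P.-integrable setT (fun w => (F (fun i => X i w))%:E) ->
  (P \x P)%E.-integrable setT (fun z => (F (mix z))%:E) /\
  (\int[P]_w (F (fun i => X i w))%:E =
   \int[P]_w' \int[P]_w (F (mix (w, w')))%:E)%E.
Proof.
move=> mF iF.
pose law1 : {measure set (vec R I) -> \bar R} := pushforward P sample.
pose law2 : {measure set (vec R I) -> \bar R} := pushforward (P \x P)%E mix.
pose mu1 := law1 msample; pose mu2 := law2 measurable_mix.
have mFE : measurable_fun [set: vec R I] (fun x : vec R I => (F x)%:E) by exact/measurable_EFinP.
have mFm : measurable_fun setT (fun z => (F (mix z))%:E).
  exact: (measurableT_comp mFE measurable_mix).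
have imix : (P \x P)%E.-integrable setT (fun z => (F (mix z))%:E).
  apply/integrableP; split=> //.
  rewrite fubini_tonelli2//; last exact: measurableT_comp.
  have /integrableP[_] := iF; rewrite /=.
  by rewrite (@decouple_ge0 (fun x => `|F x|))//; exact: measurableT_comp.
split=> //.
transitivity (\int[mu1]_x (F x)%:E)%E.
  by rewrite (integral_pushforward msample mFE _ measurableT) ?preimage_setT.
transitivity (\int[mu2]_x (F x)%:E)%E.
  by apply: eq_measure_integral => A mA _; exact: mix_law.
rewrite (integral_pushforward measurable_mix mFE _ measurableT) ?preimage_setT//.
by rewrite -integral21_prod_meas1.
Qed.

End decoupling.

(** * Expectations of real random variables *)

Section expectation.
Context {R : realType} {d : measure_display} {T : measurableType d}.
Variable P : probability T R.
Implicit Types f g : T -> R.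

Local Notation itg f := (P.-integrable setT (fun w => (f w)%:E)).
Local Notation Ex f := (\int[P]_w f w)%R.

Lemma itg_measurable f : itg f -> measurable_fun setT f.
Proof. by case/integrableP => /measurable_EFinP. Qed.

Lemma itg_le f g : measurable_fun setT f -> (forall w, `|f w| <= g w) -> itg g -> itg f.
Proof.
move=> mf fg ig; apply: le_integrable ig => //; first exact/measurable_EFinP.
by move=> w _ /=; rewrite lee_fin (le_trans (fg w))// ler_norm.
Qed.

Lemma itg_cst (c : R) : itg (fun=> c).
Proof. exact: finite_measure_integrable_cst. Qed.

Lemma itg_bounded f (C : R) : measurable_fun setT f -> (forall w, `|f w| <= C) -> itg f.
Proof. by move=> mf fC; apply: (itg_le mf fC); exact: itg_cst. Qed.

Lemma itgD f g : itg f -> itg g -> itg (fun w => f w + g w).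
Proof. by move=> h1 h2; have := integrableD measurableT h1 h2. Qed.

Lemma itgB f g : itg f -> itg g -> itg (fun w => f w - g w).
Proof. by move=> h1 h2; have := integrableB measurableT h1 h2. Qed.

Lemma itgZ (c : R) f : itg f -> itg (fun w => c * f w).
Proof. by move=> h; have := integrableZl measurableT c h. Qed.

Lemma itg_sum (I : Type) (r : seq I) (Q : pred I) (F : I -> T -> R) :
  (forall i, Q i -> itg (F i)) -> itg (fun w => \sum_(i <- r | Q i) F i w).
Proof.
move=> h; elim: r => [|i r IH].
  by under eq_fun do rewrite big_nil; exact: itg_cst.
under eq_fun do rewrite big_cons; case Qi: (Q i) => //.
by apply: itgD => //; exact: h.
Qed.

Lemma Ex_cst (c : R) : Ex (fun=> c) = c.
Proof.
rewrite (@Rintegral_cst _ _ _ P setT measurableT c) -[RHS]mulr1.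
by congr (_ * _); have /= -> := probability_setT P.
Qed.

Lemma ExD f g : itg f -> itg g -> Ex (fun w => f w + g w) = Ex f + Ex g.
Proof. exact: RintegralD. Qed.

Lemma ExB f g : itg f -> itg g -> Ex (fun w => f w - g w) = Ex f - Ex g.
Proof. exact: RintegralB. Qed.

Lemma ExZ (c : R) f : itg f -> Ex (fun w => c * f w) = c * Ex f.
Proof. exact: RintegralZl. Qed.

Lemma Ex_sum (I : Type) (r : seq I) (Q : pred I) (F : I -> T -> R) :
  (forall i, Q i -> itg (F i)) ->
  Ex (fun w => \sum_(i <- r | Q i) F i w) = \sum_(i <- r | Q i) Ex (F i).
Proof.
move=> h; elim: r => [|i r IH].
  by rewrite big_nil -[RHS]Ex_cst; apply: eq_Rintegral => w _; rewrite big_nil.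
rewrite big_cons; case: ifP => Qi.
  rewrite -IH -ExD; [|exact: h|exact: itg_sum].
  by apply: eq_Rintegral => w _; rewrite big_cons Qi.
by rewrite -IH; apply: eq_Rintegral => w _; rewrite big_cons Qi.
Qed.

Lemma Ex_le f g : itg f -> itg g -> (forall w, f w <= g w) -> Ex f <= Ex g.
Proof. by move=> h1 h2 fg; apply: le_Rintegral. Qed.

Lemma Ex_ge0 f : (forall w, 0 <= f w) -> 0 <= Ex f.
Proof. by move=> f0; apply: Rintegral_ge0. Qed.

Lemma EFin_Ex f : itg f -> (\int[P]_w (f w)%:E = (Ex f)%:E)%E.
Proof. by move=> h; rewrite /Rintegral fineK//; exact: integrable_fin_num. Qed.

Lemma itg_ge0 f (C : R) : measurable_fun setT f -> (forall w, 0 <= f w) ->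
  (\int[P]_w (f w)%:E <= C%:E)%E -> itg f /\ Ex f <= C.
Proof.
move=> mf f0 fC.
have h : itg f.
  apply/integrableP; split; first exact/measurable_EFinP.
  under eq_integral do rewrite /= ger0_norm//.
  by rewrite (le_lt_trans fC)// ltry.
by split=> //; rewrite -lee_fin -EFin_Ex.
Qed.

End expectation.

Section indep_product.
Context {R : realType} {d : measure_display} {T : measurableType d}.
Variable P : probability T R.
Variables (I : finType) (J : eqType) (X : I -> T -> R) (g : I -> J).
Hypothesis mX : forall i, measurable_fun setT (X i).
Hypothesis indX : indep_groups P X g.

Local Notation itg f := (P.-integrable setT (fun w => (f w)%:E)).
Local Notation Ex f := (\int[P]_w f w)%R.

(** After decoupling, [u] sees only the first copy and [v] only the second, so the iterated integral
    splits into a product. *)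
Lemma indep_ExM (S : pred J) (u v : vec R I -> R) :
  measurable_fun setT u -> measurable_fun setT v ->
  (forall x y, (forall i, S (g i) -> x i = y i) -> u x = u y) ->
  (forall x y, (forall i, ~~ S (g i) -> x i = y i) -> v x = v y) ->
  let U := fun w => u (fun i => X i w) in
  let V := fun w => v (fun i => X i w) in
  itg U -> itg V -> itg (fun w => U w * V w) ->
  Ex (fun w => U w * V w) = Ex U * Ex V.
Proof.
move=> mu mv du dv U V iU iV iUV.
rewrite {1}/Rintegral.
have [_] := @decouple R d T P I J X g S mX indX (fun x => u x * v x)
  (measurable_funM mu mv) iUV.
rewrite -/(U _) => ->.
rewrite (_ : (fun w' => _) = (fun w' => (Ex U)%:E * (V w')%:E)%E).
  by rewrite integralZl// EFin_Ex// -EFinM.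
apply/funext => w'.
rewrite (_ : (fun w => _) = (fun w => (U w)%:E * (V w')%:E)%E).
  by rewrite integralZr// EFin_Ex.
apply/funext => w; rewrite -EFinM /U /V; congr (_ * _)%:E.
  by apply: du => i Si; rewrite /mix /= Si.
by apply: dv => i /negbTE Si; rewrite /mix /= Si.
Qed.

End indep_product.

(** * Variance of quadratic forms *)

Lemma sqr_sum_le (R : realFieldType) (I : finType) (Q : pred I) (u : I -> R) :
  (\sum_(i | Q i) u i) ^+ 2 <= #|Q|%:R * \sum_(i | Q i) u i ^+ 2.
Proof.
have -> : (\sum_(i | Q i) u i) ^+ 2 = \sum_(i | Q i) \sum_(j | Q j) u i * u j.
  by rewrite expr2 big_distrlr.
have -> : #|Q|%:R * \sum_(i | Q i) u i ^+ 2 =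
    \sum_(i | Q i) \sum_(j | Q j) (u i ^+ 2 + u j ^+ 2) / 2.
  transitivity (\sum_(i | Q i) \sum_(j | Q j) (u i ^+ 2 / 2) +
                \sum_(i | Q i) \sum_(j | Q j) (u j ^+ 2 / 2)).
    rewrite [X in _ = X + _]exchange_big /= -mulr2n sumr_const -mulr_suml.
    by rewrite -[RHS]mulr_natr -[X in _ = X * _]mulr_natl; lra.
  rewrite -big_split /=; apply: eq_bigr => i _; rewrite -big_split /=.
  by apply: eq_bigr => j _; rewrite mulrDl.
apply: ler_sum => i _; apply: ler_sum => j _.
rewrite -subr_ge0 (_ : _ - _ = (u i - u j) ^+ 2 / 2); last by field.
by rewrite divr_ge0// sqr_ge0.
Qed.

(** The arithmetic-geometric inequality without its factor 1/4. With some arguments equal to 1 it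
    makes products of fewer variables integrable from fourth moments alone. *)
Lemma norm_prod4_le (R : realFieldType) (a b c e : R) :
  `|a * b * c * e| <= a ^+ 4 + b ^+ 4 + c ^+ 4 + e ^+ 4.
Proof.
rewrite ler_norml; apply/andP; split.
  rewrite -subr_ge0 (_ : _ - _ = ((a * b + c * e) ^+ 2 / 2 + (a^+2 - b^+2)^+2 / 4 +
    (c^+2 - e^+2)^+2 / 4) + (a ^+ 4 + b ^+ 4 + c ^+ 4 + e ^+ 4) * (3 / 4)); last by field.
  have := exprn_even_ge0 a (n:=4) isT; have := exprn_even_ge0 b (n:=4) isT.
  have := exprn_even_ge0 c (n:=4) isT; have := exprn_even_ge0 e (n:=4) isT.
  have := sqr_ge0 (a * b + c * e); have := sqr_ge0 (a^+2 - b^+2); have := sqr_ge0 (c^+2 - e^+2).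
  lra.
rewrite -subr_ge0 (_ : _ - _ = ((a * b - c * e) ^+ 2 / 2 + (a^+2 - b^+2)^+2 / 4 +
    (c^+2 - e^+2)^+2 / 4) + (a ^+ 4 + b ^+ 4 + c ^+ 4 + e ^+ 4) * (3 / 4)); last by field.
have := exprn_even_ge0 a (n:=4) isT; have := exprn_even_ge0 b (n:=4) isT.
have := exprn_even_ge0 c (n:=4) isT; have := exprn_even_ge0 e (n:=4) isT.
have := sqr_ge0 (a * b - c * e); have := sqr_ge0 (a^+2 - b^+2); have := sqr_ge0 (c^+2 - e^+2).
lra.
Qed.

Section quadratic_form.
Context {R : realType} {d : measure_display} {T : measurableType d}.
Variable P : probability T R.
Variables (p : nat) (x : 'I_p -> T -> R) (blk : 'I_p -> nat) (C : R).
Hypothesis mx : forall i, measurable_fun setT (x i).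
Hypothesis indx : indep_groups P x blk.

Local Notation itg f := (P.-integrable setT (fun w => (f w)%:E)).
Local Notation Ex f := (\int[P]_w f w)%R.

Hypothesis Ex1 : forall i, Ex (x i) = 0.
Hypothesis Ex2 : forall i j, Ex (fun w => x i w * x j w) = (i == j)%:R.
Hypothesis itg4 : forall i, itg (fun w => x i w ^+ 4).
Hypothesis Ex4 : forall i, Ex (fun w => x i w ^+ 4) <= C.

Let itg_prod4 i j k l : itg (fun w => x i w * x j w * x k w * x l w).
Proof.
apply: (@itg_le _ _ _ _ _ (fun w => x i w ^+ 4 + x j w ^+ 4 + x k w ^+ 4 + x l w ^+ 4)).
- by repeat apply: measurable_funM.
- by move=> w; exact: norm_prod4_le.
- by repeat apply: itgD.
Qed.

Let itg_prod3 j k l : itg (fun w => x j w * x k w * x l w).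
Proof.
apply: (@itg_le _ _ _ _ _ (fun w => 1 + x j w ^+ 4 + x k w ^+ 4 + x l w ^+ 4)).
- by repeat apply: measurable_funM.
- move=> w; have := norm_prod4_le 1 (x j w) (x k w) (x l w).
  by rewrite mul1r expr1n.
- by repeat apply: itgD => //; exact: itg_cst.
Qed.

Let itg_prod2 k l : itg (fun w => x k w * x l w).
Proof.
apply: (@itg_le _ _ _ _ _ (fun w => 1 + 1 + x k w ^+ 4 + x l w ^+ 4)).
- by repeat apply: measurable_funM.
- move=> w; have := norm_prod4_le 1 1 (x k w) (x l w).
  by rewrite !mul1r expr1n.
- by repeat apply: itgD => //; exact: itg_cst.
Qed.

Let itg_x k : itg (x k).
Proof.
apply: (@itg_le _ _ _ _ _ (fun w => 1 + 1 + 1 + x k w ^+ 4)) => //.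
- move=> w; have := norm_prod4_le 1 1 1 (x k w).
  by rewrite !mul1r expr1n.
- by repeat apply: itgD => //; exact: itg_cst.
Qed.

Let Ex_isolated i j k l : blk j != blk i -> blk k != blk i -> blk l != blk i ->
  Ex (fun w => x i w * (x j w * x k w * x l w)) = 0.
Proof.
move=> bj bk bl.
have := @indep_ExM R d T P 'I_p nat x blk mx indx (pred1 (blk i))
  (fun v => v i) (fun v => v j * v k * v l).
move=> /= ->; rewrite ?Ex1 ?mul0r//.
- exact: measurable_coord.
- by repeat apply: measurable_funM; exact: measurable_coord.
- by move=> u v; apply; rewrite eqxx.
- by move=> u v h; rewrite !h.
- by under eq_fun do rewrite !mulrA; exact: itg_prod4.
Qed.

Let Ex_pairs i j k l : blk k = blk i -> blk j != blk i -> blk l = blk j ->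
  Ex (fun w => (x i w * x k w) * (x j w * x l w)) = (i == k)%:R * (j == l)%:R.
Proof.
move=> bk bj bl.
have := @indep_ExM R d T P 'I_p nat x blk mx indx (pred1 (blk i))
  (fun v => v i * v k) (fun v => v j * v l).
move=> /= ->; rewrite ?Ex2//.
- by repeat apply: measurable_funM; exact: measurable_coord.
- by repeat apply: measurable_funM; exact: measurable_coord.
- by move=> u v h; rewrite !h ?bk ?eqxx.
- by move=> u v h; rewrite !h ?bl.
- by under eq_fun do rewrite !mulrA; exact: itg_prod4.
Qed.

(** Either [k] and [l] lie in the two distinct blocks of [i] and [j], one in each, and the
    expectation factors into two covariances; or one of [i], [j] is alone in its block and its zero
    mean kills the product. Dependence inside a block is seen only through covariances. *)
Lemma Ex_offdiag i j k l : blk i != blk j -> blk k != blk l ->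
  Ex (fun w => (x i w * x j w) * (x k w * x l w)) =
  (i == k)%:R * (j == l)%:R + (i == l)%:R * (j == k)%:R.
Proof.
move=> bij bkl.
have bji : blk j != blk i by rewrite eq_sym.
have neq u v : blk u != blk v -> (u == v) = false.
  by move=> h; apply/negbTE; apply: contraNN h => /eqP ->.
have [ik|ik] := eqVneq (blk k) (blk i).
  have il : blk i != blk l by rewrite -ik.
  have [jl|jl] := eqVneq (blk l) (blk j).
    rewrite (neq _ _ il) mul0r addr0 -(Ex_pairs ik bji jl).
    by apply: eq_Rintegral => w _; ring.
  have jk : blk k != blk j by rewrite ik.
  rewrite ![j == _]eq_sym (neq _ _ jl) (neq _ _ jk) !mulr0 addr0 -(Ex_isolated bij jk jl).
  by apply: eq_Rintegral => w _; ring.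
have [il|il] := eqVneq (blk l) (blk i).
  have [jk|jk] := eqVneq (blk k) (blk j).
    rewrite [i == k]eq_sym (neq _ _ ik) mul0r add0r -(Ex_pairs il bji jk).
    by apply: eq_Rintegral => w _; ring.
  have jl : blk l != blk j by rewrite il.
  rewrite ![j == _]eq_sym (neq _ _ jl) (neq _ _ jk) !mulr0 addr0 -(Ex_isolated bij jk jl).
  by apply: eq_Rintegral => w _; ring.
rewrite ![i == _]eq_sym (neq _ _ ik) (neq _ _ il) !mul0r addr0.
rewrite -(Ex_isolated bji ik il).
by apply: eq_Rintegral => w _; ring.
Qed.

Variables (A : 'M[R]_p) (kap : R).
Hypothesis kap0 : 0 <= kap.
Hypothesis A_psd : forall v : 'I_p -> R, 0 <= \sum_i \sum_j A i j * (v i * v j) <=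
  kap * \sum_i v i ^+ 2.
Hypothesis A_frob : \sum_i \sum_j A i j ^+ 2 <= p%:R * kap ^+ 2.

Let offd w := \sum_(ij : 'I_p * 'I_p | blk ij.1 != blk ij.2) A ij.1 ij.2 * (x ij.1 w * x ij.2 w).

Let itg_offd2 : itg (fun w => offd w ^+ 2).
Proof.
under eq_fun do rewrite expr2 big_distrlr /=.
apply: itg_sum => ij _; apply: itg_sum => kl _.
rewrite (_ : (fun w => _) = (fun w => ((A ij.1 ij.2 * A kl.1 kl.2) *
  (x ij.1 w * x ij.2 w * x kl.1 w * x kl.2 w))%:E)); last first.
  by apply/funext => w; congr EFin; rewrite ?/sample; ring.
exact: itgZ.
Qed.

Let Ex_offd2 : Ex (fun w => offd w ^+ 2) <= 2 * p%:R * kap ^+ 2.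
Proof.
have -> : Ex (fun w => offd w ^+ 2) =
  \sum_(ij : 'I_p * 'I_p | blk ij.1 != blk ij.2) \sum_(kl : 'I_p * 'I_p | blk kl.1 != blk kl.2)
   A ij.1 ij.2 * A kl.1 kl.2 *
   ((ij.1 == kl.1)%:R * (ij.2 == kl.2)%:R + (ij.1 == kl.2)%:R * (ij.2 == kl.1)%:R).
  under eq_Rintegral do rewrite expr2 big_distrlr /=.
  have itm ij kl : itg (fun w => A ij.1 ij.2 * (x ij.1 w * x ij.2 w) *
      (A kl.1 kl.2 * (x kl.1 w * x kl.2 w))).
    rewrite (_ : (fun w => _) = (fun w => ((A ij.1 ij.2 * A kl.1 kl.2) *
      (x ij.1 w * x ij.2 w * x kl.1 w * x kl.2 w))%:E)); last first.
  by apply/funext => w; congr EFin; rewrite ?/sample; ring.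
    exact: itgZ.
  rewrite Ex_sum => [|ij _]; last by apply: itg_sum => kl _; exact: itm.
  apply: eq_bigr => ij bij; rewrite Ex_sum => [|kl _]; last exact: itm.
  apply: eq_bigr => kl bkl; rewrite -Ex_offdiag// -ExZ.
    by apply: eq_Rintegral => w _; ring.
  by under eq_fun do rewrite !mulrA; exact: itg_prod4.
(* For each pair only the pair itself and its transpose survive, giving A_ij^2 + A_ij A_ji. The
   cross term is at most the mean of the two squares, and the sum over all pairs is then twice the
   squared Frobenius norm. *)
apply: (@le_trans _ _ (\sum_(ij : 'I_p * 'I_p) (A ij.1 ij.2 ^+ 2 +
    (A ij.1 ij.2 ^+ 2 + A ij.2 ij.1 ^+ 2) / 2))).
  rewrite [X in _ <= X](bigID (fun ij => blk ij.1 != blk ij.2)) /=.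
  rewrite -[X in X <= _]addr0 lerD//; last first.
    by apply: sumr_ge0 => ij _; rewrite addr_ge0 ?divr_ge0 ?addr_ge0 ?sqr_ge0.
  apply: ler_sum => -[i j] /= bij.
  rewrite (bigD1 (i, j))//= (bigD1 (j, i))//=; last first.
    rewrite eq_sym bij /= -pair_eqE /= negb_and; apply/orP; left.
    by apply: contraNN bij => /eqP ->.
  rewrite big1 => [|[k l] /= /andP[/andP[_ n1] n2]].
    rewrite !eqxx addr0.
    have -> : (i == j) = false by apply: contraNF bij => /eqP ->.
    have -> : (j == i) = false by apply: contraNF bij => /eqP ->.
    rewrite !mul0r !mulr1 addr0 add0r !mulr1.
    rewrite -subr_ge0 (_ : _ - _ = (A i j - A j i) ^+ 2 / 2); last by field.
    by rewrite divr_ge0// sqr_ge0.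
  move: n1 n2; rewrite -!pair_eqE /= ![k == _]eq_sym ![l == _]eq_sym.
  case: (i == k); case: (j == l); case: (j == k); case: (i == l) => //= _ _;
    by rewrite ?(mul0r, mulr0, addr0).
rewrite -(pair_bigA _ (fun i j => A i j ^+ 2 + (A i j ^+ 2 + A j i ^+ 2) / 2)) /=.
under eq_bigr do rewrite big_split /= -mulr_suml big_split /=.
rewrite big_split /= -mulr_suml big_split /= [X in (_ + X) / 2]exchange_big /=.
have := A_frob; lra.
Qed.

Let K := (\max_(i < p) blk i).+1.

Let ltK i : (blk i < K)%N.
Proof. by rewrite ltnS; exact: (leq_bigmax i). Qed.

Let form (a : nat) (v : vec R 'I_p) : R :=
  \sum_(ij : 'I_p * 'I_p | (blk ij.1 == a) && (blk ij.2 == a)) A ij.1 ij.2 * (v ij.1 * v ij.2).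

Let btr (a : nat) := \sum_(i | blk i == a) A i i.

Let sample w : vec R 'I_p := fun i => x i w.

Let mform a : measurable_fun setT (form a).
Proof.
have -> : form a = (fun v => \sum_(ij : 'I_p * 'I_p)
    if (blk ij.1 == a) && (blk ij.2 == a) then A ij.1 ij.2 * (v ij.1 * v ij.2) else 0).
  by apply/funext => v; rewrite /form big_mkcond.
apply: measurable_sum => ij; case: (_ && _); last exact: measurable_cst.
apply: measurable_funM; first exact: measurable_cst.
by apply: measurable_funM; exact: measurable_coord.
Qed.

Let itg_form a : itg (fun w => form a (sample w)).
Proof. by apply: itg_sum => ij _; apply: itgZ; exact: itg_prod2. Qed.

Let itg_formM a b : itg (fun w => form a (sample w) * form b (sample w)).
Proof.
under eq_fun do rewrite /form big_distrlr /=.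
apply: itg_sum => ij _; apply: itg_sum => kl _.
rewrite (_ : (fun w => _) = (fun w => ((A ij.1 ij.2 * A kl.1 kl.2) *
  (x ij.1 w * x ij.2 w * x kl.1 w * x kl.2 w))%:E)); last first.
  by apply/funext => w; congr EFin; rewrite ?/sample; ring.
exact: itgZ.
Qed.

Let Ex_form a : Ex (fun w => form a (sample w)) = btr a.
Proof.
rewrite /form Ex_sum => [|ij _]; last by apply: itgZ; exact: itg_prod2.
transitivity (\sum_(i | blk i == a) \sum_(j | blk j == a) A i j * (i == j)%:R).
  rewrite pair_big /=; apply: eq_bigr => -[i j] _ /=.
  by rewrite ExZ ?Ex2//; exact: itg_prod2.
apply: eq_bigr => i ai; rewrite (bigD1 i)//= eqxx mulr1 big1 ?addr0// => j /andP[_].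
by rewrite eq_sym => /negbTE ->; rewrite mulr0.
Qed.

Let Z a w := form a (sample w) - btr a.

Let itg_ZM a b : itg (fun w => Z a w * Z b w).
Proof.
rewrite (_ : (fun w => _) = (fun w => (form a (sample w) * form b (sample w) -
  (btr b * form a (sample w) + btr a * form b (sample w)) + btr a * btr b)%:E)); last first.
  by apply/funext => w; congr EFin; rewrite /Z; ring.
apply: itgD; last exact: itg_cst.
by apply: itgB => //; apply: itgD; exact: itgZ.
Qed.

Let Ex_ZM a b : a != b -> Ex (fun w => Z a w * Z b w) = 0.
Proof.
move=> ab.
have iZ c : itg (Z c) by apply: itgB => //; exact: itg_cst.
have EZ c : Ex (Z c) = 0 by rewrite /Z ExB ?Ex_form ?Ex_cst ?subrr//; exact: itg_cst.
have := @indep_ExM R d T P 'I_p nat x blk mx indx (pred1 a)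
  (fun v => form a v - btr a) (fun v => form b v - btr b).
have mZ c : measurable_fun setT (fun v => form c v - btr c).
  by apply: measurable_funB => //; exact: measurable_cst.
move=> /(_ (mZ a) (mZ b)) /= h.
rewrite {}h; first by rewrite [X in X * _]EZ mul0r.
- move=> u v h; congr (_ - _); apply: eq_bigr => -[i j] /= /andP[/eqP ai /eqP aj].
  by rewrite !h ?ai ?aj.
- move=> u v h; congr (_ - _); apply: eq_bigr => -[i j] /= /andP[/eqP ai /eqP aj].
  by rewrite !h ?ai ?aj 1?eq_sym.
- exact: iZ.
- exact: iZ.
- exact: itg_ZM.
Qed.

Let bsize (a : nat) := #|[pred i | blk i == a]|.

(** Nothing is known of the dependence inside a block, so only the norm of [A] is used: testing
    [A_psd] on the sample restricted to the block bounds the form by kap times a sum of squares, and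
    Cauchy-Schwarz turns the square of that into the block size times a sum of fourth powers. *)
Let Ex_Z2 a : Ex (fun w => Z a w * Z a w) <= kap ^+ 2 * (bsize a)%:R ^+ 2 * C.
Proof.
have -> : Ex (fun w => Z a w * Z a w) =
    Ex (fun w => form a (sample w) * form a (sample w)) - btr a ^+ 2.
  transitivity (Ex (fun w => form a (sample w) * form a (sample w) -
      (2 * btr a * form a (sample w) - btr a ^+ 2))).
    by apply: eq_Rintegral => w _; rewrite /Z; ring.
  have ic : itg (fun=> btr a ^+ 2) by exact: itg_cst.
  have i2 : itg (fun w => 2 * btr a * form a (sample w)) by exact: itgZ.
  have i3 := itgB i2 ic.
  rewrite (ExB (itg_formM a a) i3) (ExB i2 ic) ExZ// Ex_form Ex_cst; ring.
apply: (@le_trans _ _ (Ex (fun w => form a (sample w) * form a (sample w)))).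
  by rewrite gerBl sqr_ge0.
apply: (@le_trans _ _ (Ex (fun w => kap ^+ 2 * (bsize a)%:R *
    \sum_(i | blk i == a) x i w ^+ 4))).
  apply: Ex_le => //; first by apply: itgZ; apply: itg_sum.
  move=> w.
  pose v i := if blk i == a then x i w else 0.
  have /andP[] := A_psd v.
  have -> : \sum_i \sum_j A i j * (v i * v j) = form a (sample w).
    rewrite /form pair_bigA [RHS]big_mkcond /=; apply: eq_bigr => -[i j] _ /=.
    by rewrite /v; case: eqP; case: eqP => _ _; rewrite /= ?mul0r ?mulr0.
  have -> : \sum_i v i ^+ 2 = \sum_(i | blk i == a) x i w ^+ 2.
    rewrite [RHS]big_mkcond; apply: eq_bigr => i _; rewrite /v.
    by case: eqP => // _; rewrite expr0n.
  move=> f0 fk; rewrite -expr2.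
  apply: (@le_trans _ _ ((kap * \sum_(i | blk i == a) x i w ^+ 2) ^+ 2)).
    by rewrite lerXn2r ?nnegrE// (le_trans f0).
  rewrite exprMn -mulrA ler_wpM2l ?sqr_ge0//.
  apply: le_trans (sqr_sum_le _ _) _.
  by under eq_bigr do rewrite -exprM.
rewrite ExZ ?Ex_sum//; last by apply: itg_sum.
apply: (@le_trans _ _ (kap ^+ 2 * (bsize a)%:R * \sum_(i | blk i == a) C)).
  by rewrite ler_wpM2l ?mulr_ge0 ?sqr_ge0 ?ler0n//; apply: ler_sum.
by rewrite sumr_const -[C *+ _]mulr_natl [(bsize a)%:R ^+ 2]expr2 !mulrA.
Qed.

Let C0 : 0 <= C \/ p = 0%N.
Proof.
case: (posnP p) => [->|p0]; [by right|left].
apply: le_trans (Ex4 (Ordinal p0)); apply: Ex_ge0 => w.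
exact: exprn_even_ge0.
Qed.

Let bsize_le a : (bsize a <= max_block blk)%N.
Proof.
have [->//|] := posnP (bsize a); case/card_gt0P => i; rewrite inE => /eqP bi.
rewrite /max_block (leq_trans _ (leq_bigmax i))//= /bsize.
by rewrite -bi; apply: subset_leq_card; apply/fintype.subsetP => k; rewrite !inE.
Qed.

Let sum_bsize : \sum_(a < K) (bsize a)%:R = p%:R :> R.
Proof.
under eq_bigr do rewrite /bsize -sum1_card natr_sum.
rewrite (exchange_big_dep predT)//=.
transitivity (\sum_(i < p) 1 : R); last by rewrite sumr_const card_ord.
apply: eq_bigr => i _.
rewrite (bigD1 (Ordinal (ltK i))) ?inE//= big1 ?addr0//.
move=> a /andP[/eqP ai]; rewrite -val_eqE /= => /eqP; by rewrite ai.
Qed.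

Let diag w := \sum_(a < K) Z a w.

Let itg_diag2 : itg (fun w => diag w ^+ 2).
Proof.
under eq_fun do rewrite expr2 big_distrlr /=.
by apply: itg_sum => a _; apply: itg_sum.
Qed.

(** Centred contributions of distinct blocks are orthogonal, so the block variances add up; the sum
    of the squared block sizes is at most the largest size times p. *)
Let Ex_diag2 : Ex (fun w => diag w ^+ 2) <= (max_block blk)%:R * p%:R * C * kap ^+ 2.
Proof.
under eq_Rintegral do rewrite expr2 big_distrlr /=.
rewrite Ex_sum => [|a _]; last by apply: itg_sum.
apply: (@le_trans _ _ (\sum_(a < K) kap ^+ 2 * (bsize a)%:R ^+ 2 * C)).
  apply: ler_sum => a _; rewrite Ex_sum// (bigD1 a)//= big1 ?addr0 ?Ex_Z2// => b ba.
  by rewrite Ex_ZM// eq_sym.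
have [C0'|p0] := C0.
  rewrite -mulr_suml -mulr_sumr -[X in _ <= X * _]mulrA [X in _ <= X]mulrC -mulrA.
  rewrite ler_wpM2l ?sqr_ge0// [X in _ <= X]mulrA ler_wpM2r//.
  rewrite -sum_bsize mulr_sumr; apply: ler_sum => a _.
  by rewrite expr2 ler_wpM2r ?ler0n// ler_nat bsize_le.
have -> : p%:R = 0 :> R by rewrite p0.
rewrite big1 ?mulr0 ?mul0r// => a _.
rewrite (_ : bsize a = 0%N) ?expr0n ?mulr0 ?mul0r//.
by apply: eq_card0 => i; have := ltn_ord i; rewrite {2}p0.
Qed.

(** Centring by the trace splits the form into [diag], pairs within a block, and [offd], pairs
    across blocks. The inequality (u + v)^2 <= 2 u^2 + 2 v^2 doubles the two bounds, hence the
    constants 2 and 4. *)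
Lemma quadratic_form_variance :
  itg (fun w => (\sum_i \sum_j A i j * (x i w * x j w) - \tr A) ^+ 2) /\
  Ex (fun w => (\sum_i \sum_j A i j * (x i w * x j w) - \tr A) ^+ 2) <=
  (2 * (max_block blk)%:R * C + 4) * p%:R * kap ^+ 2.
Proof.
have dec w : \sum_i \sum_j A i j * (x i w * x j w) - \tr A = diag w + offd w.
  rewrite /diag /Z sumrB addrAC; congr (_ - _); last first.
    rewrite /btr (exchange_big_dep predT)//=; apply: eq_bigr => i _.
    rewrite (bigD1 (Ordinal (ltK i))) ?inE//= big1 ?addr0//.
    by move=> a /andP[/eqP ai]; rewrite -val_eqE /= => /eqP; rewrite ai.
  rewrite pair_bigA /= (bigID (fun ij => blk ij.1 == blk ij.2)) /=; congr (_ + _).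
  rewrite /form (exchange_big_dep (fun ij => blk ij.1 == blk ij.2))/=; last first.
    by move=> a ij _ /andP[/eqP -> /eqP ->].
  apply: eq_bigr => -[i j] /= /eqP bij.
  rewrite (bigD1 (Ordinal (ltK i))) ?inE//= ?bij ?eqxx// big1 ?addr0//.
  by move=> a /andP[/andP[/eqP ai _]]; rewrite -val_eqE /= -ai ?bij eqxx.
have le2 w : (diag w + offd w) ^+ 2 <= 2 * diag w ^+ 2 + 2 * offd w ^+ 2.
  rewrite -subr_ge0 (_ : _ - _ = (diag w - offd w) ^+ 2); last by ring.
  exact: sqr_ge0.
have i2 : itg (fun w => 2 * diag w ^+ 2 + 2 * offd w ^+ 2).
  by apply: itgD; exact: itgZ.
under eq_fun do rewrite dec; under eq_Rintegral do rewrite dec.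
have md : measurable_fun setT diag.
  apply: measurable_sum => a; apply: measurable_funB; last exact: measurable_cst.
  exact: (itg_measurable (itg_form a)).
have mo : measurable_fun setT offd.
  rewrite /offd; under eq_fun do rewrite big_mkcond /=.
  apply: measurable_sum => ij; case: (_ != _); last exact: measurable_cst.
  apply: measurable_funM; first exact: measurable_cst.
  exact: measurable_funM.
have i1 : itg (fun w => (diag w + offd w) ^+ 2).
  apply: itg_le i2; first by apply: measurable_funX; exact: measurable_funD.
  by move=> w; rewrite ger0_norm ?sqr_ge0.
split=> //; apply: (le_trans (Ex_le i1 i2 le2)).
rewrite ExD ?ExZ//; try exact: itgZ.
have := Ex_diag2; have := Ex_offd2; lra.
Qed.

End quadratic_form.

(** * Resolvents of positive semidefinite matrices *)

Section resolvent.
Context {R : realType} {p : nat}.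
Implicit Types (W A : 'M[R]_p) (u v : 'rV[R]_p) (x : 'cV[R]_p).

Definition dotv u v : R := (u *m v^T) 0 0.

Lemma dotvE u v : dotv u v = \sum_i u 0 i * v 0 i.
Proof. by rewrite /dotv mxE; apply: eq_bigr => i _; rewrite !mxE. Qed.

Lemma dotvC u v : dotv u v = dotv v u.
Proof. by rewrite !dotvE; apply: eq_bigr => i _; rewrite mulrC. Qed.

Lemma dotvDl u1 u2 v : dotv (u1 + u2) v = dotv u1 v + dotv u2 v.
Proof. by rewrite /dotv mulmxDl mxE. Qed.

Lemma dotvDr u v1 v2 : dotv u (v1 + v2) = dotv u v1 + dotv u v2.
Proof. by rewrite dotvC dotvDl !(dotvC u). Qed.

Lemma dotvZl a u v : dotv (a *: u) v = a * dotv u v.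
Proof. by rewrite /dotv -scalemxAl mxE. Qed.

Lemma dotvZr a u v : dotv u (a *: v) = a * dotv u v.
Proof. by rewrite dotvC dotvZl dotvC. Qed.

Lemma dotv_ge0 u : 0 <= dotv u u.
Proof. by rewrite dotvE sumr_ge0// => i _; rewrite -expr2 sqr_ge0. Qed.

Lemma dotv_eq0 u : dotv u u = 0 -> u = 0.
Proof.
rewrite dotvE => /eqP; rewrite psumr_eq0 => [/allP h|i _]; last by rewrite -expr2 sqr_ge0.
apply/rowP => i; rewrite mxE; apply/eqP.
by have := h i (mem_index_enum i); rewrite /= mulf_eq0 orbb.
Qed.

Definition psd W := W^T = W /\ forall v, 0 <= dotv (v *m W) v.

Lemma psd0 : psd 0.
Proof. by split=> [|v]; rewrite ?trmx0// mulmx0 /dotv mul0mx mxE. Qed.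

Lemma psdD W1 W2 : psd W1 -> psd W2 -> psd (W1 + W2).
Proof.
move=> [s1 h1] [s2 h2]; split=> [|v]; first by rewrite linearD /= s1 s2.
by rewrite mulmxDr dotvDl addr_ge0.
Qed.

Lemma psd_rank1 (c : R) x : 0 <= c -> psd (c *: (x *m x^T)).
Proof.
move=> c0; split=> [|v]; first by rewrite linearZ /= trmx_mul trmxK.
rewrite -scalemxAr dotvZl mulr_ge0// /dotv -!mulmxA mulmxA.
rewrite -[x^T *m v^T]trmx_mul mxE big_ord1 [X in _ * X]mxE -expr2.
exact: sqr_ge0.
Qed.

Lemma psd_sum (I : Type) (r : seq I) (Q : pred I) (F : I -> 'M[R]_p) :
  (forall i, psd (F i)) -> psd (\sum_(i <- r | Q i) F i).
Proof.
by move=> h; apply: big_ind => //; [exact: psd0|exact: psdD].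
Qed.

Variable t : R.
Hypothesis t0 : 0 < t.

Lemma psd_shift_unit W : psd W -> W + t%:M \in unitmx.
Proof.
move=> [sW hW]; rewrite -row_free_unit -kermx_eq0; apply/rowV0P => v.
move=> /sub_kermxP; rewrite mulmxDr mul_mx_scalar => h.
have : dotv (v *m W + t *: v) v = 0 by rewrite h /dotv mul0mx mxE.
rewrite dotvDl dotvZl => e; apply: dotv_eq0.
have := hW v; have := dotv_ge0 v => h1 h2.
by apply/eqP; rewrite eq_le h1 andbT -(pmulr_rle0 _ t0); lra.
Qed.

Definition resolvent W := invmx (W + t%:M).

Lemma resolvent_sym W : psd W -> (resolvent W)^T = resolvent W.
Proof. by move=> [sW _]; rewrite /resolvent trmx_inv linearD /= sW tr_scalar_mx. Qed.

(** Write v = u W + t u and expand the scalar products of v with u and with itself: every discarded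
    term is nonnegative. This gives positivity and the norm bound 1/t without diagonalizing [W]. *)
Lemma resolvent_bounds W v : psd W -> let u := v *m resolvent W in
  [/\ 0 <= dotv u u, t * dotv u u <= dotv u v & t * dotv u v <= dotv v v].
Proof.
move=> hW u; have [sW pW] := hW.
have vE : v = u *m W + t *: u.
  by rewrite -mul_mx_scalar -mulmxDr mulmxKV// psd_shift_unit.
have uW := pW u; have u0 := dotv_ge0 u; split=> //.
  by rewrite [in X in _ <= X]vE dotvDr dotvZr dotvC lerDr.
have : dotv v v = dotv (u *m W) (u *m W) + t * dotv (u *m W) u + t * dotv u v.
  by rewrite {1}vE dotvDl dotvZl [in X in X + _ = _]vE dotvDr dotvZr.
have := dotv_ge0 (u *m W); have := mulr_ge0 (ltW t0) uW; lra.
Qed.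

Lemma resolvent_form W (v : 'I_p -> R) : psd W ->
  0 <= \sum_i \sum_j resolvent W i j * (v i * v j) <= t^-1 * \sum_i v i ^+ 2.
Proof.
move=> hW; have [h1 h2 h3] := resolvent_bounds (\row_i v i) hW.
have -> : \sum_i \sum_j resolvent W i j * (v i * v j) =
    dotv ((\row_i v i) *m resolvent W) (\row_i v i).
  rewrite dotvE exchange_big; apply: eq_bigr => j _; rewrite !mxE mulr_suml.
  by apply: eq_bigr => i _; rewrite !mxE; ring.
have <- : dotv (\row_i v i) (\row_i v i) = \sum_i v i ^+ 2.
  by rewrite dotvE; apply: eq_bigr => i _; rewrite !mxE.
rewrite (le_trans _ h2) ?mulr_ge0 ?(ltW t0)//=.
by rewrite ler_pdivlMl.
Qed.

(** Each row is the image of a unit vector under the resolvent, hence has squared norm at most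
    t^-2. *)
Lemma resolvent_frob W : psd W ->
  \sum_i \sum_j resolvent W i j ^+ 2 <= p%:R * t^-1 ^+ 2.
Proof.
move=> hW; rewrite -[p in p%:R]card_ord mulr_natl -sumr_const; apply: ler_sum => i _.
have [h1 h2 h3] := resolvent_bounds (delta_mx 0 i) hW.
have e1 : dotv (delta_mx 0 i) (delta_mx 0 i) = 1.
  rewrite dotvE (bigD1 i)//= big1 ?addr0 ?mxE ?eqxx ?mulr1// => j ji.
  by rewrite !mxE (negbTE ji) mulr0.
have <- : dotv (delta_mx 0 i *m resolvent W) (delta_mx 0 i *m resolvent W) =
    \sum_j resolvent W i j ^+ 2.
  by rewrite dotvE; apply: eq_bigr => j _; rewrite -rowE mxE.
move: h2 h3; rewrite e1; set a := dotv _ _; set b := dotv _ _ => h2 h3.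
rewrite -[X in _ <= X]mulr1 exprVn ler_pdivlMl ?exprn_gt0// expr2 -mulrA (le_trans _ h3)//.
by rewrite ler_pM2l.
Qed.

Lemma resolvent_trace W : psd W -> 0 <= \tr (resolvent W) <= p%:R / t.
Proof.
move=> hW.
have h i : 0 <= resolvent W i i <= t^-1.
  have := resolvent_form (fun j => (j == i)%:R) hW.
  rewrite (bigD1 i)//= (bigD1 i)//= eqxx !mulr1 big1 => [|j ji]; last first.
    by rewrite (negbTE ji) !mulr0.
  rewrite big1 => [|j ji]; last first.
    by rewrite big1// => k _; rewrite (negbTE ji) mul0r mulr0.
  rewrite (bigD1 i)//= eqxx expr1n big1 => [|j ji]; last first.
    by rewrite (negbTE ji) expr0n.
  by rewrite !addr0 mulr1.
apply/andP; split; first by apply: sumr_ge0 => i _; case/andP: (h i).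
rewrite -[p in p%:R]card_ord mulr_natl -sumr_const; apply: ler_sum => i _.
by case/andP: (h i).
Qed.

Section rank_one.
Variables (W : 'M[R]_p) (c : R) (x : 'cV[R]_p).
Hypothesis c0 : 0 < c.
Hypothesis hW : psd W.

Let W' := W + c *: (x *m x^T).

Let hW' : psd W'.
Proof. by apply: psdD => //; apply: psd_rank1; exact: ltW. Qed.

Definition qform A : R := c * (x^T *m A *m x) 0 0.

Let q := qform (resolvent W).
Let al := qform (resolvent W').

Let u := resolvent W' *m x.

(** Sherman-Morrison in vector form: (W' + t) u = x, and moving the rank-one part to the right
    subtracts from x its multiple by [al], the quadratic form of the updated resolvent. *)
Let uE : u = (1 - al) *: (resolvent W *m x).
Proof.
have h : (W + t%:M) *m u = (1 - al) *: x.
  have : (W' + t%:M) *m u = x by rewrite mulKVmx// psd_shift_unit.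
  rewrite /W' addrAC mulmxDl => /(canRL (addrK _)) ->.
  rewrite scalerBl scale1r; congr (_ - _).
  rewrite -scalemxAl -mulmxA [x^T *m u]mx11_scalar mul_mx_scalar scalerA.
  by rewrite /al /qform /u mulmxA.
by rewrite -[u](mulKmx (psd_shift_unit hW)) h -scalemxAr.
Qed.

Lemma qform_ge0 : 0 <= q.
Proof.
rewrite mulr_ge0 ?(ltW c0)//.
have [h1 h2 _] := resolvent_bounds x^T hW.
have -> : (x^T *m resolvent W *m x) 0 0 = dotv (x^T *m resolvent W) x^T by rewrite /dotv trmxK.
by rewrite (le_trans _ h2)// mulr_ge0 ?(ltW t0).
Qed.

Lemma qform_update : al = q / (1 + q).
Proof.
have q0 := qform_ge0.
have e : al = (1 - al) * q.
  rewrite {1}/al /qform -mulmxA -/u uE -scalemxAr mulmxA mxE /q /qform; ring.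
have q1 : 1 + q != 0 by rewrite gt_eqF// ltr_wpDr.
apply: (mulIf q1); rewrite mulfVK//.
rewrite mulrDr mulr1 {1}e; ring.
Qed.

(** By the resolvent identity the difference is c |R x|^2 / (1 + q), where R is the resolvent of
    [W]. As t |R x|^2 is at most x^T R x, it is bounded by q / (t (1 + q)), whatever the size of
    [x]. *)
Lemma trace_update :
  0 <= \tr (resolvent W) - \tr (resolvent W') <= t^-1.
Proof.
have q0 := qform_ge0.
have [h1 h2 _] := resolvent_bounds x^T hW.
have q_dot : q = c * dotv (x^T *m resolvent W) x^T by rewrite /dotv trmxK.
have q1 : 0 < 1 + q by rewrite ltr_wpDr.
have al1 : 1 - al = (1 + q)^-1.
  by rewrite qform_update; field; rewrite gt_eqF.
have dE : \tr (resolvent W) - \tr (resolvent W') =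
    (1 + q)^-1 * (c * dotv (x^T *m resolvent W) (x^T *m resolvent W)).
  rewrite -raddfB /=.
  have -> : resolvent W - resolvent W' = resolvent W *m (c *: (x *m x^T)) *m resolvent W'.
    have -> : c *: (x *m x^T) = (W' + t%:M) - (W + t%:M).
      by rewrite /W' opprD addrACA subrr addr0 addrAC subrr add0r.
    rewrite mulmxBr mulmxBl mulVmx ?psd_shift_unit// mul1mx -mulmxA mulmxV ?psd_shift_unit//.
    by rewrite mulmx1.
  rewrite -scalemxAr -scalemxAl mxtraceZ.
  have -> : resolvent W *m (x *m x^T) *m resolvent W' =
      (resolvent W *m x) *m (x^T *m resolvent W') by rewrite !mulmxA.
  rewrite mxtrace_mulC.
  have -> : x^T *m resolvent W' = (1 + q)^-1 *: (x^T *m resolvent W).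
    rewrite -al1 -[x^T *m resolvent W]trmxK -linearZ /= trmx_mul trmxK resolvent_sym//.
    by rewrite -uE /u trmx_mul resolvent_sym.
  rewrite -scalemxAl mxtraceZ /mxtrace big_ord1.
  rewrite /dotv trmx_mul trmxK resolvent_sym//; ring.
rewrite dE; apply/andP; split.
  by rewrite mulr_ge0 ?invr_ge0 ?(ltW q1)// mulr_ge0// ltW.
rewrite mulrC ler_pdivrMr//.
apply: (@le_trans _ _ (t^-1 * q)); last by rewrite ler_pM2l ?invr_gt0// lerDr.
rewrite q_dot mulrCA ler_pM2l// ler_pdivlMl//.
Qed.

End rank_one.

End resolvent.

(** * Gram matrices of the columns *)

Section measurable_matrix.
Context {R : realType} {d : measure_display} {T : measurableType d}.

(** Inversion is discontinuous at 0, where its value is 0 by convention. The formula f exp(- ln f^2)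
    gives the inverse elsewhere and also vanishes at 0, thanks to its first factor. *)
Lemma measurable_invr (f : T -> R) :
  measurable_fun setT f -> measurable_fun setT (fun w => (f w)^-1).
Proof.
move=> mf.
have -> : (fun w => (f w)^-1) = (fun w => f w * expR (- ln (f w ^+ 2))).
  apply/funext => w; have [->|f0] := eqVneq (f w) 0; first by rewrite invr0 mul0r.
  have f2 : 0 < f w ^+ 2 by rewrite exprn_even_gt0.
  by rewrite expRN lnK ?posrE// expr2 invfM mulrA divff// mul1r.
apply: measurable_funM => //.
apply: measurableT_comp => //; apply: measurableT_comp => //.
by apply: measurableT_comp; [exact: measurable_ln|exact: measurable_funX].
Qed.

Definition mxmeasurable a b (F : T -> 'M[R]_(a, b)) :=
  forall i j, measurable_fun setT (fun w => F w i j).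

Lemma mxmeasurableD a b (F G : T -> 'M[R]_(a, b)) :
  mxmeasurable F -> mxmeasurable G -> mxmeasurable (fun w => F w + G w).
Proof.
move=> mF mG i j; under eq_fun do rewrite mxE.
exact: measurable_funD.
Qed.

Lemma mxmeasurable_cst a b (A : 'M[R]_(a, b)) : mxmeasurable (fun=> A).
Proof. by move=> i j; exact: measurable_cst. Qed.

Lemma mxmeasurableM a b c (F : T -> 'M[R]_(a, b)) (G : T -> 'M[R]_(b, c)) :
  mxmeasurable F -> mxmeasurable G -> mxmeasurable (fun w => F w *m G w).
Proof.
move=> mF mG i j; under eq_fun do rewrite mxE.
by apply: measurable_sum => k; exact: measurable_funM.
Qed.

Lemma mxmeasurable_tr a b (F : T -> 'M[R]_(a, b)) :
  mxmeasurable F -> mxmeasurable (fun w => (F w)^T).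
Proof. by move=> mF i j; under eq_fun do rewrite mxE; exact: mF. Qed.

Lemma mxmeasurableZ a b (c : R) (F : T -> 'M[R]_(a, b)) :
  mxmeasurable F -> mxmeasurable (fun w => c *: F w).
Proof.
move=> mF i j; under eq_fun do rewrite mxE.
by apply: measurable_funM => //; exact: measurable_cst.
Qed.

Lemma mxmeasurable_sum a b (I : Type) (r : seq I) (Q : pred I) (F : I -> T -> 'M[R]_(a, b)) :
  (forall k, mxmeasurable (F k)) -> mxmeasurable (fun w => \sum_(k <- r | Q k) F k w).
Proof.
move=> mF i j; under eq_fun do rewrite summxE big_mkcond /=.
by apply: measurable_sum => k; case: (Q k); [exact: mF|exact: measurable_cst].
Qed.

Lemma measurable_det n (F : T -> 'M[R]_n) :
  mxmeasurable F -> measurable_fun setT (fun w => \det (F w)).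
Proof.
move=> mF; apply: measurable_sum => s.
apply: measurable_funM; first exact: measurable_cst.
by apply: measurable_prod => i _; exact: mF.
Qed.

Lemma mxmeasurable_inv n (F : T -> 'M[R]_n) : (forall w, F w \in unitmx) ->
  mxmeasurable F -> mxmeasurable (fun w => invmx (F w)).
Proof.
move=> uF mF i j.
have -> : (fun w => invmx (F w) i j) = (fun w => (\det (F w))^-1 * \adj (F w) i j).
  by apply/funext => w; rewrite /invmx uF mxE.
apply: measurable_funM; first by apply: measurable_invr; exact: measurable_det.
under eq_fun do rewrite mxE /cofactor.
apply: measurable_funM; first exact: measurable_cst.
apply: measurable_det => k l; under eq_fun do rewrite !mxE.
exact: mF.
Qed.

Lemma measurable_mxtrace n (F : T -> 'M[R]_n) :
  mxmeasurable F -> measurable_fun setT (fun w => \tr (F w)).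
Proof. by move=> mF; apply: measurable_sum => i; exact: mF. Qed.

End measurable_matrix.

Section gram.
Context {R : realType} {p m : nat}.
Hypothesis m0 : (0 < m)%N.
Variable t : R.
Hypothesis t0 : 0 < t.

Local Notation data := (vec R ('I_p * 'I_m)%type).
Implicit Type x : data.

Let c : R := m%:R^-1.

Let c0 : 0 < c.
Proof. by rewrite invr_gt0 ltr0n. Qed.

Definition column x k : 'cV[R]_p := \col_i x (i, k).

Definition gram (S : pred 'I_m) x : 'M[R]_p :=
  \sum_(k | S k) m%:R^-1 *: (column x k *m (column x k)^T).

Definition gram_trace S x : R := \tr (resolvent t (gram S x)).

Definition leave_one_out k x : R :=
  qform m%:R^-1 (column x k) (resolvent t (gram (predC1 k) x)).

Lemma sample_covE (X : 'I_p -> 'I_m -> R) :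
  sample_cov X = gram predT (fun ik => X ik.1 ik.2).
Proof.
rewrite /sample_cov /gram -scaler_sumr; congr (_ *: _); apply/matrixP => i j.
rewrite mxE summxE; apply: eq_bigr => k _.
by rewrite !mxE big_ord1 !mxE.
Qed.

Lemma gram_psd S x : psd (gram S x).
Proof. by apply: psd_sum => k; apply: psd_rank1; exact: ltW. Qed.

Lemma gramD1 k x :
  gram predT x = gram (predC1 k) x + m%:R^-1 *: (column x k *m (column x k)^T).
Proof. by rewrite /gram (bigD1 k)//= addrC. Qed.

Lemma gram_local (S : pred 'I_m) (x y : data) : (forall i k, S k -> x (i, k) = y (i, k)) -> gram S x = gram S y.
Proof.
move=> h; apply: eq_bigr => k Sk.
have -> // : column x k = column y k.
by apply/matrixP => i j; rewrite !mxE h.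
Qed.

Lemma mxmeasurable_column k : mxmeasurable (fun x : data => column x k).
Proof.
move=> i j; have -> : (fun x : data => column x k i j) = (fun x => x (i, k)).
  by apply/funext => x; rewrite mxE.
exact: measurable_coord.
Qed.

Lemma mxmeasurable_gram S : mxmeasurable (gram S).
Proof.
apply: mxmeasurable_sum => k; apply: mxmeasurableZ.
apply: mxmeasurableM; first exact: mxmeasurable_column.
by apply: mxmeasurable_tr; exact: mxmeasurable_column.
Qed.

Lemma mxmeasurable_resolvent S : mxmeasurable (fun x => resolvent t (gram S x)).
Proof.
apply: mxmeasurable_inv => [x|]; first by apply: psd_shift_unit => //; exact: gram_psd.
by apply: mxmeasurableD; [exact: mxmeasurable_gram|exact: mxmeasurable_cst].
Qed.

Lemma measurable_gram_trace S : measurable_fun setT (gram_trace S).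
Proof. by apply: measurable_mxtrace; exact: mxmeasurable_resolvent. Qed.

Lemma measurable_leave_one_out k : measurable_fun setT (leave_one_out k).
Proof.
apply: measurable_funM; first exact: measurable_cst.
have mM : mxmeasurable (fun x : data => (column x k)^T *m
    resolvent t (gram (predC1 k) x) *m column x k).
  apply: mxmeasurableM; last exact: mxmeasurable_column.
  apply: mxmeasurableM; last exact: mxmeasurable_resolvent.
  by apply: mxmeasurable_tr; exact: mxmeasurable_column.
exact: mM.
Qed.

Lemma gram_trace_bounds S x : 0 <= gram_trace S x <= p%:R / t.
Proof. by apply: resolvent_trace => //; exact: gram_psd. Qed.

Lemma gram_traceD1 k x :
  0 <= gram_trace (predC1 k) x - gram_trace predT x <= t^-1.
Proof.
by rewrite /gram_trace (gramD1 k); apply: trace_update => //; exact: gram_psd.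
Qed.

(** Both traces lie within 1/t below the same number, the trace with column [k] removed; so the
    bound is 1/t and not 2/t. *)
Lemma gram_trace_bounded_diff k (x y : data) : (forall i l, l != k -> x (i, l) = y (i, l)) ->
  `|gram_trace predT x - gram_trace predT y| <= t^-1.
Proof.
move=> h.
have := gram_traceD1 k x; have := gram_traceD1 k y.
have -> : gram_trace (predC1 k) x = gram_trace (predC1 k) y.
  by rewrite /gram_trace (@gram_local _ x y).
by move=> /andP[h1 h2] /andP[h3 h4]; rewrite ler_norml; lra.
Qed.

(** The left side is the trace of the Gram matrix times its resolvent. Split over columns, each
    rank-one term yields the quadratic form of the full resolvent, which [qform_update] expresses by
    the one with the column left out. *)
Lemma gram_trace_identity x :
  p%:R - t * gram_trace predT x =
  \sum_k leave_one_out k x / (1 + leave_one_out k x).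
Proof.
have hU : gram predT x + t%:M \in unitmx by apply: psd_shift_unit => //; exact: gram_psd.
have -> : p%:R - t * gram_trace predT x = \tr (gram predT x *m resolvent t (gram predT x)).
  have <- : 1%:M - t *: resolvent t (gram predT x) = gram predT x *m resolvent t (gram predT x).
    by rewrite -(mulmxV hU) mulmxDl mul_scalar_mx addrK.
  by rewrite raddfB /= mxtraceZ mxtrace1.
rewrite {1}/gram mulmx_suml raddf_sum; apply: eq_bigr => k _.
have := @qform_update R p t t0 (gram (predC1 k) x) _ (column x k) c0 (gram_psd _ _).
rewrite -gramD1 => <-.
rewrite /qform /= -scalemxAl mxtraceZ -mulmxA mxtrace_mulC; congr (_ * _).
by rewrite /mxtrace big_ord1.
Qed.

Lemma leave_one_out_ge0 k x : 0 <= leave_one_out k x.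
Proof. by apply: qform_ge0 => //; exact: gram_psd. Qed.

(** By the trace identity, the residual is the mean over the columns of f(q_k) - f(y s) with f(q) =
    q / (1 + q), which is 1-Lipschitz on q >= 0. The error q_k - y s has two parts: the fluctuation
    of the quadratic form around its normalized trace, and the effect of removing one column from
    the trace, at most c/t. *)
Lemma mp_residual x :
  let y := p%:R / m%:R in let s := gram_trace predT x / p%:R in
  (0 < p)%N ->
  (y * (1 - t * s) - y * s / (1 + y * s)) ^+ 2 <=
  m%:R^-1 * \sum_k (2 * (leave_one_out k x - c * gram_trace (predC1 k) x) ^+ 2
     + 2 * (c / t) ^+ 2).
Proof.
move=> y s p0.
have p0' : p%:R != 0 :> R by rewrite pnatr_eq0 -lt0n.
have m0' : m%:R != 0 :> R by rewrite pnatr_eq0 -lt0n.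
have ysE : y * s = c * gram_trace predT x by rewrite /y /s /c; field; rewrite p0' m0'.
have ys0 : 0 <= y * s.
  by rewrite ysE mulr_ge0 ?(ltW c0)//; case/andP: (gram_trace_bounds predT x).
pose f (q : R) := q / (1 + q).
have flip q r : 0 <= q -> 0 <= r -> (f q - f r) ^+ 2 <= (q - r) ^+ 2.
  move=> q0 r0.
  have -> : f q - f r = (q - r) * ((1 + q) * (1 + r))^-1.
    by rewrite /f; field; rewrite !gt_eqF// ltr_wpDr.
  rewrite exprMn ler_piMr ?sqr_ge0// exprn_ile1//.
    by rewrite invr_ge0 mulr_ge0// addr_ge0.
  by rewrite invf_le1 ?mulr_gt0 ?ltr_wpDr// -[X in X <= _]mulr1 ler_pM// lerDl.
have -> : y * (1 - t * s) - y * s / (1 + y * s) =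
    c * \sum_k (f (leave_one_out k x) - f (y * s)).
  rewrite sumrB -gram_trace_identity sumr_const card_ord -[f (y * s) *+ m]mulr_natl -/(f (y * s)).
  by rewrite /y /s /c; field; rewrite p0' m0'.
rewrite exprMn.
apply: (@le_trans _ _ (c ^+ 2 * (m%:R * \sum_k (f (leave_one_out k x) - f (y * s)) ^+ 2))).
  rewrite ler_wpM2l ?sqr_ge0//; apply: le_trans (sqr_sum_le _ _) _.
  by rewrite card_ord.
rewrite mulrA (_ : c ^+ 2 * m%:R = c); last by rewrite /c; field.
rewrite ler_pM2l//; apply: ler_sum => k _.
apply: (le_trans (flip _ _ (leave_one_out_ge0 k x) ys0)).
rewrite ysE; set q := leave_one_out k x; set a := gram_trace (predC1 k) x.
set b := gram_trace predT x.
have /andP[h1 h2] : 0 <= a - b <= t^-1 by exact: gram_traceD1.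
have h3 : (c * a - c * b) ^+ 2 <= (c / t) ^+ 2.
  by rewrite -mulrBr lerXn2r ?nnegrE ?mulr_ge0 ?invr_ge0 ?(ltW c0) ?(ltW t0)// ler_pM2l.
have h4 : 0 <= ((q - c * a) - (c * a - c * b)) ^+ 2 by exact: sqr_ge0.
have : (q - c * b) ^+ 2 = 2 * (q - c * a) ^+ 2 + 2 * (c * a - c * b) ^+ 2 -
  ((q - c * a) - (c * a - c * b)) ^+ 2 by ring.
move=> ->; lra.
Qed.

End gram.

(** * Bounded differences *)

Section bounded_differences.
Context {R : realType} {d : measure_display} {T : measurableType d}.
Variable P : probability T R.
Variables (I : finType) (m : nat) (X : I -> T -> R) (g : I -> 'I_m).
Hypothesis mX : forall i, measurable_fun setT (X i).
Hypothesis indX : indep_groups P X g.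

Local Notation itg f := (P.-integrable setT (fun w => (f w)%:E)).
Local Notation Ex f := (\int[P]_w f w)%R.
Local Notation data := (vec R I).

Let sample (w : T) : data := fun i => X i w.

Let msample : measurable_fun setT sample.
Proof. exact: measurable_vec. Qed.

Definition resample (k : 'I_m) (x : data) (w : T) : data :=
  fun i => if g i == k then X i w else x i.

(** Conditional expectation given all groups but [k], realized as a function on the sample space so
    that it can be iterated. *)
Definition average (k : 'I_m) (F : data -> R) (x : data) : R :=
  Ex (fun w => F (resample k x w)).

Variables (B c : R).

Record bounded_diff (F : data -> R) : Prop := BoundedDiff {
  bd_meas : measurable_fun setT F ;
  bd_bound : forall x, 0 <= F x <= B ;
  bd_diff : forall k (x y : data), (forall i, g i != k -> x i = y i) -> `|F x - F y| <= c }.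

Definition ignores (F : data -> R) (s : seq 'I_m) :=
  forall x y : data, (forall i, g i \notin s -> x i = y i) -> F x = F y.

Lemma measurable_resample k : measurable_fun setT (fun z : data * T => resample k z.1 z.2).
Proof.
apply: measurable_vec => i; rewrite /resample; case: (g i == k).
  exact: (measurableT_comp (mX i) measurable_snd).
exact: (measurableT_comp (measurable_coord i) measurable_fst).
Qed.

Lemma measurable_resample2 k x : measurable_fun setT (resample k x).
Proof.
apply: measurable_vec => i; rewrite /resample; case: (g i == k) => //.
Qed.

Let itg_bd (H : data -> R) (b : R) : measurable_fun setT H -> (forall x, `|H x| <= b) ->
  forall (f : T -> data), measurable_fun setT f -> itg (fun w => H (f w)).
Proof.
move=> mH hb f mf; apply: (@itg_bounded _ _ _ _ _ b) => [|w]; last exact: hb.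
exact: (measurableT_comp mH mf).
Qed.

Let bd_norm F : bounded_diff F -> forall x, `|F x| <= B.
Proof. by move=> bF x; case/andP: (bd_bound bF x) => h1 h2; rewrite ger0_norm. Qed.

Lemma Ex_average k (H : data -> R) (b : R) :
  measurable_fun setT H -> (forall x, `|H x| <= b) ->
  Ex (fun w => H (sample w)) = Ex (fun w => average k H (sample w)).
Proof.
move=> mH hb; rewrite {1}/Rintegral.
have [_ ->] := @decouple R d T P I 'I_m X g (pred1 k) mX indX H mH
  (itg_bd mH hb msample).
rewrite /Rintegral; congr fine; apply: eq_integral => w' _.
rewrite /average -EFin_Ex//.
by apply: itg_bd hb _ (measurable_resample2 k _).
Qed.

Lemma average_bounded_diff k F : 0 <= c -> bounded_diff F -> bounded_diff (average k F).
Proof.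
move=> c0 bF; have mF := bd_meas bF; split.
- apply: (measurableT_comp (fine_measurable measurableT)).
  have := @measurable_fun_fubini_tonelli_F _ _ data T R P
    (fun z => (F (resample k z.1 z.2))%:E).
  apply => [|x]; last by rewrite lee_fin; case/andP: (bd_bound bF (resample k x.1 x.2)).
  apply/measurable_EFinP.
  exact: (measurableT_comp mF (measurable_resample k)).
- move=> x; apply/andP; split.
    by apply: Ex_ge0 => w; case/andP: (bd_bound bF (resample k x w)).
  rewrite -[X in _ <= X](Ex_cst P); apply: Ex_le; [|exact: itg_cst|].
    exact: (itg_bd mF (bd_norm bF) (measurable_resample2 k x)).
  by move=> w; case/andP: (bd_bound bF (resample k x w)).
- move=> l x y h; rewrite /average -ExB; last 2 first.
    exact: (itg_bd mF (bd_norm bF) (measurable_resample2 k x)).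
    exact: (itg_bd mF (bd_norm bF) (measurable_resample2 k y)).
  have i1 := itgB (itg_bd mF (bd_norm bF) (measurable_resample2 k x))
    (itg_bd mF (bd_norm bF) (measurable_resample2 k y)).
  apply: le_trans (le_normr_Rintegral measurableT i1) _.
  rewrite -[X in _ <= X](Ex_cst P); apply: Ex_le; [|exact: itg_cst|].
    by apply: (itg_le _ _ (itg_cst P c)) => [|w]; rewrite ?normr_id;
      [apply: measurableT_comp => //; exact: itg_measurable i1|];
      apply: (bd_diff bF (k := l)) => i gi; rewrite /resample; case: ifP => // _; exact: h.
  by move=> w; apply: (bd_diff bF (k := l)) => i gi; rewrite /resample; case: ifP => // _; exact: h.
Qed.

Lemma average_ignores k F s : ignores F s -> ignores (average k F) (k :: s).
Proof.
move=> hF x y h; apply: eq_Rintegral => w _; apply: hF => i gi.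
by rewrite /resample; case: eqP => // /eqP gk; apply: h; rewrite inE negb_or gk.
Qed.

Lemma average_near k F x : bounded_diff F -> `|F x - average k F x| <= c.
Proof.
move=> bF; have mF := bd_meas bF.
have i0 := itg_bd mF (bd_norm bF) (measurable_resample2 k x).
rewrite -[X in `|X - _|](Ex_cst P) /average -ExB//; last exact: itg_cst.
have i1 := itgB (itg_cst P (F x)) i0.
apply: le_trans (le_normr_Rintegral measurableT i1) _.
have hc w : `|F x - F (resample k x w)| <= c.
  by apply: (bd_diff bF (k := k)) => i /negbTE gi; rewrite /resample gi.
rewrite -[X in _ <= X](Ex_cst P); apply: Ex_le => //; last exact: itg_cst.
apply: (itg_le _ _ (itg_cst P c)) => [|w]; last by rewrite normr_id.
by apply: measurableT_comp => //; exact: itg_measurable i1.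
Qed.

(** Orthogonality of a martingale difference: averaging over group [k] leaves [H] and the average of
    [F] fixed and replaces [F] by that average. *)
Lemma Ex_average_orthogonal k F (H : data -> R) (b : R) :
  0 <= c -> bounded_diff F -> measurable_fun setT H -> (forall x, `|H x| <= b) ->
  ignores H [:: k] ->
  Ex (fun w => (F (sample w) - average k F (sample w)) * H (sample w)) = 0.
Proof.
move=> c0 bF mH hb iH.
have bG := average_bounded_diff k c0 bF.
have mD : measurable_fun setT (fun x => (F x - average k F x) * H x).
  by apply: measurable_funM => //; apply: measurable_funB; exact: bd_meas.
rewrite (@Ex_average k (fun x => (F x - average k F x) * H x) (c * b)) => [||x].
- rewrite -[RHS](Ex_cst P); apply: eq_Rintegral => w' _; set x := sample w'.
  rewrite /average.
  have E w : (F (resample k x w) - average k F (resample k x w)) * H (resample k x w) =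
    H x * (F (resample k x w) - average k F x).
    rewrite mulrC; congr (_ * (_ - _)).
      by apply: iH => i; rewrite inE => /negbTE gi; rewrite /resample gi.
    apply: (@average_ignores k F [::]); first by move=> u v h; congr F; apply/funext => i; exact: h.
    by move=> i; rewrite inE => /negbTE gi; rewrite /resample gi.
  under eq_Rintegral do rewrite E.
  have i0 := itg_bd (bd_meas bF) (bd_norm bF) (measurable_resample2 k x).
  have ic := itg_cst P (average k F x).
  by rewrite ExZ ?ExB ?Ex_cst// ?subrr ?mulr0//; exact: itgB.
- exact: mD.
- by rewrite normrM ler_pM//; exact: average_near.
Qed.

(** With D = F - G and h = G - mu, the terms D h and D h^3 have zero mean by orthogonality. In (D +
    h)^4 the remaining cross term satisfies 4 D^3 h <= 2 D^2 h^2 + 2 D^4, so 6 + 2 = 8 and 1 + 2 = 3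
    are the coefficients of D^2 h^2 and D^4, and D^2 <= c^2. *)
Lemma average_moments k F (mu : R) : 0 <= c -> bounded_diff F ->
  let G := average k F in
  Ex (fun w => (F (sample w) - mu) ^+ 2) <= Ex (fun w => (G (sample w) - mu) ^+ 2) + c ^+ 2 /\
  Ex (fun w => (F (sample w) - mu) ^+ 4) <=
    Ex (fun w => (G (sample w) - mu) ^+ 4) +
    8 * c ^+ 2 * Ex (fun w => (G (sample w) - mu) ^+ 2) + 3 * c ^+ 4.
Proof.
move=> c0 bF G.
have bG : bounded_diff G := average_bounded_diff k c0 bF.
have B0 : 0 <= B.
  by case/andP: (bd_bound bF (sample point)) => /le_trans; apply.
have nb (H : data -> R) : bounded_diff H -> forall x, `|H x - mu| <= B + `|mu|.
  by move=> bH x; rewrite (le_trans (ler_normB _ _))// lerD2r; exact: bd_norm.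
have iX (H : data -> R) n : bounded_diff H -> itg (fun w => (H (sample w) - mu) ^+ n).
  move=> bH; apply: (@itg_bd (fun x => (H x - mu) ^+ n) ((B + `|mu|) ^+ n)) => //.
    by apply: measurable_funX; apply: measurable_funB; [exact: bd_meas|exact: measurable_cst].
  by move=> x; rewrite normrX lerXn2r ?nnegrE ?addr_ge0//; exact: nb.
have mGn n : measurable_fun setT (fun x => (G x - mu) ^+ n).
  by apply: measurable_funX; apply: measurable_funB; [exact: bd_meas|exact: measurable_cst].
have iGX n : ignores (fun x => (G x - mu) ^+ n) [:: k].
  move=> x y h; congr ((_ - _) ^+ n).
  by apply: (@average_ignores k F [::] _ x y h) => u v h'; congr F; apply/funext => i; exact: h'.
have orth n : Ex (fun w => (F (sample w) - G (sample w)) * (G (sample w) - mu) ^+ n) = 0.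
  apply: (@Ex_average_orthogonal k F (fun x => (G x - mu) ^+ n) ((B + `|mu|) ^+ n)) => //.
  by move=> x; rewrite normrX lerXn2r ?nnegrE ?addr_ge0//; exact: nb.
have iorth n : itg (fun w => (F (sample w) - G (sample w)) * (G (sample w) - mu) ^+ n).
  apply: (@itg_bd (fun x => (F x - G x) * (G x - mu) ^+ n) (c * (B + `|mu|) ^+ n)) => //.
    by apply: measurable_funM => //; apply: measurable_funB; exact: bd_meas.
  move=> x; rewrite normrM ler_pM//; first exact: average_near.
  by rewrite normrX lerXn2r ?nnegrE ?addr_ge0//; exact: nb.
have D2 w : (F (sample w) - G (sample w)) ^+ 2 <= c ^+ 2.
  by rewrite -real_normK ?num_real// lerXn2r ?nnegrE//; exact: average_near.
have iG n := iX G n bG; have iF n := iX F n bF.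
have ic (a : R) : itg (fun=> a) by exact: itg_cst.
split.
- apply: (@le_trans _ _ (Ex (fun w => (G (sample w) - mu) ^+ 2 + c ^+ 2 +
      2 * ((F (sample w) - G (sample w)) * (G (sample w) - mu) ^+ 1)))).
    apply: Ex_le => //; first by apply: itgD; [exact: itgD|exact: itgZ].
    move=> w; have := D2 w; rewrite expr1 !expr2; lra.
  rewrite ExD ?ExD ?ExZ ?Ex_cst ?orth ?mulr0 ?addr0//; [exact: itgD|exact: itgZ].
- apply: (@le_trans _ _ (Ex (fun w => (G (sample w) - mu) ^+ 4 +
     8 * c ^+ 2 * (G (sample w) - mu) ^+ 2 + 3 * c ^+ 4 +
     4 * ((F (sample w) - G (sample w)) * (G (sample w) - mu) ^+ 3)))).
    apply: Ex_le => //.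
      by repeat (apply: itgD => //); exact: itgZ.
    move=> w; have hD := D2 w.
    set D := F (sample w) - G (sample w) in hD *; set h := G (sample w) - mu.
    have -> : F (sample w) - mu = D + h by rewrite /D /h; ring.
    have h1 : D ^+ 2 * h ^+ 2 <= c ^+ 2 * h ^+ 2 by rewrite ler_wpM2r ?sqr_ge0.
    have h2 : D ^+ 2 * D ^+ 2 <= c ^+ 2 * c ^+ 2 by rewrite ler_pM ?sqr_ge0.
    have h3 : 0 <= D ^+ 2 * (D - h) ^+ 2 by rewrite mulr_ge0 ?sqr_ge0.
    have -> : (D + h) ^+ 4 = h ^+ 4 + 8 * (D ^+ 2 * h ^+ 2) + 3 * (D ^+ 2 * D ^+ 2) +
      4 * (D * h ^+ 3) - 2 * (D ^+ 2 * (D - h) ^+ 2) by ring.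
    have -> : c ^+ 4 = c ^+ 2 * c ^+ 2 by ring.
    lra.
  rewrite ExD ?ExD ?ExZ ?Ex_cst ?orth ?mulr0 ?addr0//;
    repeat (try apply: itgD => //); exact: itgZ.
Qed.

(** Each averaging costs c^2 in the second moment, so this moment stays linear in the number of
    steps, and the fourth moment, which grows by a multiple of it at every step, stays quadratic. *)
Lemma average_list (s : seq 'I_m) F : 0 <= c -> bounded_diff F ->
  exists G, [/\ bounded_diff G, ignores G s,
    Ex (fun w => F (sample w)) = Ex (fun w => G (sample w)) &
    forall mu,
     Ex (fun w => (F (sample w) - mu) ^+ 2) <=
       Ex (fun w => (G (sample w) - mu) ^+ 2) + (size s)%:R * c ^+ 2 /\
     Ex (fun w => (F (sample w) - mu) ^+ 4) <=
       Ex (fun w => (G (sample w) - mu) ^+ 4) +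
       8 * c ^+ 2 * (size s)%:R *
         (Ex (fun w => (G (sample w) - mu) ^+ 2) + (size s)%:R * c ^+ 2) +
       3 * (size s)%:R * c ^+ 4].
Proof.
move=> c0 bF; elim: s => [|k s [G [bG iG EG hG]]].
  exists F; split=> // [x y h|mu]; first by congr F; apply/funext => i; exact: h.
  by rewrite !mulr0 !mul0r !addr0.
exists (average k G); split.
- exact: average_bounded_diff.
- exact: average_ignores.
- by rewrite EG (@Ex_average k G B)//; [exact: bd_meas|exact: bd_norm].
- move=> mu; have [h1 h2] := hG mu; have [h3 h4] := average_moments k mu c0 bG.
  rewrite /= -natr1; set n := (size s)%:R in h1 h2 *.
  have n0 : 0 <= n by rewrite ler0n.
  have c2 : 0 <= c ^+ 2 by rewrite sqr_ge0.
  split; first by lra.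
  set g2 := Ex (fun w => (average k G (sample w) - mu) ^+ 2) in h3 h4 *.
  set g4 := Ex (fun w => (average k G (sample w) - mu) ^+ 4) in h4 *.
  set f2 := Ex (fun w => (G (sample w) - mu) ^+ 2) in h1 h2 h3.
  have h5 : (c ^+ 2 * n) * f2 <= (c ^+ 2 * n) * (g2 + c ^+ 2).
    by rewrite ler_wpM2l// mulr_ge0.
  have c4 : c ^+ 4 = c ^+ 2 * c ^+ 2 by ring.
  rewrite c4 in h2 h4 *.
  have h6 : 0 <= n * (c ^+ 2 * c ^+ 2) by rewrite !mulr_ge0.
  have h7 : 0 <= c ^+ 2 * c ^+ 2 by rewrite mulr_ge0.
  apply: (le_trans h2).
  rewrite (_ : 8 * c ^+ 2 * n * (f2 + n * c ^+ 2) =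
    8 * ((c ^+ 2 * n) * f2) + 8 * (n * n * (c ^+ 2 * c ^+ 2))); last by ring.
  rewrite (_ : 8 * c ^+ 2 * (n + 1) * (g2 + (n + 1) * c ^+ 2) =
    8 * ((c ^+ 2 * n) * (g2 + c ^+ 2)) + 8 * c ^+ 2 * g2 + 8 * (n * n * (c ^+ 2 * c ^+ 2)) +
    8 * (n * (c ^+ 2 * c ^+ 2)) + 8 * (c ^+ 2 * c ^+ 2)); last by ring.
  lra.
Qed.

(** Averaging over every group leaves a constant, the mean of [F], whose central moments vanish.
    What remains is 8 m^2 c^4 + 3 m c^4, and m <= m^2 gives the constant 11. *)
Lemma bounded_diff_fourth_moment F : 0 <= c -> bounded_diff F -> (0 < m)%N ->
  Ex (fun w => (F (sample w) - Ex (fun w => F (sample w))) ^+ 4) <= 11 * m%:R ^+ 2 * c ^+ 4.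
Proof.
move=> c0 bF m0; have [G [bG iG EG hG]] := average_list (enum 'I_m) c0 bF.
set mu := Ex (fun w => F (sample w)).
have Gmu w : G (sample w) = mu.
  rewrite /mu EG -[LHS](Ex_cst P); apply: eq_Rintegral => w' _.
  by apply: iG => i; rewrite mem_enum.
have [_] := hG mu.
rewrite size_enum_ord.
have E n : (0 < n)%N -> Ex (fun w => (G (sample w) - mu) ^+ n) = 0.
  move=> n0; rewrite -[RHS](Ex_cst P); apply: eq_Rintegral => w _.
  by rewrite Gmu subrr expr0n eqn0Ngt n0.
rewrite !E// !add0r => /le_trans; apply.
have m1 : 1 <= m%:R :> R by rewrite ler1n.
have c4 : 0 <= c ^+ 4 by rewrite exprn_ge0.
have : m%:R * c ^+ 4 <= m%:R ^+ 2 * c ^+ 4.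
  by rewrite ler_wpM2r// expr2 -[X in X <= _]mul1r ler_wpM2r// ler0n.
rewrite (_ : 8 * c ^+ 2 * m%:R * (m%:R * c ^+ 2) = 8 * (m%:R ^+ 2 * c ^+ 4)); last by ring.
lra.
Qed.

End bounded_differences.

(** * The self-consistent equation *)

Section self_consistency.
Context {R : realType}.
Implicit Types s y t lam : R.

(** The trace identity divided by the number of columns, with every quadratic form replaced by y
    s. *)
Definition mp_equation t y s : R := y * (1 - t * s) - y * s / (1 + y * s).

Lemma ratio_diff_le (a b : R) : 0 <= a -> 0 <= b ->
  `|a / (1 + a) - b / (1 + b)| <= `|a - b|.
Proof.
move=> a0 b0.
have -> : a / (1 + a) - b / (1 + b) = (a - b) * ((1 + a) * (1 + b))^-1.
  by field; rewrite !gt_eqF// ltr_wpDr.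
rewrite normrM ler_piMr// ger0_norm ?invr_ge0 ?mulr_ge0 ?addr_ge0//.
by rewrite invf_le1 ?mulr_gt0 ?ltr_wpDr// -[X in X <= _]mulr1 ler_pM// lerDl.
Qed.

(** The linear term decreases with slope - y t and the fraction only adds to the decrease. This
    gives uniqueness of the nonnegative root together with a quantitative stability. *)
Lemma mp_equation_expansive t y s s' : 0 <= t -> 0 <= y -> 0 <= s -> 0 <= s' ->
  y * t * `|s - s'| <= `|mp_equation t y s - mp_equation t y s'|.
Proof.
move=> t0 y0.
wlog ss : s s' / s <= s' => [hw s0 s0'|s0 s0'].
  have /orP[/hw h|/hw h] := le_total s s'; first exact: h.
  by rewrite distrC (distrC (mp_equation _ _ s)); exact: h.
have ys0 : 0 <= y * s by rewrite mulr_ge0.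
have ys0' : 0 <= y * s' by rewrite mulr_ge0.
rewrite (distrC s) ger0_norm ?subr_ge0//.
apply: le_trans (ler_norm _); rewrite /mp_equation.
have : y * s / (1 + y * s) <= y * s' / (1 + y * s').
  rewrite ler_pdivrMr ?ltr_wpDr// mulrAC ler_pdivlMr ?ltr_wpDr//.
  have : y * s <= y * s' by rewrite ler_wpM2l.
  by rewrite !mulrDr !mulr1 [y * s' * (y * s)]mulrC lerD2r.
lra.
Qed.

Lemma mp_equation_param t y lam s : 0 <= t -> 0 <= y -> 0 <= lam -> 0 <= s -> t * s <= 1 ->
  `|mp_equation t lam s - mp_equation t y s| <= `|lam - y| * (1 + s).
Proof.
move=> t0 y0 l0 s0 ts1.
have -> : mp_equation t lam s - mp_equation t y s = (lam - y) * (1 - t * s) -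
    (lam * s / (1 + lam * s) - y * s / (1 + y * s)) by rewrite /mp_equation; ring.
apply: le_trans (ler_normB _ _) _; rewrite [X in _ <= X]mulrDr; apply: lerD.
  rewrite normrM ler_wpM2l// ger0_norm; last by rewrite subr_ge0.
  by rewrite gerBl mulr_ge0.
apply: le_trans (ratio_diff_le _ _) _; rewrite ?mulr_ge0//.
by rewrite -mulrBl normrM (ger0_norm s0).
Qed.

(** The nonnegative root of lam t s^2 + (t + 1 - lam) s - 1 = 0, which is [mp_equation] equated to 0
    with its denominator cleared. *)
Definition mp_stieltjes lam t : R :=
  (lam - 1 - t + Num.sqrt ((t + 1 - lam) ^+ 2 + 4 * lam * t)) / (2 * lam * t).

Lemma mp_stieltjes_root lam t : 0 < lam -> 0 < t ->
  0 <= mp_stieltjes lam t /\ mp_equation t lam (mp_stieltjes lam t) = 0.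
Proof.
move=> l0 t0; set s := mp_stieltjes lam t.
set r := Num.sqrt ((t + 1 - lam) ^+ 2 + 4 * lam * t).
have lt0 : 0 < lam * t by rewrite mulr_gt0.
have r2 : r ^+ 2 = (t + 1 - lam) ^+ 2 + 4 * lam * t.
  by rewrite sqr_sqrtr// addr_ge0 ?sqr_ge0// -mulrA mulr_ge0// ltW.
have r0 : 0 <= r by exact: sqrtr_ge0.
have rge : t + 1 - lam <= r.
  have [h|h] := lerP (t + 1 - lam) 0; first exact: le_trans h r0.
  by rewrite -ler_sqr ?nnegrE ?(ltW h)// r2 lerDl -mulrA mulr_ge0// ltW.
have sE : 2 * lam * t * s = lam - 1 - t + r.
  by rewrite /s /mp_stieltjes -/r mulrC mulfVK// gt_eqF// -mulrA mulr_gt0.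
have s0 : 0 <= s.
  rewrite /s /mp_stieltjes -/r divr_ge0//; last by rewrite -mulrA mulr_ge0// ltW.
  lra.
split=> //.
have quad : lam * t * s ^+ 2 + (t + 1 - lam) * s - 1 = 0.
  have : (2 * lam * t * s + (t + 1 - lam)) ^+ 2 = r ^+ 2 by rewrite sE; ring.
  rewrite r2 => h.
  have : 4 * (lam * t) * (lam * t * s ^+ 2 + (t + 1 - lam) * s - 1) = 0 by lra.
  by move/eqP; rewrite mulf_eq0 => /orP[|/eqP//]; rewrite gt_eqF// mulr_gt0.
have ls : 1 + lam * s != 0 by rewrite gt_eqF// ltr_wpDr// mulr_ge0// ltW.
apply: (mulIf ls); rewrite mul0r /mp_equation mulrBl mulfVK//.
transitivity (- lam * (lam * t * s ^+ 2 + (t + 1 - lam) * s - 1)); first by ring.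
by rewrite quad mulr0.
Qed.

End self_consistency.

(** * Concentration and mean of the normalized resolvent trace *)

Section trace_moments.
Context {R : realType} {d : measure_display} {T : measurableType d}.
Variable P : probability T R.
Variables (p m : nat) (X : 'I_p -> 'I_m -> T -> R) (blk : 'I_p -> nat) (C t : R).
Hypothesis p0 : (0 < p)%N.
Hypothesis m0 : (0 < m)%N.
Hypothesis t0 : 0 < t.
Hypothesis mX : forall i k, measurable_fun setT (X i k).

Local Notation itg f := (P.-integrable setT (fun w => (f w)%:E)).
Local Notation Ex f := (\int[P]_w f w)%R.
Local Notation I := ('I_p * 'I_m)%type.

Hypothesis indcol : indep_groups P (fun ik : I => X ik.1 ik.2) (fun ik => ik.2).
Hypothesis indblk : forall k, indep_groups P (fun i => X i k) blk.
Hypothesis EX1 : forall i k, Ex (X i k) = 0.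
Hypothesis EX2 : forall i j k, Ex (fun w => X i k w * X j k w) = (i == j)%:R.
Hypothesis iX4 : forall i k, itg (fun w => X i k w ^+ 4).
Hypothesis EX4 : forall i k, Ex (fun w => X i k w ^+ 4) <= C.

Let sample w : vec R I := fun ik => X ik.1 ik.2 w.

Let msample : measurable_fun setT sample.
Proof. by apply: measurable_vec => ik; exact: mX. Qed.

Definition trace_stat w : R := gram_trace t predT (sample w) / p%:R.

Let pR : 0 < p%:R :> R. Proof. by rewrite ltr0n. Qed.
Let mR : 0 < m%:R :> R. Proof. by rewrite ltr0n. Qed.

Lemma trace_stat_bounds w : 0 <= trace_stat w /\ t * trace_stat w <= 1.
Proof.
have /andP[h1 h2] := @gram_trace_bounds R p m m0 t t0 predT (sample w).
split; first by rewrite divr_ge0.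
by rewrite mulrA ler_pdivrMr// mul1r -ler_pdivlMl// mulrC.
Qed.

Lemma measurable_trace_stat : measurable_fun setT trace_stat.
Proof.
apply: measurable_funM; last exact: measurable_cst.
exact: (measurableT_comp (measurable_gram_trace m0 t0 predT) msample).
Qed.

Lemma itg_trace_stat : itg trace_stat.
Proof.
apply: (@itg_bounded _ _ _ _ _ t^-1) => [|w]; first exact: measurable_trace_stat.
have [h1 h2] := trace_stat_bounds w.
by rewrite ger0_norm// -[X in _ <= X]mulr1 ler_pdivlMl.
Qed.

Lemma trace_stat_concentration :
  Ex (fun w => (trace_stat w - Ex trace_stat) ^+ 4) <= 11 * m%:R ^+ 2 * (p%:R * t)^-1 ^+ 4.
Proof.
pose F (x : vec R I) := gram_trace t predT x / p%:R.
have bF : bounded_diff (fun ik : I => ik.2) t^-1 (p%:R * t)^-1 F.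
  split.
  - apply: measurable_funM; last exact: measurable_cst.
    exact: measurable_gram_trace.
  - move=> x; have /andP[h1 h2] := @gram_trace_bounds R p m m0 t t0 predT x.
    by rewrite divr_ge0//= ler_pdivrMr// mulrC.
  - move=> k x y h; rewrite /F -mulrBl normrM [`|_^-1|]ger0_norm ?invr_ge0 ?ler0n//.
    rewrite ler_pdivrMr// invfM mulrAC mulVf ?gt_eqF// mul1r.
    apply: (@gram_trace_bounded_diff R p m m0 t t0 k x y).
    by move=> i l lk; apply: h.
have c0 : 0 <= (p%:R * t)^-1 by rewrite invr_ge0 mulr_ge0 ?ler0n// ltW.
have mX' (ik : I) : measurable_fun setT (X ik.1 ik.2) by exact: mX.
exact: (@bounded_diff_fourth_moment R d T P I m (fun ik => X ik.1 ik.2) (fun ik => ik.2)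
  mX' indcol t^-1 (p%:R * t)^-1 F c0 bF m0).
Qed.

Let V : R := (2 * (max_block blk)%:R * C + 4) * p%:R * t^-1 ^+ 2.

Let dev k (x : vec R I) : R :=
  (leave_one_out t k x - m%:R^-1 * gram_trace t (predC1 k) x) ^+ 2.

Let mdev k : measurable_fun setT (dev k).
Proof.
apply: measurable_funX; apply: measurable_funB; first exact: measurable_leave_one_out.
by apply: measurable_funM; [exact: measurable_cst|exact: measurable_gram_trace].
Qed.

Let dev_le k : (\int[P]_w (dev k (sample w))%:E <= (m%:R^-1 ^+ 2 * V)%:E)%E.
Proof.
have mX' (ik : I) : measurable_fun setT (X ik.1 ik.2) by exact: mX.
rewrite (@decouple_ge0 R d T P I _ (fun ik => X ik.1 ik.2) (fun ik => ik.2)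
  (pred1 k) mX' indcol (dev k) (mdev k)); last by move=> x; exact: sqr_ge0.
rewrite -[X in (_ <= X)%E]mule1 -(probability_setT P) -integral_cst//.
apply: ge0_le_integral => //.
- by move=> w' _; apply: integral_ge0 => w _; rewrite lee_fin sqr_ge0.
- apply: (@measurable_fun_fubini_tonelli_G _ _ T T R P
    (fun z => (dev k (mix (fun ik : I => X ik.1 ik.2) (fun ik => ik.2) (pred1 k) z))%:E)).
    apply/measurable_EFinP.
    exact: (measurableT_comp (mdev k) (measurable_mix _ _ mX')).
  by move=> z; rewrite lee_fin sqr_ge0.
move=> w' _.
pose A := resolvent t (gram (predC1 k) (sample w')).
have hpsd := @gram_psd R p m m0 (predC1 k) (sample w').
have ti : 0 <= t^-1 by rewrite invr_ge0 ltW.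
have [i1 h1] := @quadratic_form_variance R d T P p (fun i => X i k) blk C
  (fun i => mX i k) (@indblk k) (fun i => EX1 i k) (fun i j => EX2 i j k)
  (fun i => iX4 i k) (fun i => EX4 i k) A t^-1 ti
  (fun v => resolvent_form t0 v hpsd) (resolvent_frob t0 hpsd).
have -> : (\int[P]_w (dev k (mix (fun ik : I => X ik.1 ik.2) (fun ik => ik.2) (pred1 k) (w, w')))%:E
   = \int[P]_w ((m%:R^-1 ^+ 2 * (\sum_i \sum_j A i j * (X i k w * X j k w) - \tr A) ^+ 2)%:E))%E.
  apply: eq_integral => w _; congr EFin.
  set z := mix _ _ _ _.
  have gz : gram (predC1 k) z = gram (predC1 k) (sample w').
    by apply: gram_local => i l; rewrite /z /mix /= => /negbTE ->.
  have cz : column z k = \col_i X i k w.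
    by apply/matrixP => i j; rewrite !mxE /z /mix /= eqxx.
  rewrite /dev /leave_one_out /gram_trace gz -/A cz /qform -exprMn mulrBr.
  congr ((_ * _ - _) ^+ 2).
  rewrite exchange_big mxE; apply: eq_bigr => j _; rewrite !mxE mulr_suml.
  by apply: eq_bigr => i _; rewrite !mxE; ring.
have i2 := itgZ (m%:R^-1 ^+ 2) i1.
rewrite (EFin_Ex i2) ExZ// lee_fin ler_wpM2l ?sqr_ge0//.
Qed.

Lemma trace_stat_residual :
  itg (fun w => mp_equation t (p%:R / m%:R) (trace_stat w) ^+ 2) /\
  Ex (fun w => mp_equation t (p%:R / m%:R) (trace_stat w) ^+ 2) <=
  2 * m%:R^-1 ^+ 2 * (V + t^-1 ^+ 2).
Proof.
have hd k := @itg_ge0 R d T P (fun w => dev k (sample w)) _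
  (measurableT_comp (mdev k) msample) (fun w => sqr_ge0 _) (dev_le k).
have i1 : itg (fun w => m%:R^-1 * \sum_k (2 * dev k (sample w) + 2 * (m%:R^-1 / t) ^+ 2)).
  apply: itgZ; apply: itg_sum => k _; apply: itgD; last exact: itg_cst.
  by apply: itgZ; have [] := hd k.
have le1 w : mp_equation t (p%:R / m%:R) (trace_stat w) ^+ 2 <=
    m%:R^-1 * \sum_k (2 * dev k (sample w) + 2 * (m%:R^-1 / t) ^+ 2).
  exact: (@mp_residual R p m m0 t t0 (sample w) p0).
have mm : measurable_fun setT (fun w => mp_equation t (p%:R / m%:R) (trace_stat w) ^+ 2).
  have ms := measurable_trace_stat; apply: measurable_funX; apply: measurable_funB.
    apply: measurable_funM; first exact: measurable_cst.
    apply: measurable_funB; first exact: measurable_cst.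
    by apply: measurable_funM => //; exact: measurable_cst.
  apply: measurable_funM.
    by apply: measurable_funM => //; exact: measurable_cst.
  apply: measurable_invr; apply: measurable_funD; first exact: measurable_cst.
  by apply: measurable_funM => //; exact: measurable_cst.
have i0 : itg (fun w => mp_equation t (p%:R / m%:R) (trace_stat w) ^+ 2).
  by apply: (itg_le mm _ i1) => w; rewrite ger0_norm ?sqr_ge0.
split=> //; apply: (le_trans (Ex_le i0 i1 le1)).
have i3 k : itg (fun w => 2 * dev k (sample w)) by apply: itgZ; have [] := hd k.
have ic : itg (fun=> 2 * (m%:R^-1 / t) ^+ 2 : R) by exact: itg_cst.
rewrite ExZ; last by apply: itg_sum => k _; exact: itgD.
rewrite Ex_sum; last by move=> k _; exact: itgD.
rewrite ler_pdivrMl//.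
have -> : m%:R * (2 * m%:R^-1 ^+ 2 * (V + t^-1 ^+ 2)) =
    \sum_(k < m) (2 * (m%:R^-1 ^+ 2 * V) + 2 * (m%:R^-1 / t) ^+ 2).
  rewrite sumr_const card_ord -[RHS]mulr_natl; ring.
apply: ler_sum => k _; rewrite ExD// Ex_cst lerD2r ExZ; last by have [] := hd k.
by rewrite ler_pM2l//; have [] := hd k.
Qed.

(** The equation with parameter [lam] is expansive and vanishes at the target, so its value at
    [trace_stat] controls the distance. That value is the residual at parameter p/m plus the cost of
    changing the parameter; squaring the sum gives the factors 2. *)
Lemma trace_stat_mean (lam : R) : 0 < lam ->
  (lam * t) ^+ 2 * (Ex trace_stat - mp_stieltjes lam t) ^+ 2 <=
  4 * m%:R^-1 ^+ 2 * (V + t^-1 ^+ 2) + 2 * (lam - p%:R / m%:R) ^+ 2 * (1 + t^-1) ^+ 2.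
Proof.
move=> l0; set st := mp_stieltjes lam t; set y := p%:R / m%:R.
have [st0 st1] := mp_stieltjes_root l0 t0.
have [i1 h1] := trace_stat_residual; rewrite -/y in i1 h1.
have y0 : 0 <= y by rewrite divr_ge0.
have ms := measurable_trace_stat.
have its := itg_trace_stat.
have bnd w : (lam * t) ^+ 2 * (trace_stat w - st) ^+ 2 <=
   2 * mp_equation t y (trace_stat w) ^+ 2 + 2 * (lam - y) ^+ 2 * (1 + t^-1) ^+ 2.
  have [s0 s1] := trace_stat_bounds w; set s := trace_stat w in s0 s1 *.
  have e1 := mp_equation_expansive (ltW t0) (ltW l0) s0 st0.
  rewrite -/st in st1; rewrite st1 subr0 in e1.
  have e2 := mp_equation_param (ltW t0) y0 (ltW l0) s0 s1.
  have st' : s <= t^-1 by rewrite -[X in _ <= X]mulr1 ler_pdivlMl.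
  have e3 : `|mp_equation t lam s - mp_equation t y s| <= `|lam - y| * (1 + t^-1).
    by apply: (le_trans e2); rewrite ler_wpM2l// lerD2l.
  rewrite -exprMn -real_normK ?num_real// normrM (ger0_norm (mulr_ge0 (ltW l0) (ltW t0))).
  apply: (@le_trans _ _ (`|mp_equation t lam s| ^+ 2)).
    by rewrite lerXn2r ?nnegrE ?mulr_ge0// ltW.
  rewrite real_normK ?num_real//.
  have -> : 2 * (lam - y) ^+ 2 * (1 + t^-1) ^+ 2 = 2 * ((lam - y) * (1 + t^-1)) ^+ 2.
    by ring.
  set a := mp_equation t lam s in e3 *; set b := mp_equation t y s in e3 *.
  have : (a - b) ^+ 2 <= ((lam - y) * (1 + t^-1)) ^+ 2.
    rewrite -real_normK ?num_real// -[X in _ <= X]real_normK ?num_real//.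
    rewrite lerXn2r ?nnegrE// normrM (@ger0_norm _ (1 + t^-1))//.
    by rewrite addr_ge0// invr_ge0 ltW.
  have -> : a ^+ 2 = 2 * b ^+ 2 + 2 * (a - b) ^+ 2 - (2 * b - a) ^+ 2 by ring.
  have := sqr_ge0 (2 * b - a); lra.
have is2 : itg (fun w => (trace_stat w - st) ^+ 2).
  apply: (@itg_bounded _ _ _ _ _ ((t^-1 + st) ^+ 2)).
    by apply: measurable_funX; apply: measurable_funB => //; exact: measurable_cst.
  move=> w; have [s0 s1] := trace_stat_bounds w.
  have st' : trace_stat w <= t^-1 by rewrite -[X in _ <= X]mulr1 ler_pdivlMl.
  rewrite normrX lerXn2r ?nnegrE ?addr_ge0 ?invr_ge0 ?(ltW t0)//.
  by rewrite (le_trans (ler_normB _ _))// !ger0_norm// lerD2r.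
set mu := Ex trace_stat.
(* Jensen by the tangent line of the parabola at [mu]: the difference of the two integrands is (s -
   mu)^2. *)
have jensen : (mu - st) ^+ 2 <= Ex (fun w => (trace_stat w - st) ^+ 2).
  have ic (a : R) : itg (fun=> a) by exact: itg_cst.
  have i5 : itg (fun w => (2 * (mu - st)) * trace_stat w - (mu - st) * (mu + st)).
    by apply: itgB => //; exact: itgZ.
  apply: (@le_trans _ _ (Ex (fun w => (2 * (mu - st)) * trace_stat w - (mu - st) * (mu + st)))).
    rewrite ExB// ?ExZ ?Ex_cst -/mu//; last exact: itgZ.
    rewrite le_eqVlt; apply/orP; left; apply/eqP; ring.
  apply: Ex_le => // w; rewrite -subr_ge0.
  rewrite (_ : _ - _ = (trace_stat w - mu) ^+ 2); last by ring.
  exact: sqr_ge0.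
apply: (@le_trans _ _ (Ex (fun w => (lam * t) ^+ 2 * (trace_stat w - st) ^+ 2))).
  by rewrite ExZ// ler_wpM2l ?sqr_ge0.
have ic : itg (fun=> 2 * (lam - y) ^+ 2 * (1 + t^-1) ^+ 2) by exact: itg_cst.
have i7 : itg (fun w => 2 * mp_equation t y (trace_stat w) ^+ 2) by exact: itgZ.
apply: (le_trans (Ex_le (itgZ ((lam * t) ^+ 2) is2) (itgD i7 ic) bnd)).
rewrite ExD// Ex_cst lerD2r ExZ//; lra.
Qed.

End trace_moments.

(** * Integrals of the semicircle type *)

Section arccos_endpoints.
Context {R : realType}.

(** The primitive below involves arccosines reaching 1 and -1 at the endpoints, so continuity up to
    these values is needed. It follows from the strict monotonicity of [cos] on [0, pi]. *)
Lemma acos_cvg1 (U : Type) (F : set_system U) (FF : Filter F) (f : U -> R) :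
  f @ F --> (1 : R) -> (\forall x \near F, -1 <= f x <= 1) -> acos (f x) @[x --> F] --> (0 : R).
Proof.
move=> f1 fb; apply/cvgrPdist_lt => e e0.
pose e' := Num.min e pi.
have e'0 : 0 < e' by rewrite lt_min e0 pi_gt0.
have e'pi : e' <= pi by rewrite ge_min lexx orbT.
have ce : cos e' < 1.
  by rewrite -cos0 ltr_cos// ?in_itv/= ?lexx ?pi_ge0 ?e'pi ?(ltW e'0).
have d0 : 0 < 1 - cos e' by rewrite subr_gt0.
move/cvgrPdist_lt : f1 => /(_ _ d0) f1.
near=> x.
have fx : -1 <= f x <= 1 by near: x.
rewrite sub0r normrN ger0_norm ?acos_ge0//.
apply: lt_le_trans (_ : e' <= e); last by rewrite ge_min lexx.
rewrite -ltr_cos ?in_itv/= ?acos_ge0 ?acos_lepi ?e'pi ?(ltW e'0)//.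
rewrite acosK ?in_itv//.
have : `|1 - f x| < 1 - cos e' by near: x; exact: f1.
by move=> /(le_lt_trans (ler_norm _)); lra.
Unshelve. all: by end_near. Qed.

Lemma acos_cvgN1 (U : Type) (F : set_system U) (FF : Filter F) (f : U -> R) :
  f @ F --> (-1 : R) -> (\forall x \near F, -1 <= f x <= 1) -> acos (f x) @[x --> F] --> (pi : R).
Proof.
move=> f1 fb.
have h : acos (- f x) @[x --> F] --> (0 : R).
  apply: acos_cvg1; first by rewrite -[X in _ --> X]opprK; exact: cvgN.
  near=> x; have /andP[h1 h2] : -1 <= f x <= 1 by near: x.
  by apply/andP; split; lra.
have : pi - acos (- f x) @[x --> F] --> (pi - 0 : R) by apply: cvgB => //; exact: cvg_cst.
rewrite subr0; apply: cvg_trans; apply: near_eq_cvg.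
near=> x; have fx : -1 <= f x <= 1 by near: x.
by rewrite acosN//; ring.
Unshelve. all: by end_near. Qed.

End arccos_endpoints.

Section semicircle_integral.
Context {R : realType}.
Variables (a b c : R).
Hypothesis ab : a < b.
Hypothesis ac : 0 < a + c.

Let A := a + c.
Let B := b + c.
Let S (x : R) : R := Num.sqrt ((b - x) * (x - a)).
Let al (x : R) := (2 * x - (a + b)) / (b - a).
Let be (x : R) := (A + B) / (B - A) - 2 * A * B / (B - A) * (x + c)^-1.
Let k1 := (A + B) / 2.
Let k2 : R := Num.sqrt (A * B).

Let AB : A < B. Proof. by rewrite ltrD2r. Qed.
Let B0 : 0 < B. Proof. exact: lt_trans AB. Qed.
Let d0 : 0 < B - A. Proof. by rewrite subr_gt0. Qed.

Let al_sq x : 1 - al x ^+ 2 = 4 * ((b - x) * (x - a)) / (b - a) ^+ 2.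
Proof. by rewrite /al; field; rewrite gt_eqF// subr_gt0. Qed.

Let be_sq x : 0 < x + c ->
  1 - be x ^+ 2 = 4 * (A * B) * ((b - x) * (x - a)) / ((x + c) * (B - A)) ^+ 2.
Proof.
move=> x0; rewrite /be /A /B; field.
by rewrite gt_eqF// gt_eqF// /B /A; rewrite (_ : _ - _ = b - a) ?subr_gt0//; ring.
Qed.

Let itv_le1 (y : R) : 0 <= 1 - y ^+ 2 -> -1 <= y <= 1.
Proof. by rewrite subr_ge0 -ler_norml -real_normK ?num_real// expr_le1. Qed.

Let itv_lt1 (y : R) : 0 < 1 - y ^+ 2 -> -1 < y < 1.
Proof. by rewrite subr_gt0 -ltr_norml -real_normK ?num_real// expr_lt1. Qed.

Let prod_gt0 x : a < x < b -> 0 < (b - x) * (x - a).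
Proof. by move=> /andP[h1 h2]; rewrite mulr_gt0// subr_gt0. Qed.

Let xc0 x : a <= x -> 0 < x + c.
Proof. by move=> h; apply: lt_le_trans ac _; rewrite lerD2r. Qed.

(** With z = x + c, S / z = (A + B - z - A B / z) / S. The maps [al], affine in x, and [be], affine
    in 1/z, carry [a, b] onto [-1, 1]; their arccosines have derivatives - 1 / S and - k2 / (z S),
    which with the derivative of [S] produce all the terms. *)
Let prim (x : R) := S x - k1 * acos (al x) + k2 * acos (be x).

Let derive_S x : a < x < b -> is_derive x 1 S ((a + b - 2 * x) / (2 * S x)).
Proof.
move=> xab; have p0 := prod_gt0 xab.
have h : is_derive x 1 (fun x => (b - x) * (x - a)) (a + b - 2 * x).
  apply: is_derive_eq; rewrite /GRing.scale /=; ring.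
have := @is_derive1_comp R Num.sqrt (fun z => (b - z) * (z - a)) x _ _ (is_derive1_sqrt p0) h.
by move=> h'; apply: (is_derive_eq h'); rewrite mulrC.
Qed.

Let derive_al x : a < x < b -> is_derive x 1 (fun x => acos (al x)) (- (S x)^-1).
Proof.
move=> xab; have p0 := prod_gt0 xab.
have ba : 0 < b - a by rewrite subr_gt0.
have h1 : 0 < 1 - al x ^+ 2 by rewrite al_sq divr_gt0 ?exprn_gt0// mulr_gt0.
have h : is_derive x 1 al (2 / (b - a)).
  apply: is_derive_eq; rewrite /GRing.scale /=; ring.
have := @is_derive1_comp R acos al x _ _ (is_derive1_acos (itv_lt1 h1)) h.
move=> h'; apply: (is_derive_eq h'); rewrite al_sq.
have -> : Num.sqrt (4 * ((b - x) * (x - a)) / (b - a) ^+ 2) = 2 * S x / (b - a).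
  have -> : 4 * ((b - x) * (x - a)) / (b - a) ^+ 2 = (2 * S x / (b - a)) ^+ 2.
    by rewrite -(sqr_sqrtr (ltW p0)) -/(S x); field; rewrite gt_eqF.
  by rewrite sqrtr_sqr ger0_norm// divr_ge0 ?(ltW ba)// mulr_ge0// sqrtr_ge0.
by field; rewrite !gt_eqF// sqrtr_gt0.
Qed.

Let derive_be x : a < x < b ->
  is_derive x 1 (fun x => acos (be x)) (- k2 / ((x + c) * S x)).
Proof.
move=> xab; have p0 := prod_gt0 xab; have /andP[ax xb] := xab.
have x0 := xc0 (ltW ax).
have AB0 : 0 < A * B by rewrite mulr_gt0.
have h1 : 0 < 1 - be x ^+ 2.
  rewrite be_sq//; apply: divr_gt0; last by rewrite exprn_gt0// mulr_gt0.
  by apply: mulr_gt0 => //; apply: mulr_gt0.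
have hV : is_derive x 1 (fun x => (x + c)^-1) (- (x + c) ^- 2 *: 1).
  apply: is_deriveV; first by rewrite gt_eqF.
  by apply: is_derive_eq; rewrite addr0.
have h : is_derive x 1 be (2 * A * B / (B - A) * (x + c) ^- 2).
  by apply: is_derive_eq; rewrite /GRing.scale /=; ring.
have := @is_derive1_comp R acos be x _ _ (is_derive1_acos (itv_lt1 h1)) h.
move=> h'; apply: (is_derive_eq h'); rewrite be_sq//.
have -> : Num.sqrt (4 * (A * B) * ((b - x) * (x - a)) / ((x + c) * (B - A)) ^+ 2) =
    2 * k2 * S x / ((x + c) * (B - A)).
  have q0 : 0 < (x + c) * (B - A) by rewrite mulr_gt0.
  have -> : 4 * (A * B) * ((b - x) * (x - a)) / ((x + c) * (B - A)) ^+ 2 =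
      (2 * k2 * S x / ((x + c) * (B - A))) ^+ 2.
    rewrite -(sqr_sqrtr (ltW p0)) -/(S x) -(sqr_sqrtr (ltW AB0)) -/k2.
    by field; rewrite !gt_eqF.
  by rewrite sqrtr_sqr ger0_norm// divr_ge0 ?(ltW q0)// !mulr_ge0// sqrtr_ge0.
have k20 : 0 < k2 by rewrite sqrtr_gt0.
have k2E : k2 * k2 = A * B by rewrite -expr2 sqr_sqrtr// ltW.
have -> : 2 * A * B = 2 * (k2 * k2) by rewrite k2E mulrA.
have S0 : 0 < S x by rewrite sqrtr_gt0.
by field; rewrite !gt_eqF.
Qed.

Let derive_prim x : a < x < b -> is_derive x 1 prim (S x / (x + c)).
Proof.
move=> xab; have p0 := prod_gt0 xab; have /andP[ax xb] := xab.
have x0 := xc0 (ltW ax).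
have S0 : 0 < S x by rewrite sqrtr_gt0.
have k2E : k2 ^+ 2 = A * B by rewrite sqr_sqrtr// mulr_ge0 ?ltW.
have S2 : S x ^+ 2 = (b - x) * (x - a) by rewrite sqr_sqrtr// ltW.
have h1 := derive_S xab; have h2 := derive_al xab; have h3 := derive_be xab.
apply: is_derive_eq; rewrite /GRing.scale /=.
have -> : S x / (x + c) = S x ^+ 2 / ((x + c) * S x) by field; rewrite !gt_eqF.
rewrite S2.
have -> : k2 * (- k2 / ((x + c) * S x)) = - (A * B) / ((x + c) * S x).
  by rewrite -k2E; field; rewrite !gt_eqF.
by rewrite /k1 /A /B; field; rewrite !gt_eqF.
Qed.

Let al_b : al b = 1. Proof. by rewrite /al; field; rewrite gt_eqF ?subr_gt0. Qed.
Let al_a : al a = -1. Proof. by rewrite /al; field; rewrite gt_eqF ?subr_gt0. Qed.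
Let be_b : be b = 1.
Proof. by rewrite /be -/B; field; rewrite !gt_eqF. Qed.
Let be_a : be a = -1.
Proof. by rewrite /be -/A; field; rewrite !gt_eqF. Qed.

Let cont_S : continuous S.
Proof.
move=> x; apply: continuous_comp; last exact: sqrt_continuous.
apply: cvgM; apply: cvgB => //; exact: cvg_cst.
Qed.

Let cont_al : continuous al.
Proof.
move=> x; apply: cvgM; last exact: cvg_cst.
by apply: cvgB; [apply: cvgM => //; exact: cvg_cst|exact: cvg_cst].
Qed.

Let cont_be x : a <= x -> be z @[z --> x] --> be x.
Proof.
move=> ax; apply: cvgB; first exact: cvg_cst.
apply: cvgM; first exact: cvg_cst.
by apply: cvgV; [rewrite gt_eqF// xc0|apply: cvgD => //; exact: cvg_cst].
Qed.

Let al_range x : a <= x <= b -> -1 <= al x <= 1.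
Proof.
move=> /andP[ax xb]; apply: itv_le1; rewrite al_sq divr_ge0 ?sqr_ge0//.
by rewrite !mulr_ge0// subr_ge0.
Qed.

Let be_range x : a <= x <= b -> -1 <= be x <= 1.
Proof.
move=> /andP[ax xb]; apply: itv_le1; rewrite be_sq ?xc0// divr_ge0 ?sqr_ge0//.
by rewrite !mulr_ge0 ?subr_ge0// ltW.
Qed.

(** [S] vanishes at both ends, and both arccosines go from pi at [a] to 0 at [b], so the integral is
    pi (k1 - k2). The primitive is differentiated on the open interval only, and enters at the ends
    through its limits. *)
Lemma semicircle_integral :
  (\int[@lebesgue_measure R]_(x in `[a, b]) (Num.sqrt ((b - x) * (x - a)) / (x + c))%:E =
  (pi * ((a + b) / 2 + c - Num.sqrt ((a + c) * (b + c))))%:E)%E.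
Proof.
have near_l : \forall z \near a^'+, a <= z <= b.
  near=> z; apply/andP; split; last by near: z; exact: nbhs_right_le.
  by apply: ltW; near: z; exact: nbhs_right_gt.
have near_r : \forall z \near b^'-, a <= z <= b.
  near=> z; apply/andP; split; first by near: z; exact: nbhs_left_ge.
  by apply: ltW; near: z; exact: nbhs_left_lt.
rewrite (@continuous_FTC2 R (fun x => S x / (x + c)) prim a b ab).
- rewrite -EFinB; congr EFin; rewrite /prim al_a al_b be_a be_b acos1 acosN1 !mulr0.
  rewrite (_ : S b = 0); last by rewrite /S subrr mul0r sqrtr0.
  rewrite (_ : S a = 0); last by rewrite /S subrr mulr0 sqrtr0.
  by rewrite /k1 /k2 /A /B; field.
- apply: continuous_in_subspaceT => x; rewrite inE /= in_itv /= => /andP[ax xb].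
  apply: cvgM; first exact: cont_S.
  by apply: cvgV; [rewrite gt_eqF// xc0|apply: cvgD => //; exact: cvg_cst].
- split.
  + move=> x; rewrite in_itv /= => xab.
    by have := derive_prim xab; case.
  + have -> : prim a = S a - k1 * pi + k2 * pi by rewrite /prim al_a be_a acosN1.
    apply: cvgD; first apply: cvgB.
    * by apply: cvg_at_right_filter; exact: cont_S.
    * apply: cvgM; first exact: cvg_cst.
      apply: acos_cvgN1; first by rewrite -al_a; apply: cvg_at_right_filter; exact: cont_al.
      by near=> z; apply: al_range; near: z.
    * apply: cvgM; first exact: cvg_cst.
      apply: acos_cvgN1; first by rewrite -be_a; apply: cvg_at_right_filter; exact: cont_be.
      by near=> z; apply: be_range; near: z.
  + have -> : prim b = S b - k1 * 0 + k2 * 0 by rewrite /prim al_b be_b acos1.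
    apply: cvgD; first apply: cvgB.
    * by apply: cvg_at_left_filter; exact: cont_S.
    * apply: cvgM; first exact: cvg_cst.
      apply: acos_cvg1; first by rewrite -al_b; apply: cvg_at_left_filter; exact: cont_al.
      by near=> z; apply: al_range; near: z.
    * apply: cvgM; first exact: cvg_cst.
      apply: acos_cvg1; first by rewrite -be_b; apply: cvg_at_left_filter; apply: cont_be; exact: ltW.
      by near=> z; apply: be_range; near: z.
- move=> x; rewrite in_itv /= => xab; rewrite derive1E.
  by have [_ ->] := derive_prim xab.
Unshelve. all: by end_near. Qed.

End semicircle_integral.

(** * Positive functionals and distribution functions *)

Section positive_functionals.
Context {R : realType}.
Implicit Types (f g h : R -> R).

(** Boundedness is asked on x >= 0 only, where the spectra and the limit law live; this admits 1 /
    (x + t). *)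
Definition admissible h : Prop :=
  measurable_fun setT h /\ exists C : R, forall x, 0 <= x -> `|h x| <= C.

(** The common features of an empirical spectral mean and of integration against the limit law; the
    convergence argument needs nothing else from either. *)
Record mean_functional (L : (R -> R) -> R) : Prop := MeanFunctional {
  mean_linear : forall (c : R) f g, admissible f -> admissible g ->
    L (fun x => c * f x + g x) = c * L f + L g ;
  mean_mono : forall f g, admissible f -> admissible g ->
    (forall x, 0 <= x -> f x <= g x) -> L f <= L g ;
  mean1 : L (fun=> 1) = 1 }.

Lemma admissible_cst (c : R) : admissible (fun=> c).
Proof. by split; [exact: measurable_cst|exists `|c|]. Qed.

Lemma admissibleD f g : admissible f -> admissible g -> admissible (fun x => f x + g x).
Proof.
move=> [mf [C1 h1]] [mg [C2 h2]]; split; first exact: measurable_funD.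
by exists (C1 + C2) => x x0; rewrite (le_trans (ler_normD _ _))// lerD ?h1 ?h2.
Qed.

Lemma admissibleM f g : admissible f -> admissible g -> admissible (fun x => f x * g x).
Proof.
move=> [mf [C1 h1]] [mg [C2 h2]]; split; first exact: measurable_funM.
by exists (C1 * C2) => x x0; rewrite normrM ler_pM ?h1 ?h2.
Qed.

Lemma admissibleX f n : admissible f -> admissible (fun x => f x ^+ n).
Proof.
move=> hf; elim: n => [|n IH].
  by under eq_fun do rewrite expr0; exact: admissible_cst.
by under eq_fun do rewrite exprS; exact: admissibleM.
Qed.

Lemma admissible_sum (I : Type) (r : seq I) (F : I -> R -> R) :
  (forall i, admissible (F i)) -> admissible (fun x => \sum_(i <- r) F i x).
Proof.
move=> h; elim: r => [|i r IH].
  by under eq_fun do rewrite big_nil; exact: admissible_cst.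
by under eq_fun do rewrite big_cons; exact: admissibleD.
Qed.

Lemma admissible_inv (t : R) : 0 < t -> admissible (fun x => (x + t)^-1).
Proof.
move=> t0; split.
  by apply: measurable_invr; apply: measurable_funD => //; exact: measurable_cst.
exists t^-1 => x x0; have xt : 0 < x + t by rewrite ltr_wpDl.
by rewrite ger0_norm ?invr_ge0 ?(ltW xt)// lef_pV2 ?posrE// lerDr.
Qed.

Lemma admissible_le (x0 : R) : admissible (fun x => (x <= x0)%R%:R).
Proof.
split; last by exists 1 => x _; case: (x <= x0)%R; rewrite ?normr1 ?normr0.
have -> : (fun x : R => (x <= x0)%R%:R) = \1_(`]-oo, x0]%classic) :> (R -> R).
  by apply/funext => x; rewrite indicE mem_setE in_itv.
exact: measurable_indic.
Qed.

Let mean0 L : mean_functional L -> L (fun=> 0) = 0.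
Proof.
move=> hL; have -> : (fun=> 0) = (fun=> -1 * 1 + 1) :> (R -> R) by apply/funext => x; ring.
have h := mean_linear hL (-1) (admissible_cst 1) (admissible_cst 1).
by rewrite [LHS]h (mean1 hL); ring.
Qed.

Lemma meanZ L c f : mean_functional L -> admissible f -> L (fun x => c * f x) = c * L f.
Proof.
move=> hL hf; have := mean_linear hL c hf (admissible_cst 0).
by rewrite mean0// addr0 => <-; congr L; apply/funext => x; rewrite addr0.
Qed.

Lemma meanD L f g : mean_functional L -> admissible f -> admissible g ->
  L (fun x => f x + g x) = L f + L g.
Proof.
move=> hL hf hg; have := mean_linear hL 1 hf hg.
by rewrite mul1r => <-; congr L; apply/funext => x; rewrite mul1r.
Qed.

Lemma mean_cst L c : mean_functional L -> L (fun=> c) = c.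
Proof.
move=> hL; have -> : (fun=> c) = (fun=> c * 1) :> (R -> R) by apply/funext => x; ring.
by rewrite [LHS](meanZ c hL (admissible_cst 1)) (mean1 hL) mulr1.
Qed.

Lemma mean_sum L (I : Type) (r : seq I) (F : I -> R -> R) : mean_functional L ->
  (forall i, admissible (F i)) ->
  L (fun x => \sum_(i <- r) F i x) = \sum_(i <- r) L (F i).
Proof.
move=> hL h; elim: r => [|i r IH].
  by rewrite big_nil -[RHS](mean0 hL); congr L; apply/funext => x; rewrite big_nil.
rewrite big_cons -IH -meanD//; last exact: admissible_sum.
by congr L; apply/funext => x; rewrite big_cons.
Qed.

Let y (x : R) := (x + 1)^-1.

Let adm_y : admissible y. Proof. exact: admissible_inv. Qed.

Let y_range x : 0 <= x -> 0 < y x <= 1.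
Proof.
move=> x0; have x1 : 0 < x + 1 by rewrite ltr_wpDl.
by rewrite invr_gt0 x1/= invf_le1// lerDr.
Qed.

Let sg j : R := j.+2%:R^-1.

Let sg0 j : 0 < sg j. Proof. by rewrite invr_gt0 ltr0n. Qed.
Let sg12 j : sg j <= 2^-1. Proof. by rewrite lef_pV2 ?posrE ?ltr0n// ler_nat. Qed.

Definition spectral_shift j : R := 1 - j.+2%:R^-1.

Lemma spectral_shift_gt0 j : 0 < spectral_shift j.
Proof. by have := sg12 j; rewrite /spectral_shift -/(sg j); lra. Qed.

(* With y = 1/(x+1) and s = 1/(j+2), 1/(x + spectral_shift j) = y/(1 - s y), whose
   Taylor expansion in s has the powers of y as coefficients. *)
Let rem k j x := y x ^+ k.+1 / (1 - sg j * y x).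

Let den_gt0 j x : 0 <= x -> 2^-1 <= 1 - sg j * y x.
Proof.
move=> x0; have /andP[h1 h2] := y_range x0.
have : sg j * y x <= 2^-1 * 1 by rewrite ler_pM// ?(ltW h1)// ltW.
lra.
Qed.

Let remE k j x : 0 <= x ->
  (x + spectral_shift j)^-1 = \sum_(i < k) sg j ^+ i * y x ^+ i.+1 + sg j ^+ k * rem k j x.
Proof.
move=> x0; have h := den_gt0 j x0.
have d0 : 1 - sg j * y x != 0 by rewrite gt_eqF//; apply: lt_le_trans h.
have x1 : x + 1 != 0 by rewrite gt_eqF// ltr_wpDl.
have xt : x + spectral_shift j != 0 by rewrite gt_eqF// ltr_wpDl// spectral_shift_gt0.
elim: k => [|k IH].
  rewrite big_ord0 add0r expr0 mul1r /rem expr1.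
  apply: (mulIf xt); rewrite mulVf//.
  apply: (mulIf d0); rewrite mul1r mulrAC mulfVK//.
  by rewrite /y /spectral_shift -/(sg j); field.
rewrite big_ord_recr /= IH -addrA; congr (_ + _).
rewrite /rem [y x ^+ k.+2]exprS [sg j ^+ k.+1]exprS; field.
by rewrite d0.
Qed.

Let adm_rem k j : admissible (rem k j).
Proof.
apply: admissibleM; first exact: admissibleX.
split; last first.
  exists 2 => x x0; have h := den_gt0 j x0.
  have h' : 0 < 1 - sg j * y x by apply: lt_le_trans h.
  by rewrite ger0_norm ?invr_ge0 ?(ltW h')// invf_ple ?posrE.
apply: measurable_invr; apply: measurable_funB; first exact: measurable_cst.
by apply: measurable_funM; [exact: measurable_cst|case: adm_y].
Qed.

Let rem_near k j x : 0 <= x -> y x ^+ k.+1 <= rem k j x <= y x ^+ k.+1 + 2 * sg j.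
Proof.
move=> x0; have /andP[y0 y1] := y_range x0; have h := den_gt0 j x0.
have d0 : 0 < 1 - sg j * y x by apply: lt_le_trans h.
have yk0 : 0 <= y x ^+ k.+1 by rewrite exprn_ge0// ltW.
have yk1 : y x ^+ k.+1 <= 1 by rewrite exprn_ile1// ltW.
have sy : 0 <= sg j * y x by rewrite mulr_ge0 ?(ltW y0)// ltW.
have sy1 : sg j * y x <= sg j by rewrite ger_pMr.
rewrite /rem; apply/andP; split.
  by rewrite ler_pdivlMr// ler_piMr// gerBl.
rewrite ler_pdivrMr// -subr_ge0.
have : y x ^+ k.+1 * (sg j * y x) <= 1 * sg j by rewrite ler_pM.
have : 2 * sg j * 2^-1 <= 2 * sg j * (1 - sg j * y x).
  by rewrite ler_wpM2l// mulr_ge0// ltW.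
rewrite mul1r.
set Y := y x ^+ k.+1; set s := sg j * y x.
have := sg0 j; lra.
Qed.

Let mean_rem k j L : mean_functional L ->
  L (fun x => (x + spectral_shift j)^-1) =
  \sum_(i < k) sg j ^+ i * L (fun x => y x ^+ i.+1) + sg j ^+ k * L (rem k j).
Proof.
move=> hL.
have ad i : admissible (fun x => y x ^+ i.+1) by exact: admissibleX.
have ad' i : admissible (fun x => sg j ^+ i * y x ^+ i.+1).
  by apply: admissibleM => //; exact: admissible_cst.
have adr : admissible (fun x => sg j ^+ k * rem k j x).
  by apply: admissibleM; [exact: admissible_cst|exact: adm_rem].
have ads : admissible (fun x => \sum_(i < k) sg j ^+ i * y x ^+ i.+1).
  exact: (@admissible_sum _ _ (fun (i : 'I_k) x => sg j ^+ i * y x ^+ i.+1)).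
have adi := admissible_inv (spectral_shift_gt0 j).
transitivity (L (fun x => \sum_(i < k) sg j ^+ i * y x ^+ i.+1 + sg j ^+ k * rem k j x)).
  apply/eqP; rewrite eq_le; apply/andP; split; apply: mean_mono => //;
    by [exact: admissibleD|move=> x x0; rewrite -remE].
rewrite meanD// (@mean_sum L _ _ (fun (i : 'I_k) x => sg j ^+ i * y x ^+ i.+1))//.
rewrite meanZ//; congr (_ + _); apply: eq_bigr => i _.
by rewrite meanZ.
Qed.

Let mean_rem_near k j L : mean_functional L ->
  `|L (rem k j) - L (fun x => y x ^+ k.+1)| <= 2 * sg j.
Proof.
move=> hL.
have ad i : admissible (fun x => y x ^+ i) by exact: admissibleX.
have h1 : L (fun x => y x ^+ k.+1) <= L (rem k j).
  by apply: mean_mono => // x x0; case/andP: (rem_near k j x0).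
have h2 : L (rem k j) <= L (fun x => y x ^+ k.+1) + 2 * sg j.
  rewrite -[X in _ <= _ + X](mean_cst _ hL) -meanD//; last exact: admissible_cst.
  apply: mean_mono => //; first by apply: admissibleD => //; exact: admissible_cst.
  by move=> x x0; case/andP: (rem_near k j x0).
by rewrite ger0_norm; lra.
Qed.

Variables (L : (R -> R) -> R) (Ln : nat -> (R -> R) -> R).
Hypothesis hL : mean_functional L.
Hypothesis hLn : forall n, mean_functional (Ln n).
Hypothesis stieltjes_cvg : forall j,
  Ln n (fun x => (x + spectral_shift j)^-1) @[n --> \oo] -->
  L (fun x => (x + spectral_shift j)^-1).

(** Strong induction. Once the lower moments converge, the expansion can be solved for the
    remainder, whose mean thus converges for each [j]. For large [j] the remainder is within 2 / (j
    + 2) of the next power of y, uniformly in [n], so the two limits can be exchanged. *)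
Let moment_cvgS k : Ln n (fun x => y x ^+ k.+1) @[n --> \oo] --> L (fun x => y x ^+ k.+1).
Proof.
elim/ltn_ind: k => k IH.
have rem_cvg j : Ln n (rem k j) @[n --> \oo] --> L (rem k j).
  have s0 : sg j ^+ k != 0 by rewrite expf_neq0// gt_eqF.
  have E M : mean_functional M -> M (rem k j) = (sg j ^+ k)^-1 *
     (M (fun x => (x + spectral_shift j)^-1) - \sum_(i < k) sg j ^+ i * M (fun x => y x ^+ i.+1)).
    by move=> hM; rewrite (mean_rem k j hM) addrAC subrr add0r mulKf.
  rewrite E//; under eq_fun do rewrite E//.
  apply: cvgM; first exact: cvg_cst.
  apply: cvgB => //.
  apply: cvg_big => //; last by move=> i _; apply: cvgM; [exact: cvg_cst|exact: IH].
  exact: add_continuous.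
apply/cvgrPdist_lt => e e0.
have [j hj] : exists j, 4 * sg j < e / 2.
  (* The approximation costs 2 / (j + 2) once for the limit and once for [Ln n]; together they must
     stay below e / 2. *)
  pose j := Num.truncn (8 / e); exists j.
  have h := truncnS_gt (8 / e).
  have j0 : 0 < j.+2%:R :> R by rewrite ltr0n.
  rewrite /sg ltr_pdivrMr//.
  have : 8 < j.+1%:R * e by rewrite -ltr_pdivrMr.
  have : j.+1%:R <= j.+2%:R :> R by rewrite ler_nat.
  move=> h1 h2.
  have : j.+1%:R * e <= j.+2%:R * e by rewrite ler_pM2r.
  lra.
have e2 : 0 < e / 2 by rewrite divr_gt0.
have := rem_cvg j => /cvgrPdist_lt /(_ _ e2); apply: filterS => n hn.
have := mean_rem_near k j hL; have := mean_rem_near k j (hLn n).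
move: hn; rewrite !ltr_norml !ler_norml => /andP[? ?] /andP[? ?] /andP[? ?].
by apply/andP; split; lra.
Qed.

Let poly_cvg (q : {poly R}) : Ln n (fun x => q.[y x]) @[n --> \oo] --> L (fun x => q.[y x]).
Proof.
have E M : mean_functional M ->
    M (fun x => q.[y x]) = \sum_(i < size q) q`_i * M (fun x => y x ^+ i).
  move=> hM.
  have ad i : admissible (fun x => y x ^+ i) by exact: admissibleX.
  under eq_fun do rewrite horner_coef.
  rewrite (@mean_sum M _ _ (fun (i : 'I_(size q)) x => q`_i * y x ^+ i))//.
    by apply: eq_bigr => i _; rewrite meanZ.
  by move=> i; apply: admissibleM => //; exact: admissible_cst.
rewrite E//; under eq_fun do rewrite E//.
apply: cvg_big => //; first exact: add_continuous.
move=> [[|i] /= _] _; apply: cvgM; try exact: cvg_cst.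
  have -> : (fun x => y x ^+ 0) = (fun=> 1) by apply/funext => x; rewrite expr0.
  by rewrite mean1//; under eq_fun do rewrite mean1//; exact: cvg_cst.
exact: moment_cvgS.
Qed.

Let adm_poly (q : {poly R}) : admissible (fun x => q.[y x]).
Proof.
under eq_fun do rewrite horner_coef.
apply: (@admissible_sum _ _ (fun (i : 'I_(size q)) x => q`_i * y x ^+ i)) => i.
by apply: admissibleM; [exact: admissible_cst|exact: admissibleX].
Qed.

(* The polynomial (1 - X^N)^M with M ~ c^-N approximates the indicator of [0, c[ on
   [0, 1], exponentially fast in N away from c. *)
Lemma threshold_poly (c : R) (N : nat) : 0 < c < 1 -> exists q : {poly R},
  forall u, 0 < u <= 1 ->
    [/\ 0 <= q.[u] <= 1, q.[u] <= (c / u) ^+ N & 1 - (u / c) ^+ N <= q.[u]].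
Proof.
move=> /andP[c0 c1].
have cN : 0 < c ^+ N by rewrite exprn_gt0.
pose M := Num.truncn ((c ^+ N)^-1).
have M1 : M%:R <= (c ^+ N)^-1 by rewrite truncn_le invr_ge0 ltW.
have M2 : (c ^+ N)^-1 < M.+1%:R by exact: truncnS_gt.
exists ((1 - 'X^N) ^+ M) => u /andP[u0 u1].
rewrite !hornerE.
have uN0 : 0 < u ^+ N by rewrite exprn_gt0.
have uN1 : u ^+ N <= 1 by rewrite exprn_ile1// ltW.
set v := u ^+ N in uN0 uN1 *.
have v1 : 0 <= 1 - v by rewrite subr_ge0.
have bern (z : R) : -1 <= z -> 1 + M%:R * z <= (1 + z) ^+ M.
  move=> z1; elim: (M) => [|K IH]; first by rewrite mul0r addr0 expr0.
  rewrite exprS; apply: (@le_trans _ _ ((1 + z) * (1 + K%:R * z))).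
    have : 0 <= K%:R * (z * z) by rewrite mulr_ge0 ?ler0n// -expr2 sqr_ge0.
    by rewrite -natr1; lra.
  by rewrite ler_wpM2l//; lra.
split.
- by rewrite exprn_ge0//= exprn_ile1// gerBl ltW.
- rewrite expr_div_n.
  (* The upper bound passes to the inverse: (1 + v)^M is at least 1 + M v by Bernoulli, hence at
     least v / c^N, the rounding in [M] being absorbed by v <= 1. *)
  have h1 : (1 - v) ^+ M * (1 + v) ^+ M <= 1.
    rewrite -exprMn exprn_ile1//; first by rewrite mulr_ge0// addr_ge0// ltW.
    by rewrite -subr_ge0 (_ : _ - _ = v ^+ 2) ?sqr_ge0//; ring.
  have h2 : v / c ^+ N <= (1 + v) ^+ M.
    apply: le_trans (bern v _); last by rewrite (le_trans _ (ltW uN0))// lerN10.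
    have : v * (c ^+ N)^-1 <= v * M.+1%:R by rewrite ler_pM2l// ltW.
    rewrite -natr1; lra.
  rewrite -/v ler_pdivlMr//.
  rewrite -[X in _ <= X]mul1r -ler_pdivrMr// -mulrA.
  by apply: le_trans h1; rewrite ler_wpM2l// exprn_ge0.
- rewrite expr_div_n -/v; apply: le_trans (bern (- v) _); last by rewrite lerN2.
  by rewrite mulrN lerD2l lerN2 mulrC ler_wpM2l// ltW.
Qed.

Definition mean_cdf (M : (R -> R) -> R) (x0 : R) : R := M (fun x => (x <= x0)%R%:R).
Local Notation cdf := mean_cdf.

Let cdf_neg M x0 : mean_functional M -> x0 < 0 -> cdf M x0 = 0.
Proof.
move=> hM x00; apply/eqP; rewrite eq_le -(mean_cst 0 hM).
have h x : 0 <= x -> (x <= x0) = false.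
  by move=> h; apply/negbTE; rewrite -ltNge; exact: lt_le_trans h.
by apply/andP; split; apply: mean_mono => //; (try exact: admissible_le);
  (try exact: admissible_cst) => x /h ->.
Qed.

Let cdf_ge0 M x0 : mean_functional M -> 0 <= cdf M x0.
Proof.
move=> hM; rewrite -(mean_cst 0 hM); apply: mean_mono => //.
- exact: admissible_cst.
- exact: admissible_le.
Qed.

(** Since y decreases in x, 1 - q(y) with a threshold at the image of a point between [a] and [b] is
    nearly 1 for x <= a and nearly 0 for x > b. The polynomial serves all functionals at once. The
    left end is raised to max(a, 0) because only x >= 0 is seen. *)
Let cdf_sandwich (a b e : R) : a < b -> 0 < b -> 0 < e ->
  exists q : {poly R}, forall M, mean_functional M ->
   cdf M a <= 1 - M (fun x => q.[y x]) + e /\ 1 - M (fun x => q.[y x]) <= cdf M b + e.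
Proof.
move=> ab b0 e0.
pose a' := Num.max a 0.
have a'0 : 0 <= a' by rewrite le_max lexx orbT.
have a'b : a' < b by rewrite gt_max ab b0.
pose md := (a' + b) / 2.
have md1 : a' < md by rewrite /md; lra.
have md2 : md < b by rewrite /md; lra.
have md0 : 0 < md by apply: le_lt_trans md1.
have c01 : 0 < y md < 1.
  have h : 0 < md + 1 by rewrite ltr_wpDl// ltW.
  by rewrite invr_gt0 h/= invf_lt1// ltrDr.
have /andP[c0 c1] := c01.
have ya : y md < y a' by rewrite /y ltf_pV2 ?posrE ?ltrD2r// ltr_wpDl// ltW.
have yb : y b < y md by rewrite /y ltf_pV2 ?posrE ?ltrD2r// ltr_wpDl// ltW.
have ya0 : 0 < y a' by apply: lt_trans ya.
have yb0 : 0 < y b by rewrite /y invr_gt0 ltr_wpDl// ltW.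
pose rho := Num.max (y md / y a') (y b / y md).
have rho1 : `|rho| < 1.
  rewrite ger0_norm; last by rewrite le_max divr_ge0// ltW.
  by rewrite gt_max !ltr_pdivrMr// !mul1r ya.
have [N hN] : exists N, rho ^+ N < e.
  have := cvg_geometric (1 : R) rho1 => /cvgrPdist_lt /(_ _ e0) [N _ /(_ N (leqnn _))].
  by rewrite sub0r normrN /geometric /= mul1r => h; exists N; apply: le_lt_trans h; exact: ler_norm.
have [q hq] := threshold_poly N c01.
exists q => M hM.
have ad1 := adm_poly q.
have ad2 : admissible (fun x => 1 - q.[y x]).
  have -> : (fun x => 1 - q.[y x]) = (fun x => 1 + (-1) * q.[y x]).
    by apply/funext => x; rewrite mulN1r.
  by apply: admissibleD; [|apply: admissibleM => //]; exact: admissible_cst.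
have E : M (fun x => 1 - q.[y x]) = 1 - M (fun x => q.[y x]).
  have := mean_linear hM (-1) ad1 (admissible_cst 1).
  rewrite (mean1 hM) mulN1r addrC => <-; congr M; apply/funext => x; ring.
have rho0 : 0 <= rho by rewrite le_max divr_ge0// ltW.
have le_rho1 u : y a' <= u -> (y md / u) ^+ N <= rho ^+ N.
  move=> au; have u0 : 0 < u by apply: lt_le_trans au.
  apply: lerXn2r; rewrite ?nnegrE// ?divr_ge0 ?(ltW c0) ?(ltW u0)//.
  by rewrite le_max ler_pM2l// lef_pV2 ?posrE// au.
have le_rho2 u : 0 < u -> u <= y b -> (u / y md) ^+ N <= rho ^+ N.
  move=> u0 ub.
  apply: lerXn2r; rewrite ?nnegrE// ?divr_ge0 ?(ltW c0) ?(ltW u0)//.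
  rewrite le_max; apply/orP; right; apply: ler_wpM2r => //.
  by rewrite invr_ge0 ltW.
rewrite -E -[e](mean_cst e hM) -!meanD//; try exact: admissible_cst; try exact: admissible_le.
split; apply: mean_mono => //; try exact: admissible_le.
- by apply: admissibleD => //; exact: admissible_cst.
- move=> x x0; have yx := y_range x0; have /andP[yx0 yx1] := yx.
  have [/andP[q0 q1] qa _] := hq _ yx.
  case: (leP x a) => [xa|_]; last by rewrite /=; lra.
  have : q.[y x] <= rho ^+ N.
    apply: (le_trans qa); apply: le_rho1; rewrite /y lef_pV2 ?posrE ?ltr_wpDl//.
    by rewrite lerD2r le_max xa.
  rewrite /=; lra.
- by apply: admissibleD => //; [exact: admissible_le|exact: admissible_cst].
- move=> x x0; have yx := y_range x0; have /andP[yx0 yx1] := yx.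
  have [/andP[q0 q1] _ qb] := hq _ yx.
  case: (leP x b) => [_|xb]; first by rewrite /=; lra.
  have : (y x / y md) ^+ N <= rho ^+ N.
    apply: le_rho2 => //; rewrite /y lef_pV2 ?posrE ?ltr_wpDl// ?lerD2r ltW//.
  rewrite /=; lra.
Qed.

Let cdf_limits (a b e : R) : a < b -> 0 < e ->
  \forall n \near \oo, cdf (Ln n) a <= cdf L b + e /\ cdf L a <= cdf (Ln n) b + e.
Proof.
move=> ab e0; have [b0|b0] := ltP 0 b; last first.
  have a0 : a < 0 by apply: lt_le_trans b0.
  near=> n; rewrite (cdf_neg hL a0) (cdf_neg (hLn n) a0).
  by split; (apply: addr_ge0; [exact: cdf_ge0|exact: ltW]).
have e3 : 0 < e / 3 by rewrite divr_gt0.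
have [q hq] := cdf_sandwich ab b0 e3.
have [h1 h2] := hq _ hL.
have := @poly_cvg q => /cvgrPdist_lt /(_ _ e3); apply: filterS => n.
have [h3 h4] := hq _ (hLn n).
by rewrite ltr_norml => /andP[h5 h6]; split; lra.
Unshelve. all: by end_near. Qed.

Lemma cdf_cvg (x0 : R) : {for x0, continuous (cdf L)} ->
  cdf (Ln n) x0 @[n --> \oo] --> cdf L x0.
Proof.
move=> cx; apply/cvgrPdist_le => e e0.
have e2 : 0 < e / 2 by rewrite divr_gt0.
have /cvgrPdist_lt /(_ _ e2) := cx => -[dl /= dl0 hdl].
pose r := dl / 2.
have r0 : 0 < r by rewrite divr_gt0.
have h1 : `|cdf L x0 - cdf L (x0 + r)| < e / 2.
  apply: hdl; rewrite /ball_ /= opprD addNKr normrN gtr0_norm// /r; lra.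
have h2 : `|cdf L x0 - cdf L (x0 - r)| < e / 2.
  apply: hdl; rewrite /ball_ /= opprB addrC subrK gtr0_norm// /r; lra.
have x1 : x0 < x0 + r by rewrite ltrDl.
have x2 : x0 - r < x0 by rewrite gtrBl.
near=> n.
have [h3 _] : cdf (Ln n) x0 <= cdf L (x0 + r) + e / 2 /\ cdf L x0 <= cdf (Ln n) (x0 + r) + e / 2.
  by near: n; exact: cdf_limits.
have [_ h4] : cdf (Ln n) (x0 - r) <= cdf L x0 + e / 2 /\
    cdf L (x0 - r) <= cdf (Ln n) x0 + e / 2.
  by near: n; exact: cdf_limits.
move: h1 h2; rewrite !ltr_norml ler_norml => /andP[? ?] /andP[? ?].
by apply/andP; split; lra.
Unshelve. all: by end_near. Qed.

End positive_functionals.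

(** * The Marchenko-Pastur functional *)

Section marchenko_pastur.
Context {R : realType}.
Variable lam : R.
Hypothesis lam0 : 0 < lam.

Local Notation leb := (@lebesgue_measure R).

Let a : R := (1 - Num.sqrt lam) ^+ 2.
Let b : R := (1 + Num.sqrt lam) ^+ 2.

Let rt0 : 0 < Num.sqrt lam. Proof. by rewrite sqrtr_gt0. Qed.
Let rt2 : Num.sqrt lam ^+ 2 = lam. Proof. by rewrite sqr_sqrtr// ltW. Qed.
Let a0 : 0 <= a. Proof. exact: sqr_ge0. Qed.
Let ab : a < b. Proof. by rewrite /a /b -subr_gt0 (_ : _ - _ = 4 * Num.sqrt lam) ?mulr_gt0//; ring. Qed.
Let addab : a + b = 2 * (1 + lam).
Proof. by rewrite -[in RHS]rt2 /a /b; ring. Qed.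
Let mulab (t : R) : (a + t) * (b + t) = (t + 1 - lam) ^+ 2 + 4 * lam * t.
Proof.
have -> : (a + t) * (b + t) = a * b + (a + b) * t + t ^+ 2 by ring.
have -> : a * b = (1 - lam) ^+ 2 by rewrite -[in RHS]rt2 /a /b; ring.
by rewrite addab; ring.
Qed.

(** [Num.sqrt] vanishes on negative numbers, so the positive part in the density is built in. *)
Let S (x : R) : R := Num.sqrt ((b - x) * (x - a)).

Let S_off x : x \notin `[a, b] -> S x = 0.
Proof.
rewrite in_itv /= negb_and -!ltNge => h; apply: ler0_sqrtr.
case/orP: h => h; [rewrite mulr_ge0_le0// ?subr_ge0 ?subr_le0|
  rewrite mulr_le0_ge0// ?subr_ge0 ?subr_le0] => //; last by rewrite ltW// (lt_trans ab).
- by rewrite ltW// (lt_trans h).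
- by rewrite ltW.
- by rewrite ltW.
Qed.

Let mp_densityE x : mp_density lam x = (2 * pi * lam)^-1 * (S x / x).
Proof.
rewrite /mp_density -/a -/b; case: ltP => x0.
  have -> : Num.sqrt (Num.max 0 ((b - x) * (x - a))) = S x.
    rewrite /S; case: (leP 0 ((b - x) * (x - a))) => // h.
    by rewrite sqrtr0 ler0_sqrtr// ltW.
  by rewrite invfM; ring.
have -> : S x = 0; last by rewrite mul0r mulr0.
apply: ler0_sqrtr; rewrite mulr_ge0_le0// ?subr_ge0 ?subr_le0.
  by apply: (le_trans x0); apply: ltW; apply: le_lt_trans ab.
exact: (le_trans x0).
Qed.

Let mS : measurable_fun setT S.
Proof.
apply: continuous_measurable_fun => x; apply: continuous_comp; last exact: sqrt_continuous.
by apply: cvgM; apply: cvgB => //; exact: cvg_cst.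
Qed.

Let mquot (t : R) : measurable_fun setT (fun x => S x / (x + t)).
Proof.
apply: measurable_funM => //; apply: measurable_invr.
by apply: measurable_funD => //; exact: measurable_cst.
Qed.

Let val (t : R) : R := pi * ((a + b) / 2 + t - Num.sqrt ((a + t) * (b + t))).

Let int_t (t : R) : 0 < t -> (\int[leb]_(x in `[a, b]) (S x / (x + t))%:E = (val t)%:E)%E.
Proof. by move=> t0; apply: semicircle_integral => //; rewrite ltr_wpDl. Qed.

Let S0 x : 0 <= S x. Proof. exact: sqrtr_ge0. Qed.

Let quot_ge0 (t x : R) : 0 <= t -> x \in `[a, b] -> 0 <= S x / (x + t).
Proof.
move=> t0; rewrite in_itv /= => /andP[ax _]; rewrite divr_ge0// addr_ge0//.
exact: le_trans ax.
Qed.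

Let h (n : nat) : R := n.+1%:R^-1.
Let h0 n : 0 < h n. Proof. by rewrite invr_gt0 ltr0n. Qed.
Let h_cvg : h n @[n --> \oo] --> (0 : R).
Proof. exact: cvg_harmonic. Qed.

Let val_cvg : val (h n) @[n --> \oo] --> val 0.
Proof.
apply: cvgM; first exact: cvg_cst.
apply: cvgB; first by apply: cvgD => //; exact: cvg_cst.
apply: continuous_cvg; first exact: sqrt_continuous.
by apply: cvgM; apply: cvgD => //; exact: cvg_cst.
Qed.

Let quot_cvg x : x \in `[a, b] -> S x / (x + h n) @[n --> \oo] --> S x / x.
Proof.
rewrite in_itv /= => /andP[ax xb].
have [x0|x0] := ltP 0 x.
  apply: cvgM; first exact: cvg_cst.
  apply: cvgV; first by rewrite gt_eqF.
  by rewrite -[X in _ --> X]addr0; apply: cvgD => //; exact: cvg_cst.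
have xE : x = 0 by apply/eqP; rewrite eq_le x0 (le_trans a0).
have aE : a = 0 by apply/eqP; rewrite eq_le a0 -xE ax.
rewrite (_ : S x = 0); last by rewrite /S xE aE !subr0 mulr0 sqrtr0.
by rewrite mul0r; under eq_fun do rewrite mul0r; exact: cvg_cst.
Qed.

(** For lam = 1 the left end [a] is 0 and the integrand is singular there, outside the scope of
    [semicircle_integral]. Monotone convergence along the shifts 1 / (n + 1) covers all [lam]
    together. *)
Let int_0 : (\int[leb]_(x in `[a, b]) (S x / x)%:E = (val 0)%:E)%E.
Proof.
pose g' n x := (S x / (x + h n))%:E.
have mg n : measurable_fun `[a, b] (g' n).
  by apply: measurable_funTS; apply/measurable_EFinP; exact: mquot.
have g0 n x : `[a, b]%classic x -> (0 <= g' n x)%E.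
  by move=> xab; rewrite lee_fin quot_ge0// ltW.
have ndg x : `[a, b]%classic x -> nondecreasing_seq (g'^~ x).
  move=> xab m n mn; rewrite lee_fin ler_wpM2l//.
  have x0 : 0 <= x by move: xab; rewrite /= in_itv /= => /andP[ax _]; exact: le_trans ax.
  rewrite lef_pV2 ?posrE ?ltr_wpDl// lerD2l lef_pV2 ?posrE ?ltr0n//.
  by rewrite ler_nat.
have cv := @cvg_monotone_convergence _ _ R leb `[a, b]%classic (measurable_itv _) g' mg g0 ndg.
have -> : (\int[leb]_(x in `[a, b]) (S x / x)%:E =
    \int[leb]_(x in `[a, b]) (limn (g'^~ x)))%E.
  apply: eq_integral => x; rewrite inE => xab; apply/esym/cvg_lim => //.
  by apply: cvg_EFin; [near=> n|exact: quot_cvg].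
have cv' : (\int[leb]_(x in `[a, b]) g' n x)%E @[n --> \oo] --> ((val 0)%:E)%E.
  under eq_fun do rewrite /g' int_t//.
  by apply: cvg_EFin; [near=> n|exact: val_cvg].
exact: (cvg_unique _ cv cv').
Unshelve. all: by end_near. Qed.

Let itg_t (t : R) : 0 <= t -> leb.-integrable `[a, b] (fun x => (S x / (x + t))%:E).
Proof.
move=> t0; apply/integrableP; split.
  by apply: measurable_funTS; apply/measurable_EFinP; exact: mquot.
have -> : (\int[leb]_(x in `[a, b]) `|(S x / (x + t))%:E| =
    \int[leb]_(x in `[a, b]) (S x / (x + t))%:E)%E.
  by apply: eq_integral => x; rewrite inE => xab /=; rewrite ger0_norm// quot_ge0.
move: t0; rewrite le_eqVlt => /orP[/eqP <-|t0]; last by rewrite int_t// ltry.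
by under eq_integral do rewrite addr0; rewrite int_0 ltry.
Qed.

Let mmp : measurable_fun setT (mp_density lam).
Proof.
have -> : mp_density lam = (fun x => (2 * pi * lam)^-1 * (S x / (x + 0))).
  by apply/funext => x; rewrite mp_densityE addr0.
by apply: measurable_funM; [exact: measurable_cst|exact: mquot].
Qed.

Let pl0 : 0 < 2 * pi * lam.
Proof. by rewrite !mulr_gt0// pi_gt0. Qed.

Let mp_ge0 x : 0 <= mp_density lam x.
Proof.
rewrite /mp_density; case: ifP => // x0.
by rewrite divr_ge0 ?sqrtr_ge0// mulr_ge0// ltW.
Qed.

Let mp_neg x : x <= 0 -> mp_density lam x = 0.
Proof. by move=> x0; rewrite /mp_density ltNge x0. Qed.

Let mp_off x : x \notin `[a, b] -> mp_density lam x = 0.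
Proof. by move=> xab; rewrite mp_densityE S_off// mul0r mulr0. Qed.

Let Rint_mp (f : R -> R) :
  (\int[leb]_x (f x * mp_density lam x))%R =
  (\int[leb]_(x in `[a, b]) (f x * mp_density lam x))%R.
Proof.
rewrite [RHS]Rintegral_mkcond; apply: eq_Rintegral => x _; rewrite patchE.
by case: ifPn => //; rewrite mem_setE => /mp_off ->; rewrite mulr0.
Qed.

Let itg_mp : leb.-integrable setT (fun x => (mp_density lam x)%:E).
Proof.
have h1 : leb.-integrable `[a, b]
    (fun x => (((2 * pi * lam)^-1)%:E * (S x / (x + 0))%:E)%E).
  by apply: integrableZl => //; exact: itg_t.
have h2 : leb.-integrable `[a, b] (fun x => (mp_density lam x)%:E).
  by apply: eq_integrable h1 => // x _; rewrite mp_densityE addr0 -EFinM.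
have h3 : leb.-integrable setT ((fun x => (mp_density lam x)%:E) \_ `[a, b]).
  have [h3 _] := @integrable_mkcond _ _ R leb `[a, b]%classic
    (fun x => (mp_density lam x)%:E) (measurable_itv `[a, b]); exact: h3.
apply: eq_integrable h3 => // x _; rewrite patchE.
by case: ifPn => //; rewrite mem_setE => /mp_off ->.
Qed.

Let itg_adm f : admissible f -> leb.-integrable setT (fun x => (f x * mp_density lam x)%:E).
Proof.
move=> [mf [C hC]].
have := integrableZl measurableT C itg_mp => h1.
apply: le_integrable h1 => //.
  by apply/measurable_EFinP; exact: measurable_funM.
move=> x _ /=; rewrite lee_fin !normrM.
have [x0|x0] := leP x 0; first by rewrite mp_neg// normr0 !mulr0.
by rewrite ler_wpM2r// (le_trans (hC _ (ltW x0)))// ler_norm.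
Qed.

Let atom : R := if 1 < lam then 1 - lam^-1 else 0.

Let atom_ge0 : 0 <= atom.
Proof.
by rewrite /atom; case: ifPn => // l1; rewrite subr_ge0 invf_le1// ltW.
Qed.

Definition mp_mean (f : R -> R) : R :=
  (if 1 < lam then 1 - lam^-1 else 0) * f 0 +
  (\int[leb]_x (f x * mp_density lam x))%R.

(** The source of the atom: divided by 2 pi lam, this is the mass of the continuous part, namely 1
    for lam <= 1 and 1 / lam otherwise. *)
Let val0 : val 0 = pi * (1 + lam - `|1 - lam|).
Proof.
rewrite /val mulab mulr0 !addr0 add0r sqrtr_sqr addab; congr (_ * _); lra.
Qed.

Let Rint_t t : 0 < t -> (\int[leb]_(x in `[a, b]) (S x / (x + t)))%R = val t.
Proof. by move=> t0; rewrite /Rintegral int_t. Qed.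

Let Rint_0 : (\int[leb]_(x in `[a, b]) (S x / x))%R = val 0.
Proof. by rewrite /Rintegral int_0. Qed.

Let itg_0 : leb.-integrable `[a, b] (fun x => (S x / x)%:E).
Proof. by apply: eq_integrable (itg_t (lexx 0)) => // x _; rewrite addr0. Qed.

Lemma mp_mean_functional : mean_functional mp_mean.
Proof.
split.
- move=> c f g af ag; rewrite /mp_mean.
  have -> : (\int[leb]_x ((c * f x + g x) * mp_density lam x))%R =
      (c * (\int[leb]_x (f x * mp_density lam x)) + \int[leb]_x (g x * mp_density lam x))%R.
    rewrite -RintegralZl//; last exact: itg_adm.
    rewrite -RintegralD//; [|exact: (integrableZl measurableT c (itg_adm af))|exact: itg_adm].
    by apply: eq_Rintegral => x _; ring.
  ring.
- move=> f g af ag fg; rewrite /mp_mean lerD//.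
    by rewrite ler_wpM2l//; exact: fg.
  apply: le_Rintegral => //; [exact: itg_adm|exact: itg_adm|].
  move=> x _; have [x0|x0] := leP x 0; first by rewrite mp_neg// !mulr0.
  by rewrite ler_wpM2r// fg// ltW.
- rewrite /mp_mean Rint_mp mulr1.
  have -> : (\int[leb]_(x in `[a, b]) (1 * mp_density lam x))%R = (2 * pi * lam)^-1 * val 0.
    rewrite -Rint_0 -RintegralZl//.
    by apply: eq_Rintegral => x _; rewrite mul1r mp_densityE.
  rewrite val0; have pi0 : pi != 0 :> R by rewrite gt_eqF// pi_gt0.
  have l0 : lam != 0 by rewrite gt_eqF.
  move: (pi : R) pi0 => q pi0.
  case: ltP => l1.
    by rewrite ler0_norm ?subr_le0 ?(ltW l1)//; field; rewrite ?pi0 ?l0.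
  by rewrite ger0_norm ?subr_ge0//; field; rewrite ?pi0 ?l0.
Qed.

(** The partial fractions 1 / (x (x + t)) = (1 / x - 1 / (x + t)) / t reduce the integral to [val 0]
    and [val t]. The absolute value in [val 0] combines with the atom, so that a single formula
    holds for every [lam]. *)
Lemma mp_mean_stieltjes t : 0 < t ->
  mp_mean (fun x => (x + t)^-1) = mp_stieltjes lam t.
Proof.
move=> t0; rewrite /mp_mean Rint_mp.
have -> : (\int[leb]_(x in `[a, b]) ((x + t)^-1 * mp_density lam x))%R =
    (2 * pi * lam * t)^-1 * (val 0 - val t).
  rewrite -Rint_0 -(Rint_t t0) -RintegralB//; last exact: (itg_t (ltW t0)).
  rewrite -RintegralZl//; last first.
    have ib : leb.-integrable `[a, b] (fun x => ((S x / x)%:E - (S x / (x + t))%:E)%E).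
      by apply: integrableB => //; exact: (itg_t (ltW t0)).
    by apply: eq_integrable ib.
  apply: eq_Rintegral => x; rewrite inE /= in_itv /= => /andP[ax xb].
  have xt : x + t != 0 by rewrite gt_eqF// ltr_wpDl// (le_trans a0).
  rewrite mp_densityE.
  have pi0 : pi != 0 :> R by rewrite gt_eqF// pi_gt0.
  have l0 : lam != 0 by rewrite gt_eqF.
  have t0' : t != 0 by rewrite gt_eqF.
  have [xE|x0] := eqVneq x 0.
    have aE : a = 0 by apply/eqP; rewrite eq_le a0 -xE ax.
    by rewrite (_ : S x = 0) ?(mul0r, mulr0, subrr)// /S xE aE !subr0 mulr0 sqrtr0.
  move: (pi : R) pi0 => q pi0.
  by field; rewrite ?pi0 ?l0 ?t0' ?xt ?x0.
rewrite val0 /val mulab addab /mp_stieltjes add0r.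
set r := Num.sqrt _.
have pi0 : pi != 0 :> R by rewrite gt_eqF// pi_gt0.
have l0 : lam != 0 by rewrite gt_eqF.
have t0' : t != 0 by rewrite gt_eqF.
move: (pi : R) pi0 => q pi0.
case: ltP => l1.
  by rewrite ler0_norm ?subr_le0 ?(ltW l1)//; field; rewrite ?pi0 ?l0 ?t0'.
by rewrite ger0_norm ?subr_ge0//; field; rewrite ?pi0 ?l0 ?t0'.
Qed.

Lemma mp_mean_cdf x0 : mean_cdf mp_mean x0 = mp_cdf lam x0.
Proof.
rewrite /mean_cdf /mp_mean /mp_cdf; congr (_ + _).
  by case: ifP => // _; rewrite mul0r.
transitivity (Rintegral leb `]-oo, x0]%classic (mp_density lam)); last by [].
rewrite [RHS]Rintegral_mkcond.
apply: eq_Rintegral => x _; rewrite patchE mem_setE in_itv /=.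
by case: (x <= x0)%R; rewrite ?mul1r ?mul0r.
Qed.

End marchenko_pastur.

(** * Spectra of real symmetric matrices *)

Module RealSpectral.
Import spectral complex.
Local Open Scope complex_scope.

Section real_spectral.
Context {R : realType} {p : nat}.
Variable W : 'M[R]_p.
Hypothesis hW : psd W.

Local Notation toC := (real_complex R).

Let WC : 'M[R[i]]_p := map_mx toC W.

Let herm : WC \is hermsymmx.
Proof.
apply: realsym_hermsym.
  apply/is_hermitianmxP; rewrite expr0 scale1r; apply/matrixP => i j.
  by rewrite !mxE -{1}(proj1 hW) mxE.
by apply/mxOverP => i j; rewrite mxE complex_real.
Qed.

Let Q := spectralmx WC.
Let sp := spectral_diag WC.

Let WCE : WC = invmx Q *m diag_mx sp *m Q.
Proof. exact/orthomx_spectralP/hermitian_normalmx/herm. Qed.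

Let Qu : Q \in unitmx. Proof. exact: spectral_unit. Qed.

Let r (i : 'I_p) : R := complex.Re (sp 0 i).

Let spE i : sp 0 i = (r i)%:C.
Proof.
have /mxOverP h := hermitian_spectral_diag_real herm.
by rewrite /r RRe_real//; exact: h.
Qed.

(** [W] is diagonalized as a complex Hermitian matrix. Its complex eigenvalues are real, so the
    factorization holds over R by injectivity of the embedding. *)
Let char_poly_prod : char_poly W = \prod_i ('X - (r i)%:P).
Proof.
apply: (@map_poly_inj _ _ toC); rewrite map_char_poly -/WC rmorph_prod /=.
transitivity (char_poly (diag_mx sp)).
  rewrite WCE /char_poly /char_poly_mx.
  set V := map_mx polyC (invmx Q); set U := map_mx polyC Q.
  have VU : V *m U = 1%:M by rewrite -map_mxM mulVmx// map_mx1.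
  have -> : 'X%:M - map_mx polyC (invmx Q *m diag_mx sp *m Q) =
      V *m ('X%:M - map_mx polyC (diag_mx sp)) *m U.
    rewrite mulmxBr mulmxBl !map_mxM -/V -/U; congr (_ - _).
    by rewrite mul_mx_scalar -scalemxAl VU scale_scalar_mx mulr1.
  by rewrite !det_mulmx mulrC mulrA -det_mulmx (mulmx1C VU) det1 mul1r.
rewrite char_poly_trig; last exact: diag_mx_is_trig.
apply: eq_bigr => i _; rewrite rmorphB /= map_polyX map_polyC /=.
by rewrite mxE eqxx mulr1n spE.
Qed.

Let r_ge0 i : 0 <= r i.
Proof.
have : eigenvalue W (r i).
  rewrite eigenvalue_root_char char_poly_prod /root horner_prod (bigD1 i)//=.
  by rewrite hornerXsubC subrr mul0r.
case/eigenvalueP => v vW v0.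
have := (proj2 hW) v; rewrite vW dotvZl.
have : 0 < dotv v v.
  by rewrite lt_neqAle dotv_ge0 andbT eq_sym; apply: contraNN v0 => /eqP/dotv_eq0 ->.
by move=> h; rewrite pmulr_lge0.
Qed.

(** [eigenvalues] is an arbitrary choice among root sequences. [char_poly_prod] shows that one
    exists, which excludes the default value, and unique factorization makes any two agree up to
    order. *)
Let eigs : perm_eq (eigenvalues W) [seq r i | i <- enum 'I_p].
Proof.
have : char_poly W = \prod_(x <- eigenvalues W) ('X - x%:P).
  rewrite /eigenvalues; case: xgetP => [s _ //|/(_ [seq r i | i <- enum 'I_p]) []].
  by rewrite /= big_map char_poly_prod big_enum.
rewrite char_poly_prod -big_enum -(big_map r predT (fun x => 'X - x%:P)) /=.
by move=> e; rewrite perm_sym; exact: prod_XsubC_eq e.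
Qed.

Lemma size_eigenvalues : size (eigenvalues W) = p.
Proof. by rewrite (perm_size eigs) size_map size_enum_ord. Qed.

Lemma eigenvalues_ge0 x : x \in eigenvalues W -> 0 <= x.
Proof. by rewrite (perm_mem eigs) => /mapP[i _ ->]. Qed.

Lemma trace_resolvent_eigenvalues (t : R) : 0 < t ->
  \tr (resolvent t W) = \sum_(x <- eigenvalues W) (x + t)^-1.
Proof.
move=> t0; rewrite (perm_big _ eigs) big_map big_enum /=.
apply: (@complexI R); rewrite -trace_map_mx rmorph_sum /=.
pose E := \row_i (((r i + t)^-1)%:C).
have -> : map_mx toC (resolvent t W) = invmx Q *m diag_mx E *m Q.
  have u := psd_shift_unit t0 hW.
  have h : map_mx toC (W + t%:M) *m (invmx Q *m diag_mx E *m Q) = 1%:M.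
    rewrite map_mxD map_scalar_mx -/WC WCE.
    have -> : invmx Q *m diag_mx sp *m Q + (t%:C)%:M =
        invmx Q *m (diag_mx sp + (t%:C)%:M) *m Q.
      rewrite mulmxDr mulmxDl; congr (_ + _).
      by rewrite mul_mx_scalar -scalemxAl mulVmx// scale_scalar_mx mulr1.
    rewrite !mulmxA mulmxK// -[invmx Q *m _ *m _]mulmxA.
    have -> : (diag_mx sp + (t%:C)%:M) *m diag_mx E = 1%:M.
      apply/matrixP => i j; rewrite mulmxDl mul_diag_mx mul_scalar_mx !mxE.
      have rt : r i + t != 0 by rewrite gt_eqF// ltr_wpDl.
      case: eqP => [_|_]; last by rewrite !mulr0n !mulr0 addr0.
      by rewrite !mulr1n spE -mulrDl -rmorphD -rmorphM mulfV// rmorph1.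
    by rewrite mulmx1 mulVmx.
  rewrite /resolvent map_invmx.
  have u' : map_mx toC (W + t%:M) \in unitmx by rewrite map_unitmx.
  by rewrite -[RHS](mulKmx u') h mulmx1.
rewrite mxtrace_mulC mulmxA mulmxV// mul1mx mxtrace_diag.
by apply: eq_bigr => i _; rewrite mxE.
Qed.

End real_spectral.
End RealSpectral.

(** * Almost sure convergence *)

Import RealSpectral.

Section almost_sure.
Context {R : realType} {d : measure_display} {T : measurableType d}.
Variable P : probability T R.

(** The series of the f_n has a finite integral, hence is finite almost everywhere, and the terms of
    a convergent series tend to 0. No independence between different n is involved. *)
Lemma ae_cvg0_summable (f : nat -> T -> R) (B : R) :
  (forall n, measurable_fun setT (f n)) -> (forall n w, 0 <= f n w) ->
  (forall N, (\sum_(0 <= n < N) \int[P]_w (f n w)%:E <= B%:E)%E) ->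
  {ae P, forall w, f n w @[n --> \oo] --> (0 : R)}.
Proof.
move=> mf f0 fB.
have mE n : measurable_fun setT (fun w => (f n w)%:E) by exact/measurable_EFinP.
have fE0 n w : setT w -> (0 <= (f n w)%:E)%E by rewrite lee_fin.
have iS : P.-integrable setT (fun w => \sum_(0 <= n <oo) (f n w)%:E)%E.
  apply/integrableP; split.
    by apply: (@ge0_emeasurable_sum _ _ _ _ (fun n w => (f n w)%:E) predT) => // n w _ _; rewrite lee_fin.
  under eq_integral => w _.
    rewrite gee0_abs; last by apply: nneseries_ge0 => n _ _; rewrite lee_fin.
    over.
  rewrite /= integral_nneseries//; apply: le_lt_trans (ltry B).
  apply: lime_le; last by apply: nearW => N; exact: fB.
  by apply: is_cvg_nneseries => n _ _; apply: integral_ge0 => w _; rewrite lee_fin.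
have := integrable_ae measurableT iS.
apply: filterS => w /(_ Logic.I) /fineK hw.
apply: cvg_series_cvg_0; apply: nondecreasing_is_cvgn.
  by apply/nondecreasing_seqP => n; rewrite !seriesEnat /= big_nat_recr//= lerDl.
exists (fine (\sum_(0 <= n <oo) (f n w)%:E)%E) => _ [N _ <-].
rewrite -lee_fin hw seriesEnat /= -sumEFin.
by apply: nneseries_lim_ge => n _ _; rewrite lee_fin.
Qed.

End almost_sure.

Lemma sum_inv_sqr_le (R : realType) N : \sum_(0 <= n < N) (n.+1%:R^-1 ^+ 2) <= 2 :> R.
Proof.
(* The bound telescopes: 1 / a^2 <= 2 / a - 2 / (a + 1) for a >= 1. *)
suff : \sum_(0 <= n < N) (n.+1%:R^-1 ^+ 2) <= 2 - 2 / N.+1%:R :> R.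
  by move=> /le_trans; apply; rewrite gerBl divr_ge0.
elim: N => [|N IH]; first by rewrite big_geq// divr1 subrr.
rewrite big_nat_recr//=; apply: le_trans (lerD IH (lexx _)) _.
have a1 : 1 <= N.+1%:R :> R by rewrite ler1n.
have -> : N.+2%:R = N.+1%:R + 1 :> R by rewrite -natr1.
set a : R := N.+1%:R in a1 *.
have a0 : 0 < a by apply: lt_le_trans a1.
rewrite -subr_ge0 (_ : _ - _ = (a - 1) / (a ^+ 2 * (a + 1))).
  by rewrite divr_ge0 ?subr_ge0// mulr_ge0 ?sqr_ge0// addr_ge0// ltW.
by field; rewrite !gt_eqF// addr_gt0.
Qed.

Section empirical.
Context {R : realType}.

Definition empirical_mean (s : seq R) (f : R -> R) : R :=
  (\sum_(x <- s) f x) / (size s)%:R.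

Lemma empirical_mean_functional (s : seq R) : (0 < size s)%N ->
  (forall x, x \in s -> 0 <= x) -> mean_functional (empirical_mean s).
Proof.
move=> s0 sp; split.
- move=> c f g _ _; rewrite /empirical_mean big_split /= -mulr_sumr; ring.
- move=> f g _ _ fg; rewrite ler_wpM2r// big_seq [X in _ <= X]big_seq.
  by apply: ler_sum => x /sp; exact: fg.
- rewrite /empirical_mean big_const_seq count_predT iter_addr_0.
  by rewrite divff// pnatr_eq0 -lt0n.
Qed.

Lemma esdE n (W : 'M[R]_n) x : size (eigenvalues W) = n ->
  esd W x = mean_cdf (empirical_mean (eigenvalues W)) x.
Proof.
move=> sW; rewrite /esd /mean_cdf /empirical_mean sW; congr (_ / _).
by elim: (eigenvalues W) => [|r s IH]; rewrite ?big_nil ?big_cons//= natrD IH.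
Qed.

End empirical.

(** * Almost sure limit of the resolvent trace at a fixed shift *)

Section main.
Context {R : realType} {d : measure_display} {T : measurableType d}.
Variable P : probability T R.
Variables (p m : nat -> nat) (blk : forall n, 'I_(p n) -> nat).
Variables (X : forall n, 'I_(p n) -> 'I_(m n) -> {RV P >-> R}) (lam C : R).
Arguments X : clear implicits.
Arguments blk : clear implicits.
Hypothesis p0 : forall n, (0 < p n)%N.
Hypothesis pS : forall n, (p n < p n.+1)%N.
Hypothesis m0 : forall n, (0 < m n)%N.
Hypothesis indcol : forall n, indep_groups P
  (fun ik : 'I_(p n) * 'I_(m n) => X n ik.1 ik.2 : T -> R) (fun ik => ik.2).
Hypothesis indblk : forall n (k : 'I_(m n)),
  indep_groups P (fun i => X n i k : T -> R) (blk n).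

Local Notation itg f := (P.-integrable setT (fun w => (f w)%:E)).
Local Notation Ex f := (\int[P]_w f w)%R.

Hypothesis EX1 : forall n i k, Ex (X n i k) = 0.
Hypothesis EX2 : forall n i j k, Ex (fun w => X n i k w * X n j k w) = (i == j)%:R.
Hypothesis iX4 : forall n i k, itg (fun w => X n i k w ^+ 4).
Hypothesis EX4 : forall n i k, Ex (fun w => X n i k w ^+ 4) <= C.
Hypothesis lam0 : 0 < lam.
Hypothesis ratio_cvg : ((p n)%:R / (m n)%:R : R) @[n --> \oo] --> lam.
Hypothesis block_cvg : ((max_block (blk n))%:R / (p n)%:R : R) @[n --> \oo] --> (0 : R).

Variable t : R.
Hypothesis t0 : 0 < t.

Let stat n : T -> R := trace_stat (fun i k => X n i k : T -> R) t.

Let p_ge n : (n < p n)%N.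
Proof. by elim: n => [|n IH]; [exact: p0|exact: leq_ltn_trans (pS n)]. Qed.

Let pR n : 0 < (p n)%:R :> R. Proof. by rewrite ltr0n. Qed.
Let mR n : 0 < (m n)%:R :> R. Proof. by rewrite ltr0n. Qed.

Let pinv_le n : (p n)%:R^-1 <= n.+1%:R^-1 :> R.
Proof. by rewrite lef_pV2 ?posrE ?ltr0n// ler_nat. Qed.

Let pinv_cvg : ((p n)%:R^-1 : R) @[n --> \oo] --> (0 : R).
Proof.
apply: (squeeze_cvgr (f := fun=> 0) (h := harmonic)).
- by apply: nearW => n; rewrite invr_ge0 ler0n/= /harmonic pinv_le.
- exact: cvg_cst.
- exact: cvg_harmonic.
Qed.

Lemma trace_stat_mean_cvg : Ex (stat n) @[n --> \oo] --> mp_stieltjes lam t.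
Proof.
pose al n : R := (max_block (blk n))%:R / (p n)%:R.
pose be n : R := (p n)%:R / (m n)%:R.
pose ga n : R := (p n)%:R^-1.
(* The bound of [trace_stat_mean] rewritten in the three ratios with known limits: 1 / m^2 becomes
   (p / m)^2 / p^2, and one factor 1 / p joins the block size to form [al]. *)
pose bound n : R := 4 * be n ^+ 2 * ((2 * C * al n + 4 * ga n) * t^-1 ^+ 2 +
  ga n ^+ 2 * t^-1 ^+ 2) + 2 * (lam - be n) ^+ 2 * (1 + t^-1) ^+ 2.
have bound_cvg : bound n @[n --> \oo] --> (0 : R).
  have -> : 0 = 4 * lam ^+ 2 * ((2 * C * 0 + 4 * 0) * t^-1 ^+ 2 + 0 ^+ 2 * t^-1 ^+ 2) +
    2 * (lam - lam) ^+ 2 * (1 + t^-1) ^+ 2 by ring.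
  have sq (u : nat -> R) (l : R) : u n @[n --> \oo] --> l -> u n ^+ 2 @[n --> \oo] --> l ^+ 2.
    by move=> ul; rewrite expr2; under eq_fun do rewrite expr2; exact: cvgM.
  have cst (c : R) : c @[_ --> \oo] --> c by exact: cvg_cst.
  apply: cvgD.
    apply: cvgM; first by apply: cvgM => //; exact: sq.
    apply: cvgD; last by apply: cvgM => //; exact: sq.
    apply: cvgM => //; apply: cvgD; apply: cvgM => //.
  by apply: cvgM => //; apply: cvgM => //; apply: sq; exact: cvgB.
have hb n : (lam * t) ^+ 2 * (Ex (stat n) - mp_stieltjes lam t) ^+ 2 <= bound n.
  have := @trace_stat_mean R d T P (p n) (m n) (fun i k => X n i k) (blk n) C t (p0 n) (m0 n)
    t0 (fun i k => measurable_funPT (X n i k)) (@indcol n) (@indblk n) (@EX1 n) (@EX2 n)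
    (@iX4 n) (@EX4 n) lam lam0.
  move=> /le_trans; apply; rewrite le_eqVlt; apply/orP; left; apply/eqP.
  by rewrite /bound /al /be /ga; field; rewrite !gt_eqF.
apply/cvgrPdist_lt => e e0.
have lt0 : 0 < lam * t by rewrite mulr_gt0.
have e1 : 0 < (lam * t) ^+ 2 * e ^+ 2 by rewrite mulr_gt0 ?exprn_gt0.
have /cvgrPdist_lt /(_ _ e1) := bound_cvg; apply: filterS => n.
rewrite sub0r normrN => /(le_lt_trans (ler_norm _)) /(le_lt_trans (hb n)).
rewrite ltr_pM2l ?exprn_gt0// distrC -real_normK ?num_real//.
by rewrite ltr_pXn2r ?nnegrE// ltW.
Qed.

Lemma trace_stat_cvg : {ae P, forall w, stat n w @[n --> \oo] --> mp_stieltjes lam t}.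
Proof.
pose mu n := Ex (stat n).
pose f n w := (stat n w - mu n) ^+ 4.
have ms n : measurable_fun setT (stat n).
  exact: (measurable_trace_stat (m0 n) t0 (fun i k => measurable_funPT (X n i k))).
have mf n : measurable_fun setT (f n).
  by apply: measurable_funX; apply: measurable_funB => //; exact: measurable_cst.
have f0 n w : 0 <= f n w by exact: exprn_even_ge0.
have hf n := @trace_stat_concentration R d T P (p n) (m n) (fun i k => X n i k) t (p0 n) (m0 n)
    t0 (fun i k => measurable_funPT (X n i k)) (@indcol n).
have itf n : itg (f n).
  have [st0 st1] : (forall w, 0 <= stat n w) /\ (forall w, t * stat n w <= 1).
    by split=> w; have [] := @trace_stat_bounds R d T (p n) (m n) (fun i k => X n i k) t
      (p0 n) (m0 n) t0 w.
  apply: (@itg_bounded _ _ _ _ _ ((t^-1 + `|mu n|) ^+ 4)) => // w.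
  rewrite normrX lerXn2r ?nnegrE ?addr_ge0 ?invr_ge0 ?(ltW t0)//.
  rewrite (le_trans (ler_normB _ _))// lerD2r ger0_norm//.
  by rewrite -[X in _ <= X]mulr1 ler_pdivlMl.
have [K hK] : exists K : R, forall n, (m n)%:R / (p n)%:R <= K.
  have cv : ((m n)%:R / (p n)%:R : R) @[n --> \oo] --> lam^-1.
    have -> : (fun n => (m n)%:R / (p n)%:R : R) = (fun n => ((p n)%:R / (m n)%:R)^-1).
      by apply/funext => n; rewrite invf_div.
    by apply: cvgV => //; rewrite gt_eqF.
  have /cvg_seq_bounded : cvgn (fun n => (m n)%:R / (p n)%:R : R) by apply/cvg_ex; exists lam^-1.
  case/pinfty_ex_gt0 => K _ hK; exists K => n.
  exact: le_trans (ler_norm _) (hK n Logic.I).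
have K0 : 0 <= K by apply: le_trans (hK 0%N); rewrite divr_ge0.
(* The n-th term is at most 11 t^-4 (m / p)^2 / p^2; the ratio m / p is bounded by [K], and p_n >= n
   + 1 by strict growth, so the sum of inverse squares, at most 2, takes over. *)
have hN N : (\sum_(0 <= n < N) \int[P]_w (f n w)%:E <= (11 * K ^+ 2 * t^-1 ^+ 4 * 2)%:E)%E.
  under eq_bigr do rewrite (EFin_Ex (itf _)).
  rewrite sumEFin lee_fin.
  apply: (@le_trans _ _ (\sum_(0 <= n < N) 11 * K ^+ 2 * t^-1 ^+ 4 * (n.+1%:R^-1 ^+ 2))).
    apply: ler_sum => n _; apply: (le_trans (hf n)).
    have -> : 11 * (m n)%:R ^+ 2 * ((p n)%:R * t)^-1 ^+ 4 =
       11 * t^-1 ^+ 4 * (((m n)%:R / (p n)%:R) ^+ 2 * (p n)%:R^-1 ^+ 2).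
      by field; rewrite !gt_eqF.
    have -> : 11 * K ^+ 2 * t^-1 ^+ 4 * n.+1%:R^-1 ^+ 2 =
      11 * t^-1 ^+ 4 * (K ^+ 2 * n.+1%:R^-1 ^+ 2) by ring.
    rewrite ler_wpM2l ?mulr_ge0 ?exprn_ge0 ?invr_ge0 ?(ltW t0)//.
    by apply: ler_pM; rewrite ?sqr_ge0//; apply: lerXn2r; rewrite ?nnegrE ?divr_ge0 ?invr_ge0.
  rewrite -mulr_sumr ler_wpM2l ?sum_inv_sqr_le//.
  apply: mulr_ge0; first by rewrite mulr_ge0 ?sqr_ge0.
  by rewrite exprn_ge0// invr_ge0 ltW.
have := ae_cvg0_summable mf f0 hN; apply: filterS => w hw.
have c0 : stat n w - mu n @[n --> \oo] --> (0 : R).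
  apply/cvgrPdist_lt => e e0; have e4 : 0 < e ^+ 4 by rewrite exprn_gt0.
  have /cvgrPdist_lt /(_ _ e4) := hw; apply: filterS => n.
  rewrite !sub0r !normrN /f normrX.
  by rewrite ltr_pXn2r ?nnegrE// ltW.
have : stat n w - mu n + mu n @[n --> \oo] --> 0 + mp_stieltjes lam t.
  by apply: cvgD => //; exact: trace_stat_mean_cvg.
by rewrite add0r; under eq_fun do rewrite subrK.
Qed.

End main.

Unset Implicit Arguments.

Theorem theorem1p3 (R : realType) (d : measure_display) (T : measurableType d)
  (P : probability T R)
  (p m : nat -> nat) (blk : forall n, 'I_(p n) -> nat)
  (X : forall n, 'I_(p n) -> 'I_(m n) -> {RV P >-> R}) (lam : R) :
  (forall n, (0 < p n)%N) ->
  (forall n, (p n < p n.+1)%N) ->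
  (forall n, (0 < m n)%N) ->
  (* columns of X^(n) are independent *)
  (forall n, indep_groups P (fun ik : 'I_(p n) * 'I_(m n) => X n ik.1 ik.2)
                            (fun ik => ik.2)) ->
  (* each column follows the block-independent model with blocks blk n *)
  (forall n (k : 'I_(m n)), indep_groups P (fun i => X n i k) (blk n)) ->
  (forall n i k, ('E_P[X n i k] = 0)%E) ->
  (forall n i i' k, ('E_P[fun w => (X n i k w * X n i' k w)%R] = (i == i')%:R%:E)%E) ->
  (* (i) *)
  0 < lam -> ((fun n => (p n)%:R / (m n)%:R) @ \oo --> lam) ->
  (* (ii) *)
  ((fun n => (max_block (blk n))%:R / (p n)%:R : R) @ \oo --> 0) ->
  (* (iii) *)
  (exists C : R, forall n i k, ('E_P[fun w => (X n i k w ^+ 4)%R] <= C%:E)%E) ->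
  {ae P, forall w, forall x : R, {for x, continuous (mp_cdf lam)} ->
     (fun n => esd (sample_cov (fun i k => X n i k w)) x) @ \oo
       --> mp_cdf lam x}.
Proof.
move=> p0 pS m0 indcol indblk EX1 EX2 lam0 ratio block [C EX4].
have mX n i k : measurable_fun setT (X n i k) := measurable_funPT (X n i k).
(* The moment bound is on an extended-real integral of a nonnegative function, so its finiteness
   also provides integrability. *)
have h4 n i k := @itg_ge0 R d T P (fun w => X n i k w ^+ 4) C
  (measurable_funX 4 (mX n i k)) (fun w => exprn_even_ge0 (X n i k w) (n := 4) isT).
have H j : {ae P, forall w,
    trace_stat (fun i k => X n i k : T -> R) (spectral_shift j) w @[n --> \oo] -->
    mp_stieltjes lam (spectral_shift j)}.
  apply: (@trace_stat_cvg R d T P p m blk X lam C) => //.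
  - by move=> n i k; have := EX1 n i k; rewrite unlock /Rintegral => ->.
  - by move=> n i i' k; have := EX2 n i i' k; rewrite unlock /Rintegral => ->.
  - by move=> n i k; have := EX4 n i k; rewrite unlock => /h4[].
  - by move=> n i k; have := EX4 n i k; rewrite unlock => /h4[].
  - exact: spectral_shift_gt0.
(* Countably many shifts give a single null set, independent of [x]; from here on [w] is fixed and
   the argument is deterministic. *)
have := ae_foralln H; apply: filterS => w hw x.
pose W n := sample_cov (fun i k => X n i k w).
have psdW n : psd (W n) by rewrite /W sample_covE; exact: gram_psd.
have sW n : size (eigenvalues (W n)) = p n by exact: size_eigenvalues.
have hL := mp_mean_functional lam0.
have hLn n : mean_functional (empirical_mean (eigenvalues (W n))).
  apply: empirical_mean_functional; first by rewrite sW.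
  exact: eigenvalues_ge0.
have -> : mp_cdf lam = mean_cdf (mp_mean lam).
  by apply/funext => y; rewrite mp_mean_cdf.
move=> cx; have := @cdf_cvg R _ _ hL hLn _ x cx.
have -> : (fun n => esd (sample_cov (fun i k => X n i k w)) x) =
    (fun n => mean_cdf (empirical_mean (eigenvalues (W n))) x).
  by apply/funext => n; rewrite esdE.
apply=> j; rewrite mp_mean_stieltjes ?spectral_shift_gt0//.
have -> : (fun n => empirical_mean (eigenvalues (W n)) (fun x => (x + spectral_shift j)^-1)) =
    (fun n => trace_stat (fun i k => X n i k : T -> R) (spectral_shift j) w); last exact: hw.
apply/funext => n; rewrite /trace_stat /empirical_mean sW.
rewrite -trace_resolvent_eigenvalues ?spectral_shift_gt0//.
by rewrite /gram_trace /W sample_covE.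
Qed.
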